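(* Let $G$ be a connected Lie group and let $(K_{(\alpha)})_{\alpha\in A}$ be a family of centered probability densities on $G$, indexed by a set $A$. Assume that (i) there exists a neighborhood $W$ of the identity $e$ with $\inf\{K_{(\alpha)}(g):g\in W,\,\alpha\in A\}>0$, and (ii) $\sup_{\alpha\in A}\int_G dg\,K_{(\alpha)}(g)e^{k\rho(g)}<\infty$ for each $k>0$. Set $T_{(\alpha)}f=K_{(\alpha)}*f$, $f\in L^p$. Then for each $p\in(1,\infty)$ there exists $c=c(p)>0$ with $$\|(I-T_{(\alpha)})T_{(\alpha)}^n\|_{p\to p}\le c\,n^{-1}$$ for all $n\in\mathbb{N}$ and $\alpha\in A$.
   Context: $\mathbb{N}=\{1,2,3,\dots\}$; $dg$ is a left Haar measure on $G$; $L^p=L^p(G;dg)$ (complex-valued); $\|\cdot\|_{p\to q}$ is the norm of bounded operators $L^p\to L^q$. Convolution: $(f_1*f_2)(g)=\int_G dh\,f_1(h)f_2(h^{-1}g)$. A probability density on $G$ is a Borel measurable $K:G\to[0,\infty)$ with $\int_G dg\,K(g)=1$. Distance: fix a relatively compact, open, symmetric ($U=U^{-1}$) neighborhood $U$ of $e$ (which generates $G$), and set $\rho(g)=\inf\{n\in\mathbb{N}: g\in U^n\}$, where $U^n=\{g_1\cdots g_n: g_i\in U\}$. Centered: let $G_0=\overline{[G,G]}$ be the closure of the commutator subgroup, $\pi_0:G\to G/G_0$ the canonical homomorphism. $G/G_0$ is a connected abelian Lie group, so $G/G_0\cong\mathbb{R}^q\times\mathbb{T}^r$ for some integers $q,r\ge0$,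 $\mathbb{T}=\mathbb{R}/\mathbb{Z}$. Put $G_1=\pi_0^{-1}(\{0\}\times\mathbb{T}^r)$, and let $\pi_1:G\to G/G_1\cong\mathbb{R}^q$ have components $\pi_1^{(i)}:G\to\mathbb{R}$. A density $K$ is centered if $\int_G dg\,K(g)\pi_1^{(i)}(g)=0$ for all $i\in\{1,\dots,q\}$. *)

(* Defs.v *)
From HB Require Import structures.
From mathcomp Require Import all_boot all_order all_algebra generic_quotient ring_quotient.
From mathcomp Require Import monoid complex.
From mathcomp Require Import all_classical all_reals all_analysis.

Set Implicit Arguments.
Unset Strict Implicit.
Unset Printing Implicit Defensive.

Import Order.TTheory GRing.Theory Num.Theory.
Import numFieldNormedType.Exports.

Local Open Scope classical_set_scope.
Local Open Scope ring_scope.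
Local Open Scope quotient_scope.

(* C^k maps between finite-dimensional spaces; meant for D open: f is
   continuous on D, all its directional derivatives exist on D and they are
   C^(k-1). *)
Fixpoint cont_diff (R : realType) (V W : normedModType R) (k : nat)
    (D : set V) (f : V -> W) : Prop :=
  (forall x, D x -> {for x, continuous f}) /\
  if k is k'.+1 then
    forall v, (forall x, D x -> derivable f x v) /\ cont_diff k' D ('D_v f)
  else True.

Definition smooth_on (R : realType) (V W : normedModType R)
    (D : set V) (f : V -> W) : Prop := forall k, cont_diff k D f.

Definition homeomorphism (X Y : topologicalType) (f : X -> Y) : Prop :=
  continuous f /\ exists g : Y -> X, [/\ cancel f g, cancel g f & continuous g].

(* The point of the carrier is irrelevant (groups are nonempty); the library
   asks for one to build the Borel measurable space. *)
HB.structure Definition PreTopologicalGroup :=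
  {G of Group G & PointedTopological G}.

HB.mixin Record PreTopologicalGroup_isTopologicalGroup G
    of PreTopologicalGroup G := {
  mulg_continuous : continuous (fun x : G * G => (x.1 * x.2)%g);
  invg_continuous : continuous (fun x : G => x^-1%g)
}.

#[short(type="topologicalGroupType")]
HB.structure Definition TopologicalGroup :=
  {G of PreTopologicalGroup G & PreTopologicalGroup_isTopologicalGroup G}.

(* A chart with values in R^d; chart_fun and chart_inv are only relevant on
   chart_dom and on chart_img respectively. *)
Record chart (R : realType) (d : nat) (X : topologicalType) := Chart {
  chart_dom : set X;
  chart_fun : X -> 'rV[R]_d;
  chart_inv : 'rV[R]_d -> X;
  chart_img := chart_fun @` chart_dom;
  chart_dom_open : open chart_dom;
  chart_img_open : open chart_img;
  chart_funK : forall x, chart_dom x -> chart_inv (chart_fun x) = x;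
  chart_fun_continuous : forall x, chart_dom x -> {for x, continuous chart_fun};
  chart_inv_continuous : forall y, chart_img y -> {for y, continuous chart_inv}
}.

HB.mixin Record TopologicalGroup_isLieGroup (R : realType) (d : nat) G
    of TopologicalGroup G := {
  lie_hausdorff : hausdorff_space G;
  lie_second_countable : @second_countable G;
  atlas : set (chart R d G);
  atlas_cover : forall x : G, exists2 c, atlas c & chart_dom c x;
  atlas_compatible : forall c1 c2, atlas c1 -> atlas c2 ->
    smooth_on (chart_fun c1 @` (chart_dom c1 `&` chart_dom c2))
      (chart_fun c2 \o chart_inv c1);
  mulg_smooth : forall c1 c2 c3, atlas c1 -> atlas c2 -> atlas c3 ->
    smooth_on
      [set y : 'rV[R]_d * 'rV[R]_d | [/\ chart_img c1 y.1, chart_img c2 y.2 &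
         chart_dom c3 (chart_inv c1 y.1 * chart_inv c2 y.2)%g]]
      (fun y => chart_fun c3 (chart_inv c1 y.1 * chart_inv c2 y.2)%g);
  invg_smooth : forall c1 c2, atlas c1 -> atlas c2 ->
    smooth_on
      [set y : 'rV[R]_d | chart_img c1 y /\ chart_dom c2 (chart_inv c1 y)^-1%g]
      (fun y => chart_fun c2 (chart_inv c1 y)^-1%g)
}.

#[short(type="lieGroupType")]
HB.structure Definition LieGroup (R : realType) (d : nat) :=
  {G of TopologicalGroup G & TopologicalGroup_isLieGroup R d G}.

Section Subgroups.
Variable G : groupType.

Definition is_subgroup (H : set G) : Prop :=
  H 1%g /\ forall x y, H x -> H y -> H (x / y)%g.

Definition commutator_subgroup : set G :=
  smallest is_subgroup [set [~ x, y]%g | x in [set: G] & y in [set: G]].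

Definition lcoset (N : set G) (g : G) : set G := [set (g * n)%g | n in N].

Definition lcoset_eq (N : set G) : rel G :=
  fun g h => `[< lcoset N g = lcoset N h >].

Lemma lcoset_eq_equiv (N : set G) : equiv_class_of (lcoset_eq N).
Proof.
split=> [g|g h|h g k]; first exact/asboolP.
- by apply/asboolP/asboolP.
- by move=> /asboolP gh /asboolP hk; apply/asboolP; rewrite gh.
Qed.

Canonical lcoset_eq_equivRel (N : set G) := EquivRelPack (lcoset_eq_equiv N).
Canonical lcoset_eq_encModRel (N : set G) := defaultEncModRel (lcoset_eq N).

(* {g_1 ... g_n : g_i \in U} *)
Definition set_power (U : set G) (n : nat) : set G :=
  [set (\prod_(i < n) s i)%g | s in [set s : 'I_n -> G | forall i, U (s i)]].

End Subgroups.

Definition left_quotient (G : topologicalGroupType) (N : set G) :=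
  quotient_topology {eq_quot (lcoset_eq N)}.

Definition left_proj (G : topologicalGroupType) (N : set G) :
  G -> left_quotient N := \pi_(left_quotient N).

Definition integers (R : realType) : zmodClosed R :=
  GRing.ZmodClosed.clone R (@Num.int_num_subdef R) _.

(* R/Z, with the quotient topology and the quotient group structure *)
Definition circle (R : realType) :=
  quotient_topology {ideal_quot integers R}.
HB.instance Definition _ (R : realType) :=
  GRing.Zmodule.copy (circle R) {ideal_quot integers R}.

(* An isomorphism of topological groups from G/N onto (X, add), for N normal
   in G: the group law of G/N is the one for which left_proj N is a morphism. *)
Definition quotient_iso (G : topologicalGroupType) (N : set G)
    (X : topologicalType) (phi : left_quotient N -> X) (add : X -> X -> X) :=
  homeomorphism phi /\
  forall g h : G, phi (left_proj N (g * h)%g) =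
                  add (phi (left_proj N g)) (phi (left_proj N h)).

Definition closed_commutator (G : topologicalGroupType) : set G :=
  closure (@commutator_subgroup G).
Arguments closed_commutator G : clear implicits.

(* the preimage of {0} x T^r under G -> G/G_0 ~ R^q x T^r *)
Definition torus_preimage (R : realType) (G : topologicalGroupType) (q r : nat)
    (phi0 : left_quotient (closed_commutator G) -> 'rV[R]_q * 'rV[circle R]_r) : set G :=
  [set g | (phi0 (left_proj (closed_commutator G) g)).1 = 0].

Definition borel (G : topologicalGroupType) := g_sigma_algebraType (@open G).

Section Haar.
Variables (R : realType) (G : topologicalGroupType).

(* Regularity is automatic on the second countable groups considered here. *)
Definition left_haar (mu : {measure set (borel G) -> \bar R}) : Prop :=
  [/\ forall (g : G) (B : set (borel G)), measurable B ->
         mu [set (g * x)%g | x in B] = mu B,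
      forall C : set G, compact C -> (mu C < +oo)%E
    & mu [set: G] != 0%E].

Variable mu : {measure set (borel G) -> \bar R}.

Definition Cmeasurable (f : G -> R[i]) : Prop :=
  measurable_fun [set: borel G] (fun g : borel G => complex.Re (f g)) /\
  measurable_fun [set: borel G] (fun g : borel G => complex.Im (f g)).

Definition Cintegral (f : G -> R[i]) : R[i] :=
  Complex (\int[mu]_g complex.Re (f g)) (\int[mu]_g complex.Im (f g)).

Definition Cnorm (p : R) (f : G -> R[i]) : \bar R :=
  Lnorm mu p%:E (fun g => (Normc.normc (f g))%:E).

Definition in_Lp (p : R) (f : G -> R[i]) : Prop :=
  Cmeasurable f /\ (Cnorm p f < +oo)%E.

(* Operators act on representatives. *)
Definition opnorm (p q : R) (S : (G -> R[i]) -> (G -> R[i])) : \bar R :=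
  ereal_sup [set Cnorm q (S f) | f in [set f | in_Lp p f /\ (Cnorm p f <= 1)%E]].

(* For f1 in L^1 and f2 in L^p the integral converges absolutely for almost
   every g; the library's total integral fixes a value at the other points. *)
Definition convolution (f1 f2 : G -> R[i]) : G -> R[i] :=
  fun g => Cintegral (fun h => f1 h * f2 (h^-1 * g)%g).

Definition conv_op (K : G -> R) (f : G -> R[i]) : G -> R[i] :=
  convolution (fun g => (K g)%:C%C) f.

Definition prob_density (K : G -> R) : Prop :=
  [/\ measurable_fun [set: borel G] (K : borel G -> R),
      forall g, 0 <= K g
    & (\int[mu]_g (K g)%:E = 1)%E].

(* pi1 : G -> R^q.  The extended integral is 0 only if it converges. *)
Definition centered (q : nat) (pi1 : G -> 'rV[R]_q) (K : G -> R) : Prop :=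
  forall i, (\int[mu]_g (K g * pi1 g ord0 i)%:E = 0)%E.

End Haar.

Definition distance_neighborhood (G : topologicalGroupType) (U : set G) : Prop :=
  [/\ open U, precompact U, U 1%g & [set x^-1%g | x in U] = U].

Definition rho (R : realType) (G : topologicalGroupType) (U : set G) (g : G) : R :=
  inf [set n%:R | n in [set n : nat | (0 < n)%N /\ set_power U n g]].

(* Main.v *)
Require Import Defs.
From HB Require Import structures.
From mathcomp Require Import all_boot all_order all_algebra.
From mathcomp Require Import complex finmap.
From mathcomp Require Import all_classical all_reals all_analysis.
From mathcomp Require Import measurable_realfun.
From mathcomp Require Import ring lra.

Set Implicit Arguments.
Unset Strict Implicit.
Unset Printing Implicit Defensive.

Import Order.TTheory GRing.Theory Num.Theory.
Import numFieldNormedType.Exports.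

Local Open Scope classical_set_scope.
Local Open Scope ring_scope.

(* Write [T] for convolution with a density [K] of the family, [N] for the p-th
   power of the L^p norm of [v], and [J] for [v |v|^(p-2)]. With
   [F = v |v|^(p/2-1)], [s = 2/p] and [t = 2 - s], [v] and [J] are the radial
   powers of [F] of exponents [s] and [t]. By a refined Young inequality,
   [N - Re <z T v, J>], for [|z| = 1], dominates the mean against [K] of the energy
   [E_z h = || z F(h^-1 .) - F ||_2^2]. Since [K] is bounded below near the
   identity, this mean dominates both [|z - 1|^2 N] and, for [z = 1], the energies
   [E_1 h] of all small [h]. The function [h |-> Im <v(h^-1 .), J>] is additive up
   to energies. Corrected by a linear combination of the coordinates of [pi_1],
   whose integral against [K] vanishes by centering, it is a quasi-homomorphism
   that is bounded on a neighbourhood of the identity: [G] is a compact set times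
   a subset generated by commutators and by elements on which the corrected
   function vanishes, and [4 f(u) = f(u^4) + O(energy)] lets its supremum over
   the compact set absorb itself. Hence it grows at most exponentially in [rho],
   and the exponential moments bound [|Im <T v, J>|] by [N - Re <T v, J>]. So the
   numerical range of [T] lies in a fixed Stolz angle at 1, and
   [|l - 1| ||v|| <= kappa ||l v - T v||] for [1 < |l| <= 2]. Such a bound gives the
   decay of [(I - T) T^n]: up to a factor, [T^n] is a sum, over roots of unity, of
   second differences of truncated resolvents on a circle of radius [1 + O(1/n)],
   each carrying a factor [O(n^-2)]. *)

(** The obstacle is a mismatch of orders: [N - Re <T v, J>] is controlled by squared displacements,
    while [Im <T v, J>] is of first order, so a Stolz angle can come only from cancellation.
    Centering removes what factors through [pi_1], and a compactness argument shows that nothing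
    else of first order remains. That argument must not see [v], [p] or the density: its constants
    are chosen before the energy, the function and the scale, and boundedness on compact sets serves
    only to make a supremum finite. The passage to powers is Cauchy's formula integrated by parts
    twice, made discrete so that only polynomials in [T] occur; [T] acts on representatives and is
    linear only up to null sets. The second derivative of the resolvent times [I - T] is
    [O(|l - 1|^-2)], whose mean over the circle is [O(n)]; the two integrations by parts give
    [O(n^-2)], and the product is [O(1/n)]. *)

Notation normc := Normc.normc.
Notation Re := complex.Re.
Notation Im := complex.Im.

(** * Complex moduli, roots of unity and the discrete Parseval identity *)

Section ComplexModulus.
Variable R : realType.
Implicit Types x y z : R[i].

Lemma normcC x : `|x| = (normc x)%:C%C.
Proof. by case: x. Qed.

Lemma normc_ge0 x : 0 <= normc x.
Proof. by case: x => a b; exact: sqrtr_ge0. Qed.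

Lemma normcD x y : normc (x + y) <= normc x + normc y.
Proof. by rewrite -lecR rmorphD -!normcC ler_normD. Qed.

Lemma normc_opp x : normc (- x) = normc x.
Proof. by apply/complexI; rewrite -!normcC normrN. Qed.

Lemma normcBC x y : normc (x - y) = normc (y - x).
Proof. by rewrite -normc_opp opprB. Qed.

Lemma normcB x y : normc (x - y) <= normc x + normc y.
Proof. by rewrite -(normc_opp y) normcD. Qed.

Lemma lerB_normcD x y : normc x - normc y <= normc (x + y).
Proof. by rewrite lerBlDr -{1}(addrK y x) normcB. Qed.

Lemma normcX x n : normc (x ^+ n) = normc x ^+ n.
Proof.
by elim: n => [|n ih]; rewrite ?expr0 ?Normc.normc1// !exprS Normc.normcM ih.
Qed.

Lemma normc_real (a : R) : normc a%:C%C = `|a|.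
Proof. by rewrite /normc/= expr0n/= addr0 sqrtr_sqr. Qed.

Lemma normc_eq0 x : (normc x == 0) = (x == 0).
Proof.
by apply/eqP/eqP => [/Normc.eq0_normc//|->]; rewrite Normc.normc0.
Qed.

Lemma normc_gt0 x : (0 < normc x) = (x != 0).
Proof. by rewrite lt0r normc_ge0 andbT normc_eq0. Qed.

Lemma sqr_normcE x : normc x ^+ 2 = Re x ^+ 2 + Im x ^+ 2.
Proof. by case: x => a b; rewrite sqr_sqrtr// addr_ge0 ?sqr_ge0. Qed.

Lemma normc_conj x : normc x^*%C = normc x.
Proof. by case: x => a b; rewrite /normc/= sqrrN. Qed.

Lemma Re_le_normc x : `|Re x| <= normc x.
Proof.
by rewrite -(@ler_sqr R) ?nnegrE ?normc_ge0// sqr_normcE real_normK ?num_real// lerDl sqr_ge0.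
Qed.

Lemma Im_le_normc x : `|Im x| <= normc x.
Proof.
by rewrite -(@ler_sqr R) ?nnegrE ?normc_ge0// sqr_normcE real_normK ?num_real// lerDr sqr_ge0.
Qed.

Lemma normc_le_ReIm x : normc x <= `|Re x| + `|Im x|.
Proof.
rewrite -(@ler_sqr R) ?nnegrE ?normc_ge0 ?addr_ge0// sqr_normcE sqrrD.
by rewrite !real_normK ?num_real// -addrA addrCA lerDr mulrn_wge0// mulr_ge0.
Qed.

(** Linearizes the modulus, so that the triangle inequality for complex integrals reduces to the one
    for real parts. *)
Lemma unimodular_rotation z : exists2 s, normc s = 1 & normc z = Re (s * z).
Proof.
have [->|z0] := eqVneq z 0.
  by exists 1; rewrite ?Normc.normc1// mulr0 Normc.normc0.
exists (z^*%C / (normc z)%:C%C).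
  rewrite Normc.normcM Normc.normcV normc_conj normc_real ger0_norm ?normc_ge0//.
  by rewrite divff// normc_eq0.
have nz : (normc z)%:C%C != 0 :> R[i].
  by apply: contra z0 => /eqP[/Normc.eq0_normc->].
have -> : z^*%C / (normc z)%:C%C * z = (normc z)%:C%C.
  by apply: (mulIf nz); rewrite mulrAC divfK// mulrC -sqr_normc normcC -expr2.
by [].
Qed.

End ComplexModulus.

Section Cis.
Variable R : realType.
Implicit Types (x : R).

Definition cis x : R[i] := Complex (cos x) (sin x).

Lemma cisD x y : cis (x + y) = cis x * cis y.
Proof. by apply/eqP; rewrite eq_complex/= cosD sinD eqxx/= addrC eqxx. Qed.

Lemma cisMn x n : cis (x *+ n) = cis x ^+ n.
Proof.
elim: n => [|n ih]; first by rewrite mulr0n expr0 /cis cos0 sin0.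
by rewrite mulrS cisD ih exprS.
Qed.

Lemma normc_cis x : normc (cis x) = 1.
Proof. by rewrite /cis /normc/= cos2Dsin2 sqrtr1. Qed.

Lemma sin_le x : 0 <= x -> sin x <= x.
Proof.
move=> x0.
have d (y : R) : is_derive y 1 (fun z : R => z - sin z) (1 - cos y) by exact: is_deriveB.
rewrite -subr_ge0 -[leLHS](_ : 0 - sin 0 = 0); last by rewrite sin0 subrr.
apply: (@ger0_derive1_ndecr _ (fun z : R => z - sin z) 0 x) => //.
- by move=> y _; rewrite derive1E (@derive_val _ _ _ _ _ _ _ (d y)) subr_ge0 cos_le1.
- apply/continuous_subspaceT => y; apply/differentiable_continuous/derivable1_diffP.
  exact: ex_derive.
Qed.

Lemma sqr_normc_cisB1 x : normc (cis x - 1) ^+ 2 = 4 * sin (x / 2) ^+ 2.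
Proof.
rewrite sqr_normcE/= subr0.
have c : cos x = 1 - 2 * sin (x / 2) ^+ 2.
  rewrite {1}[x]splitr cosD -!expr2; have := cos2Dsin2 (x / 2); lra.
have := cos2Dsin2 x; rewrite c; nra.
Qed.

Lemma normc_cisB1_le x : 0 <= x -> x <= pi -> normc (cis x - 1) <= x.
Proof.
move=> x0 xp; rewrite -(@ler_sqr R) ?nnegrE ?normc_ge0// sqr_normc_cisB1.
have h := @sin_le (x / 2) ltac:(lra).
have h' : 0 <= sin (x / 2).
  by apply: sin_ge0_pi; apply/andP; split; have := pi_gt0 R; lra.
nra.
Qed.

(** The [m]-th power is -1, so the order divides [2m]; a smaller order [k] would make the chord
    [2 sin(k pi / 2m)] vanish with its angle strictly between 0 and [pi]. *)
Lemma cis_primitive m : (0 < m)%N -> (m.*2).-primitive_root (cis (pi / m%:R)).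
Proof.
move=> m0; have mR : m%:R != 0 :> R by rewrite pnatr_eq0 -lt0n.
have zm : cis (pi / m%:R) ^+ m = -1.
  rewrite -cisMn -[X in cis X]mulr_natr divfK// /cis cospi sinpi.
  by apply/eqP; rewrite eq_complex/= oppr0 !eqxx.
have zN : cis (pi / m%:R) ^+ m.*2 = 1 by rewrite -muln2 exprM zm sqrrN expr1n.
have N0 : (0 < m.*2)%N by rewrite double_gt0.
have [k pk kN] := prim_order_exists N0 zN.
have k0 := prim_order_gt0 pk.
have kle := dvdn_leq N0 kN.
move: kle; rewrite leq_eqVlt => /orP[/eqP<-//|kltN].
have := sqr_normc_cisB1 (pi / m%:R *+ k).
rewrite cisMn (prim_expr_order pk) subrr Normc.normc0 expr0n/=.
suff /gt_eqF : 0 < 4 * sin ((pi / m%:R : R) *+ k / 2) ^+ 2 by move=> + /esym/eqP => ->.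
rewrite mulr_gt0// exprn_gt0// sin_gt0_pi//.
have p0 := pi_gt0 R; rewrite -(mulr_natr (pi / m%:R)); apply/andP; split.
  by rewrite !mulr_gt0 ?invr_gt0 ?ltr0n.
have -> : pi / m%:R * k%:R / 2 = pi * (k%:R / (m.*2)%:R) :> R.
  by rewrite -muln2 natrM; field.
rewrite gtr_pMr// ltr_pdivrMr ?ltr0n// mul1r ltr_nat//.
Qed.

End Cis.

Section Parseval.
Variables (C : numClosedFieldType) (N : nat) (z : C).
Hypothesis pz : N.-primitive_root z.

Lemma sum_root_of_unity (u : C) : u ^+ N = 1 -> u != 1 -> \sum_(j < N) u ^+ j = 0.
Proof.
move=> uN u1; have := subrX1 u N; rewrite uN subrr => /esym/eqP.
by rewrite mulf_eq0 subr_eq0 (negPf u1) => /eqP.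
Qed.

(** Orthogonality of characters: off the diagonal the ratio is an [N]-th root of unity other than 1,
    and its geometric sum vanishes. *)
Lemma sum_prim_root k l : (k < N)%N -> (l < N)%N ->
  \sum_(j < N) (z ^+ k / z ^+ l) ^+ j = if k == l then N%:R else 0.
Proof.
move=> kN lN; have zl : z ^+ l != 0.
  by rewrite expf_neq0//; apply: contra_eq_neq (prim_expr_order pz) => ->;
     rewrite expr0n gtn_eqF ?(prim_order_gt0 pz)// eq_sym oner_eq0.
case: eqVneq => [->|kl].
  under eq_bigr do rewrite divff// expr1n.
  by rewrite sumr_const card_ord.
apply: sum_root_of_unity.
  by rewrite expr_div_n -!exprM ![(_ * N)%N]mulnC !exprM (prim_expr_order pz) !expr1n divr1.
apply: contra kl => /eqP h.
have : z ^+ k == z ^+ l by apply/eqP; rewrite -[LHS](divfK zl) h mul1r.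
by rewrite (eq_prim_root_expr pz) !modn_small.
Qed.

Lemma parseval (y : nat -> C) :
  \sum_(j < N) `|\sum_(k < N) y k * z ^+ (j * k)| ^+ 2 = N%:R * \sum_(k < N) `|y k| ^+ 2.
Proof.
have nz : `|z| = 1.
  apply/eqP; rewrite -(@pexpr_eq1 _ _ N) ?(prim_order_gt0 pz)//.
  by rewrite -normrX (prim_expr_order pz) normr1.
have cz : z^* = z^-1.
  have z0 : z != 0 by rewrite -normr_eq0 nz oner_eq0.
  by apply: (mulfI z0); rewrite -normCK nz expr1n divff.
under eq_bigr do rewrite normCK rmorph_sum mulr_suml.
transitivity (\sum_(j < N) \sum_(k < N) \sum_(l < N)
    y k * (y l)^* * (z ^+ k / z ^+ l) ^+ j).
  apply: eq_bigr => j _; apply: eq_bigr => k _; rewrite mulr_sumr.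
  apply: eq_bigr => l _; rewrite rmorphM rmorphXn/= cz mulrACA; congr (_ * _).
  by rewrite expr_div_n -!exprM mulnC exprVn (mulnC l).
rewrite exchange_big/= mulr_sumr; apply: eq_bigr => k _.
rewrite exchange_big/= (bigD1 k)//= [X in _ + X]big1 ?addr0.
  by rewrite -mulr_sumr sum_prim_root// eqxx -normCK mulrC.
move=> l lk; rewrite -mulr_sumr sum_prim_root// ifN ?mulr0//.
by rewrite eq_sym.
Qed.

End Parseval.

(** * From resolvent bounds to decay of powers *)

Section ResolventToDecay.
Variable R : realType.
Local Notation C := R[i].
Implicit Types (P Q : {poly C}) (l : C).

(** The Neumann series of [(l - X)^-1] cut after [N] terms, a polynomial that stands in for the
    inverse. *)
Definition trunc_resolvent (N : nat) l : {poly C} :=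
  \sum_(k < N) (l^-1 ^+ k.+1) *: 'X^k.

Lemma trunc_resolventP N l : l != 0 ->
  (l%:P - 'X) * trunc_resolvent N l = 1 - (l^-1 ^+ N) *: 'X^N.
Proof.
move=> l0; elim: N => [|N ih].
  by rewrite /trunc_resolvent big_ord0 mulr0 !expr0 scale1r subrr.
rewrite /trunc_resolvent big_ord_recr/= mulrDr ih mulrBl.
rewrite -[in l%:P * _]mul_polyC mulrA -polyCM exprS mulrA divff// mul1r mul_polyC.
by rewrite -scalerAr -exprS -exprS addrA subrK.
Qed.

(* The second difference of the resolvent [(x - X)^-1 A] along a geometric
   progression carries a factor [(z - 1)^2]. *)
Lemma second_difference (a b c z x Ra Rb Rc A : {poly C}) :
  b = a * z -> c = b * z ->
  (a - x) * Ra = A -> (b - x) * Rb = A -> (c - x) * Rc = A ->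
  (a - x) * ((c - x) * (Ra - 2 * Rb + Rc)) = a * (z - 1) ^+ 2 * ((b + x) * Rb).
Proof.
move=> bE cE hA hB hC.
have -> : (a - x) * ((c - x) * (Ra - 2 * Rb + Rc)) =
  (c - x) * ((a - x) * Ra) - 2 * (a - x) * (c - x) * Rb + (a - x) * ((c - x) * Rc).
  by ring.
by rewrite hA hC -hB cE bE; ring.
Qed.

Variables (nu : {poly C} -> R) (kap : R).
Hypothesis nuD : forall P Q, nu (P + Q) <= nu P + nu Q.
Hypothesis nuZ : forall l P, nu (l *: P) = normc l * nu P.
Hypothesis nuX : forall P, nu ('X * P) <= nu P.
Hypothesis nu_resolvent : forall l P, 1 < normc l -> normc l <= 2 ->
  normc (l - 1) * nu P <= kap * nu ((l%:P - 'X) * P).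
Hypothesis kap0 : 0 <= kap.

Let nu0 : nu 0 = 0.
Proof. by rewrite -(scale0r 0) nuZ Normc.normc0 mul0r. Qed.

Let nuN P : nu (- P) = nu P.
Proof. by rewrite -scaleN1r nuZ normc_opp Normc.normc1 mul1r. Qed.

Let nu_ge0 P : 0 <= nu P.
Proof.
have := nuD P (- P); rewrite subrr nu0 nuN; lra.
Qed.

Let nuB P Q : nu (P - Q) <= nu P + nu Q.
Proof. by rewrite -(nuN Q) nuD. Qed.

Let nuXn n P : nu ('X^n * P) <= nu P.
Proof.
elim: n => [|n ih]; first by rewrite expr0 mul1r.
by rewrite exprS -mulrA (le_trans (nuX _)).
Qed.

Let nu_sum I (r : seq I) (F : I -> {poly C}) :
  nu (\sum_(i <- r) F i) <= \sum_(i <- r) nu (F i).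
Proof.
elim/big_rec2: _ => [|i y x _ h]; first by rewrite nu0.
by apply: (le_trans (nuD _ _)); rewrite lerD2l.
Qed.

(** [nu P] stands for the norm of [P(T) f] with [f] fixed, so [nuX] says that [T] contracts. The
    weights [la j ^+ m] extract [X^n] from the truncated resolvents, as in Cauchy's formula, and
    each second difference times [1 - X] is small. *)
Lemma polynomial_decay n :
  nu ('X^n * (1 - 'X)) <= 48 * kap ^+ 2 * (1 + kap) * pi ^+ 2 / n.+1%:R * nu 1.
Proof.
(* There are [2m] nodes and [z ^+ m = -1], so shifting the nodes by 0, 1, 2 produces the signs +, -,
   +. In the second difference the coefficients then add up to 1 + 2 + 1 = 4 instead of
   cancelling. *)
pose m := n.+1; pose N := m.*2; pose z : C := cis (pi / m%:R).
have N0 : (0 < N)%N by rewrite double_gt0.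
have pz : N.-primitive_root z by exact: cis_primitive.
have nz k : normc (z ^+ k) = 1 by rewrite normcX normc_cis expr1n.
have zn0 k : z ^+ k != 0 by rewrite -normc_gt0 nz.
(* With [r ^+ N = 2] the radius exceeds 1 by [O(1/N)], and [la j ^+ N = 2] for every [j], so all
   truncated resolvents share the right-hand side [A], as [second_difference] requires. *)
pose r : R := 2 `^ (N%:R^-1).
have r0 : 0 < r by rewrite powR_gt0.
have rN : r ^+ N = 2.
  by rewrite -powR_mulrn ?ltW// -powRrM mulVf ?powRr1// pnatr_eq0 -lt0n.
have r1 : 1 < r.
  rewrite ltNge; apply/negP => rle.
  have : r ^+ N <= 1 by rewrite exprn_ile1// ltW.
  by rewrite rN; lra.
have rX k : (k <= N)%N -> r ^+ k <= 2.
  by move=> kN; rewrite -rN ler_weXn2l// ltW.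
have r2 : r <= 2 by rewrite -[r]expr1 rX.
pose la j : C := r%:C%C * z ^+ j.
have nla j : normc (la j) = r.
  by rewrite Normc.normcM nz mulr1 normc_real gtr0_norm.
have la0 j : la j != 0 by rewrite -normc_gt0 nla.
have laN j : (la j)^-1 ^+ N = 2^-1.
  rewrite exprVn exprMn -exprM mulnC exprM (prim_expr_order pz) expr1n mulr1.
  by rewrite -rmorphXn/= rN rmorph_nat.
have la1 j : 0 < normc (la j - 1).
  have := lerB_normcD (la j) (-1); rewrite normc_opp Normc.normc1 nla.
  by move: r1; lra.
pose A : {poly C} := 1 - 2^-1 *: 'X^N.
pose T j := trunc_resolvent N (la j).
have TE j : ((la j)%:P - 'X) * T j = A by rewrite trunc_resolventP// laN.
have nA : nu A <= 2 * nu 1.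
  apply: (le_trans (nuB _ _)); rewrite nuZ Normc.normcV.
  have -> : normc (2 : C) = 2.
    by rewrite -[2](rmorph_nat (real_complex R)) normc_real ger0_norm.
  have := nuXn N 1; rewrite mulr1; have := nu_ge0 1; lra.
pose dz := normc (z - 1).
have coefsum s : \sum_(j < N) (la j ^+ m) *: T (j + s)%N = (N%:R * (-1) ^+ s) *: 'X^n :> {poly C}.
  have term j (k : 'I_N) : la j ^+ m * (la (j + s)%N)^-1 ^+ k.+1 =
      r%:C%C ^+ m / r%:C%C ^+ k.+1 / (z ^+ s) ^+ k.+1 * (z ^+ m / z ^+ k.+1) ^+ j.
    have -> : (z ^+ m / z ^+ k.+1) ^+ j = (z ^+ j) ^+ m / (z ^+ j) ^+ k.+1.
      by rewrite expr_div_n -!exprM (mulnC j m) (mulnC j k.+1).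
    rewrite /la exprD !exprVn !exprMn !invfM.
    move: (_ ^+ m) (_ ^+ m) (_ ^-  _) (_ ^- _) (_ ^- _) => ? ? ? ? ?.
    by ring.
  rewrite /T/trunc_resolvent; under eq_bigr do rewrite scaler_sumr.
  rewrite exchange_big/=.
  have nN : (n < N)%N by rewrite /N /m -addnn addSn ltnS leq_addr.
  have zm1 : z ^+ m = -1.
    rewrite /z -cisMn -[X in cis X]mulr_natr divfK ?pnatr_eq0// /cis cospi sinpi.
    by apply/eqP; rewrite eq_complex/= oppr0 !eqxx.
  rewrite (bigD1 (Ordinal nN))//= [X in _ + X]big1 ?addr0.
    under eq_bigr do rewrite scalerA (term _ (Ordinal nN))/=.
    rewrite -scaler_suml -mulr_sumr; congr (_ *: _).
    rewrite divff; last by rewrite expf_neq0// eq_complex/= eqxx andbT gt_eqF.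
    rewrite (eq_bigr (fun=> 1)) => [|j _]; last by rewrite divff// expr1n.
    rewrite sumr_const card_ord mul1r mulrC -exprM mulnC exprM zm1.
    by congr (_ * _); rewrite -exprVn invrN invr1.
  move=> k kn; under eq_bigr do rewrite scalerA (term _ k)/=.
  rewrite -scaler_suml -mulr_sumr; set S := (X in _ * X).
  suff -> : S = 0 by rewrite mulr0 scale0r.
  apply: sum_root_of_unity.
    by rewrite expr_div_n -!exprM ![(_ * N)%N]mulnC !exprM (prim_expr_order pz) !expr1n divr1.
  apply: contra kn => /eqP h.
  have : z ^+ n * z == z ^+ k * z.
    by rewrite -!exprSr; apply/eqP; rewrite -[LHS](divfK (zn0 k.+1)) h mul1r.
  rewrite (inj_eq (mulIf _)); last by rewrite -[z]expr1.
  by rewrite (eq_prim_root_expr pz) !modn_small// eq_sym.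
pose D j := T j - 2 * T (j + 1)%N + T (j + 2)%N.
have Dsum : \sum_(j < N) (la j ^+ m) *: D j = (4 * N%:R) *: 'X^n.
  transitivity (\sum_(j < N) ((la j ^+ m) *: T (j + 0)%N
      - 2 *: ((la j ^+ m) *: T (j + 1)%N) + (la j ^+ m) *: T (j + 2)%N)).
    apply: eq_bigr => j _; rewrite /D addn0 scalerDr scalerBr; congr (_ - _ + _).
    by rewrite scaler_nat mulr_natl -scalerMnr.
  rewrite big_split sumrB/= -scaler_sumr !coefsum scalerA -scalerBl -scalerDl.
  by congr (_ *: _); ring.
have nuD1 j : nu (D j * (1 - 'X)) <= 6 * kap ^+ 2 * (1 + kap) * dz ^+ 2 *
    (normc (la j - 1) ^- 2 + normc (la (j + 2)%N - 1) ^- 2) * nu 1.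
  set a := la j; set b := la (j + 1)%N; set c := la (j + 2)%N.
  have bE : b%:P = a%:P * z%:P :> {poly C} by rewrite -polyCM /a/b/la addn1 exprSr mulrA.
  have cE : c%:P = b%:P * z%:P :> {poly C}.
    by rewrite -polyCM /c/b/la addn2 addn1 [_ ^+ _.+2]exprSr mulrA.
  have e := second_difference bE cE (TE _) (TE _) (TE _).
  have e' : (a%:P - 'X) * ((c%:P - 'X) * (D j * (1 - 'X))) =
      (a * (z - 1) ^+ 2) *: ((b%:P + 'X) * (T (j + 1)%N * (1 - 'X))).
    rewrite [(c%:P - _) * _]mulrA [LHS]mulrA e -mul_polyC (polyCM a) polyC_exp polyCB polyC1; ring.
  (* The factor [1 - X] cancels one resolvent: [T (1 - X) = A - (b - 1) T], and the resolvent
     hypothesis bounds the last term by [kap * nu A]. *)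
  have h1 : nu (T (j + 1)%N * (1 - 'X)) <= (2 + 2 * kap) * nu 1.
    have -> : T (j + 1)%N * (1 - 'X) = A - (b - 1) *: T (j + 1)%N.
      by rewrite -(TE (j + 1)%N) -mul_polyC polyCB; ring.
    apply: (le_trans (nuB _ _)); rewrite nuZ.
    have := @nu_resolvent b (T (j + 1)%N); rewrite nla => /(_ r1 r2); rewrite TE.
    have : kap * nu A <= kap * (2 * nu 1) by rewrite ler_wpM2l.
    by move: nA; lra.
  have h2 : nu ((b%:P + 'X) * (T (j + 1)%N * (1 - 'X))) <= 3 * ((2 + 2 * kap) * nu 1).
    rewrite mulrDl mul_polyC (le_trans (nuD _ _))// nuZ nla.
    have := nuX (T (j + 1)%N * (1 - 'X)).
    have : r * nu (T (j + 1)%N * (1 - 'X)) <= 2 * nu (T (j + 1)%N * (1 - 'X)).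
      by rewrite ler_wpM2r.
    by move: h1; lra.
  have h3 : normc (a - 1) * (normc (c - 1) * nu (D j * (1 - 'X))) <=
      kap ^+ 2 * (2 * dz ^+ 2 * (3 * ((2 + 2 * kap) * nu 1))).
    have s1 : normc (c - 1) * nu (D j * (1 - 'X)) <=
       kap * nu ((c%:P - 'X) * (D j * (1 - 'X))) by apply: nu_resolvent; rewrite nla.
    have s2 : normc (a - 1) * nu ((c%:P - 'X) * (D j * (1 - 'X))) <=
       kap * nu ((a%:P - 'X) * ((c%:P - 'X) * (D j * (1 - 'X)))).
      by apply: nu_resolvent; rewrite nla.
    rewrite (le_trans (ler_wpM2l (ltW (la1 j)) s1))// mulrCA expr2 -mulrA ler_wpM2l//.
    rewrite (le_trans s2)// ler_wpM2l// e' nuZ Normc.normcM normcX nla.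
    rewrite ler_pM//; first by rewrite mulr_ge0 ?exprn_ge0 ?normc_ge0// ltW.
    by rewrite ler_wpM2r// exprn_ge0 ?normc_ge0.
  have h4 : nu (D j * (1 - 'X)) <= kap ^+ 2 * (2 * dz ^+ 2 * (3 * ((2 + 2 * kap) * nu 1))) *
     ((normc (a - 1))^-1 * (normc (c - 1))^-1).
    rewrite -invfM ler_pdivlMr; last by rewrite mulr_gt0 ?la1.
    by rewrite mulrC -(mulrA (normc (a - 1))).
  rewrite (le_trans h4)//.
  set x := (normc (a - 1))^-1; set y := (normc (c - 1))^-1.
  rewrite -!exprVn -/x -/y.
  have K0 : 0 <= kap ^+ 2 * (1 + kap) * dz ^+ 2 * nu 1.
    by rewrite !mulr_ge0 ?exprn_ge0 ?normc_ge0// addr_ge0.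
  have xy : 2 * (x * y) <= x ^+ 2 + y ^+ 2 by have := sqr_ge0 (x - y); nra.
  have := ler_wpM2l K0 xy; lra.
(* The value at 1 of the truncated resolvent is [1 / (2 (la j - 1))], and its coefficients have
   modulus at most 1; Parseval then evaluates the sum over the circle. *)
have P2 s : \sum_(j < N) normc (la (j + s)%N - 1) ^- 2 <= 4 * N%:R ^+ 2.
  pose y k : C := (r%:C%C ^+ k.+1)^-1 / (z ^+ s) ^+ k.+1.
  have nzV : N.-primitive_root (z^-1).
    have /andP[_ /forallP pzE] := pz; rewrite /primitive_root_of_unity N0.
    apply/forallP => i; rewrite -(eqP (pzE i)) !unity_rootE exprVn.
    by rewrite invr_eq1.
  have := parseval nzV y => pa.
  have pb : \sum_(j < N) normc (\sum_(k < N) y k * z^-1 ^+ (j * k)) ^+ 2 =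
     N%:R * \sum_(k < N) normc (y k) ^+ 2.
    apply/complexI; rewrite rmorphM rmorph_nat !rmorph_sum/=.
    under eq_bigr do rewrite rmorphXn/= -normcC.
    by rewrite pa; congr (_ * _); apply: eq_bigr => k _; rewrite rmorphXn/= -normcC.
  have ny k : normc (y k) <= 1.
    rewrite Normc.normcM Normc.normcV normcX normc_real gtr0_norm//.
    rewrite Normc.normcV -exprM nz invr1 mulr1 invf_le1 ?exprn_gt0//.
    by rewrite exprn_ege1// ltW.
  have -> : \sum_(j < N) normc (la (j + s)%N - 1) ^- 2 =
      4 * \sum_(j < N) normc (\sum_(k < N) y k * z^-1 ^+ (j * k)) ^+ 2.
    rewrite mulr_sumr; apply: eq_bigr => j _.
    have q1 : (la (j + s)%N - 1) * (\sum_(k < N) (la (j + s)%N)^-1 ^+ k.+1) = 2^-1.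
      have := trunc_resolventP N (la0 (j + s)%N) => /(congr1 (horner^~ 1)).
      rewrite hornerM laN hornerD hornerC hornerN hornerX.
      rewrite /trunc_resolvent horner_sum hornerD hornerN hornerZ hornerC hornerXn expr1n mulr1.
      under eq_bigr do rewrite hornerZ hornerXn expr1n mulr1.
      by move=> ->; field.
    have q2 : \sum_(k < N) (la (j + s)%N)^-1 ^+ k.+1 =
        z ^- j * \sum_(k < N) y k * z^-1 ^+ (j * k).
      rewrite mulr_sumr; apply: eq_bigr => k _; rewrite /y /la exprD.
      rewrite !invfM !exprMn !exprVn -!exprM mulnS exprD invfM; ring.
    have q3 : normc (la (j + s)%N - 1) * normc (\sum_(k < N) y k * z^-1 ^+ (j * k)) = 2^-1.
      have := congr1 (@Normc.normc R) q1; rewrite q2 !Normc.normcM Normc.normcV nz invr1 mul1r => ->.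
      rewrite Normc.normcV -[2](rmorph_nat (real_complex R)) normc_real ger0_norm//.
    move: q3 (la1 (j + s)%N); set u := normc _; set v := normc _ => uv u0.
    have -> : v = 2^-1 / u by rewrite -uv mulrAC divff ?mul1r ?gt_eqF.
    by field; rewrite gt_eqF.
  rewrite pb ler_pM2l// expr2 ler_wpM2l//.
  rewrite (le_trans (ler_sum _ (G := fun=> 1) _))//.
    by move=> k _; rewrite exprn_ile1// normc_ge0.
  by rewrite sumr_const card_ord.
have main : 4 * N%:R * nu ('X^n * (1 - 'X)) <=
    96 * kap ^+ 2 * (1 + kap) * dz ^+ 2 * N%:R ^+ 2 * nu 1.
  have -> : 4 * N%:R * nu ('X^n * (1 - 'X)) =
      nu (\sum_(j < N) (la j ^+ m) *: (D j * (1 - 'X))).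
    under eq_bigr do rewrite scalerAl.
    rewrite -mulr_suml Dsum. rewrite -(scalerAl (4 * N%:R)) nuZ; congr (_ * _).
    have -> : (4 * N%:R : C) = (4 * N%:R : R)%:C%C by rewrite rmorphM !rmorph_nat.
    by rewrite normc_real ger0_norm ?mulr_ge0.
  apply: (le_trans (nu_sum _ _)).
  apply: (@le_trans _ _ (\sum_(j < N) 2 * (6 * kap ^+ 2 * (1 + kap) * dz ^+ 2 *
    (normc (la j - 1) ^- 2 + normc (la (j + 2)%N - 1) ^- 2) * nu 1))).
    apply: ler_sum => j _; rewrite nuZ normcX nla ler_pM// ?exprn_ge0 ?rX// ?ltW//.
    by rewrite /N -addnn leq_addr.
  rewrite -mulr_sumr -mulr_suml -mulr_sumr big_split/=.
  have := P2 0%N.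
  have -> : \sum_(j < N) normc (la (j + 0)%N - 1) ^- 2 = \sum_(j < N) normc (la j - 1) ^- 2.
    by apply: eq_bigr => j _; rewrite addn0.
  have := P2 2%N.
  set S2 := \sum_(i < N) _; set S0 := \sum_(i < N) _ => hS2 hS0.
  have hS : S0 + S2 <= 8 * N%:R ^+ 2 by lra.
  have K0 : 0 <= kap ^+ 2 * (1 + kap) * dz ^+ 2 * nu 1.
    by rewrite !mulr_ge0 ?exprn_ge0 ?normc_ge0// addr_ge0.
  have := ler_wpM2l K0 hS; lra.
have dz2 : dz ^+ 2 <= (pi / m%:R) ^+ 2.
  rewrite ler_sqr ?nnegrE ?normc_ge0 ?divr_ge0 ?pi_ge0//.
  apply: normc_cisB1_le; first by rewrite divr_ge0 ?pi_ge0.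
  by rewrite ler_pdivrMr ?ltr0n// ler_peMr ?pi_ge0 ?ler1n.
have mR : 0 < m%:R :> R by rewrite ltr0n.
have NE : N%:R = 2 * m%:R :> R by rewrite /N -muln2 natrM mulrC.
rewrite NE in main.
have K0 : 0 <= kap ^+ 2 * (1 + kap) * nu 1.
  by rewrite !mulr_ge0 ?exprn_ge0// addr_ge0.
have := ler_wpM2l K0 dz2 => h.
rewrite -(ler_pM2l (_ : 0 < 8 * m%:R)); last by rewrite mulr_gt0.
have -> : 8 * m%:R * (48 * kap ^+ 2 * (1 + kap) * pi ^+ 2 / n.+1%:R * nu 1) =
   384 * (kap ^+ 2 * (1 + kap) * nu 1 * (pi / m%:R) ^+ 2) * m%:R ^+ 2.
  by rewrite /m; field; rewrite gt_eqF.
have m20 : 0 <= m%:R ^+ 2 :> R by rewrite exprn_ge0 ?ltW.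
have := ler_wpM2r m20 h.
move: main; lra.
Qed.

End ResolventToDecay.

(** * Radial powers of complex numbers *)

Section RealPowers.
Variable R : realType.
Implicit Types (A B M s t x y : R).

Lemma powR_homo s A B : 0 <= s -> 0 <= A -> A <= B -> A `^ s <= B `^ s.
Proof.
by move=> s0 A0 AB; apply: ge0_ler_powR; rewrite ?nnegrE// (le_trans A0).
Qed.

Lemma powRB1_antitone s A B : s <= 1 -> 0 < A -> A <= B -> B `^ (s - 1) <= A `^ (s - 1).
Proof.
move=> s1 A0 AB; have B0 := lt_le_trans A0 AB.
rewrite -(opprB 1 s) !powRN lef_pV2 ?posrE ?powR_gt0//.
apply: ge0_ler_powR; rewrite ?nnegrE ?subr_ge0 // ltW//.
Qed.

(** The tangent line at 1, obtained from Young's inequality with exponents [1/s] and [1/(1-s)]. *)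
Lemma concave_powR s A : 0 < s -> s <= 1 -> 0 <= A -> A `^ s <= s * A + (1 - s).
Proof.
move=> s0; rewrite le_eqVlt => /predU1P[->|s1] A0; first by rewrite powRr1//; lra.
have := @conjugate_powR R (A `^ s) 1 s^-1 (1 - s)^-1 (powR_ge0 _ _) ler01.
rewrite !invr_gt0 subr_gt0 => /(_ s0 s1); rewrite !invrK mulr1 powR1 -powRrM.
rewrite divff ?gt_eqF// powRr1// => h.
by apply: (le_trans (h _)); lra.
Qed.

(** The right-hand side equals [s A B + (1 - s) B^2]; divided by [B^2], this is the tangent line at
    [A/B = 1] of a concave power. *)
Lemma young_refined_le s t A B : 0 < s -> s <= 1 -> s + t = 2 -> 0 <= A -> 0 <= B ->
  A `^ s * B `^ t <= s / 2 * A ^+ 2 + t / 2 * B ^+ 2 - s / 2 * (A - B) ^+ 2.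
Proof.
move=> s0 s1 st A0; rewrite le_eqVlt => /predU1P[<-|B0].
  rewrite powR0; last by rewrite gt_eqF//; lra.
  by rewrite mulr0 subr0; lra.
have -> : A `^ s * B `^ t = (A / B) `^ s * B ^+ 2.
  have -> : t = 2%:R - s by lra.
  rewrite powRB; last by rewrite (gt_eqF B0) implybT.
  rewrite powR_mulrn ?ltW//.
  have Bi : 0 <= B^-1 by rewrite invr_ge0 ltW.
  rewrite powRM// -[B^-1](powR_inv1 (ltW B0)) -!powRrM mulN1r powRN.
  by rewrite -mulrA [X in _ * X = _]mulrC.
have AB : 0 <= A / B by rewrite divr_ge0// ltW.
have := ler_wpM2r (sqr_ge0 B) (concave_powR s0 s1 AB).
move=> /le_trans; apply.
have -> : (s * (A / B) + (1 - s)) * B ^+ 2 = s * A * B + (1 - s) * B ^+ 2.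
  by field; rewrite gt_eqF.
have -> : t = 2 - s by lra.
by lra.
Qed.

Lemma young_refined s t A B : 0 < s -> 0 < t -> s + t = 2 -> 0 <= A -> 0 <= B ->
  A `^ s * B `^ t <= s / 2 * A ^+ 2 + t / 2 * B ^+ 2 - Num.min s t / 2 * (A - B) ^+ 2.
Proof.
move=> s0 t0 st A0 B0; case: (leP s t) => h.
  by apply: young_refined_le => //; lra.
have := @young_refined_le t s B A t0; rewrite [_ + s]addrC mulrC => /(_ _ st).
rewrite [(B - A) ^+ 2]sqrrB [(A - B) ^+ 2]sqrrB => g.
by apply: (le_trans (g _ _ _)) => //; lra.
Qed.

Lemma powRM_le_sqrD s t x y : 0 < s -> 0 < t -> s + t = 2 -> 0 <= x -> 0 <= y ->
  x `^ s * y `^ t <= x ^+ 2 + y ^+ 2.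
Proof.
move=> s0 t0 st x0 y0; apply: (le_trans (young_refined s0 t0 st x0 y0)).
have m0 : 0 <= Num.min s t by rewrite le_min !ltW.
have := mulr_ge0 m0 (sqr_ge0 (x - y)); have := sqr_ge0 x; have := sqr_ge0 y.
nra.
Qed.

(** The factor [B] turns the singular [B^(s-1)] into the monotone [B^s], so [B] may be arbitrarily
    small. *)
Lemma dist_mul_powRB1_le s A B : 0 < s -> s <= 1 -> 0 < A -> 0 <= B ->
  `|B `^ (s - 1) - A `^ (s - 1)| * B <= A `^ (s - 1) * `|B - A|.
Proof.
move=> s0 s1 A0; rewrite le_eqVlt => /predU1P[<-|B0].
  by rewrite mulr0 mulr_ge0 ?powR_ge0.
have EA := mulr_powRB1 (ltW A0) s0; have EB := mulr_powRB1 (ltW B0) s0.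
case: (leP A B) => AB.
  have h := powRB1_antitone s1 A0 AB.
  have h2 : A `^ s <= B `^ s by rewrite powR_homo// ltW.
  by rewrite ler0_norm ?subr_le0// (@ger0_norm _ (B - A)) ?subr_ge0//; lra.
have h := powRB1_antitone s1 B0 (ltW AB).
have h2 : B `^ s <= A `^ s by rewrite powR_homo// ltW.
by rewrite ger0_norm ?subr_ge0// (@ler0_norm _ (B - A)) ?subr_le0 ?(ltW AB)//; lra.
Qed.

Lemma dist_mul_powRD1_le t A B : 1 <= t -> t <= 2 -> 0 < A -> 0 <= B -> B <= A ->
  `|B `^ (t - 1) - A `^ (t - 1)| * B <= A `^ (t - 1) * (A - B).
Proof.
move=> t1 t2 A0 B0 BA; move: B0; rewrite le_eqVlt => /predU1P[<-|B0].
  by rewrite mulr0 subr0 mulr_ge0 ?powR_ge0 ?ltW.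
have [->|t1'] := eqVneq t 1.
  by rewrite subrr !powRr0 subrr normr0 mul0r mul1r subr_ge0.
have u0 : 0 < t - 1 by rewrite subr_gt0 lt_def t1'.
have u1 : t - 1 <= 1 by lra.
have EA := mulr_powRB1 (ltW A0) u0; have EB := mulr_powRB1 (ltW B0) u0.
have h := powRB1_antitone u1 B0 BA.
have h2 : B `^ (t - 1) <= A `^ (t - 1) by rewrite powR_homo// ltW.
rewrite ler0_norm ?subr_le0// opprB.
have h3 : B * A `^ (t - 1 - 1) <= B `^ (t - 1) by rewrite -EB ler_pM2l.
have h4 : A `^ (t - 1) - B `^ (t - 1) <= A `^ (t - 1 - 1) * (A - B) by rewrite -EA; nra.
have P0 : 0 <= A `^ (t - 1 - 1) * (A - B) by rewrite mulr_ge0 ?powR_ge0 ?subr_ge0.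
apply: (le_trans (ler_wpM2r (ltW B0) h4)).
rewrite -EA (mulrC A) -[in leRHS]mulrA (mulrC A) mulrA.
by rewrite ler_wpM2l.
Qed.

End RealPowers.

Section RadialPower.
Variable R : realType.
Implicit Types (s t : R) (a b d : R[i]).

(** The Mazur map on values: if [f = radial s F] with [s > 0], then [|f|^(2/s) = |F|^2]. Written as
    a product, it gives 0 at 0 also for [s < 1]. *)
Definition radial s a : R[i] := (normc a `^ (s - 1))%:C%C * a.

Lemma radial0 s : radial s 0 = 0.
Proof. by rewrite /radial mulr0. Qed.

Lemma normc_radial s a : 0 < s -> normc (radial s a) = normc a `^ s.
Proof.
move=> s0; rewrite Normc.normcM normc_real ger0_norm ?powR_ge0//.
by rewrite mulrC mulr_powRB1// normc_ge0.
Qed.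

Lemma radial_rot s (z : R[i]) a : normc z = 1 -> radial s (z * a) = z * radial s a.
Proof. by move=> z1; rewrite /radial Normc.normcM z1 mul1r mulrCA. Qed.

Lemma radial_comp s t a : 0 < t -> radial s (radial t a) = radial (s * t) a.
Proof.
move=> t0; rewrite {1}/radial normc_radial// -powRrM /radial mulrA -rmorphM/=.
have [->|a0] := eqVneq a 0; first by rewrite !mulr0.
rewrite -powRD ?normc_eq0 ?a0 ?implybT//.
by congr ((_ `^ _)%:C%C * _); ring.
Qed.

Lemma radial1 a : radial 1 a = a.
Proof. by rewrite /radial subrr powRr0 mul1r. Qed.

Lemma radial_sub_le1 s a b : 0 < s -> s <= 1 -> a != 0 ->
  normc (radial s b - radial s a) <= 2 * (normc (b - a) * normc a `^ (s - 1)).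
Proof.
move=> s0 s1 a0.
have -> : radial s b - radial s a =
   (normc a `^ (s - 1))%:C%C * (b - a) + (normc b `^ (s - 1) - normc a `^ (s - 1))%:C%C * b.
  by rewrite /radial rmorphB; ring.
apply: (le_trans (normcD _ _)); rewrite !Normc.normcM !normc_real.
rewrite (ger0_norm (powR_ge0 _ _)).
have := dist_mul_powRB1_le s0 s1 _ (normc_ge0 b) (A := normc a); rewrite normc_gt0 => /(_ a0).
have : `|normc b - normc a| <= normc (b - a).
  rewrite ler_norml; have := lerB_normcD b (- a); rewrite normc_opp.
  have := lerB_normcD a (- b); rewrite normc_opp normcBC => h1 h2.
  by apply/andP; split; lra.
move=> h1 h2; have := ler_wpM2l (powR_ge0 (normc a) (s - 1)) h1; lra.
Qed.

Lemma radial_sub_ge1 t a d : 1 <= t -> t <= 2 -> normc d <= normc a ->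
  normc (radial t d - radial t a) <= 2 * (normc (d - a) * normc a `^ (t - 1)).
Proof.
move=> t1 t2 da; have [a0|a0] := eqVneq a 0.
  move: da; rewrite a0 Normc.normc0 => d0.
  have : normc d == 0 by rewrite eq_le d0 normc_ge0.
  by rewrite normc_eq0 => /eqP->; rewrite !subrr Normc.normc0 mul0r mulr0.
have -> : radial t d - radial t a =
   (normc a `^ (t - 1))%:C%C * (d - a) + (normc d `^ (t - 1) - normc a `^ (t - 1))%:C%C * d.
  by rewrite /radial rmorphB; ring.
apply: (le_trans (normcD _ _)); rewrite !Normc.normcM !normc_real.
rewrite (ger0_norm (powR_ge0 _ _)).
have := dist_mul_powRD1_le t1 t2 _ (normc_ge0 d) da; rewrite normc_gt0 => /(_ a0).
have h1 : normc a - normc d <= normc (d - a).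
  by have := lerB_normcD a (- d); rewrite normc_opp normcBC.
have := ler_wpM2l (powR_ge0 (normc a) (t - 1)) h1; lra.
Qed.

Lemma radial_holder s a b : 0 < s -> s <= 1 ->
  normc (radial s b - radial s a) <= 4 * normc (b - a) `^ s.
Proof.
move=> s0 s1; case: (leP (normc (b - a)) (normc a)) => h.
  have [ab|ab] := eqVneq b a.
    by rewrite ab !subrr Normc.normc0 mulr_ge0 ?powR_ge0.
  have x0 : 0 < normc (b - a) by rewrite normc_gt0 subr_eq0.
  have a0 : a != 0 by rewrite -normc_gt0 (lt_le_trans x0).
  apply: (le_trans (radial_sub_le1 _ s0 s1 a0)).
  have := powRB1_antitone s1 x0 h; have := mulr_powRB1 (ltW x0) s0.
  have := powR_ge0 (normc a) (s - 1); nra.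
have b2 : normc b <= 2 * normc (b - a).
  by have := normcD (b - a) a; rewrite subrK; lra.
apply: (le_trans (normcB _ _)); rewrite !normc_radial//.
have ha : normc a `^ s <= normc (b - a) `^ s.
  by rewrite powR_homo ?normc_ge0// ltW.
have hb : normc b `^ s <= 2 * normc (b - a) `^ s.
  apply: (@le_trans _ _ ((2 * normc (b - a)) `^ s)).
    by rewrite powR_homo ?normc_ge0// ltW.
  rewrite powRM ?normc_ge0// ler_wpM2r ?powR_ge0//.
  by rewrite ler1_powR// ler1n.
have := powR_ge0 (normc (b - a)) s; lra.
Qed.

(** Near [a] the two radial powers are Lipschitz with constants of order [|a|^(s-1)] and
    [|a|^(t-1)], which are reciprocal because [s + t = 2]. If [d] is much larger than [a], then
    [|d| <= 2 |d - a|], and Hölder continuity of order [s] for one factor and homogeneity of order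
    [t] for the other leave [x^s y^t <= x^2 + y^2]. *)
Lemma radial_cross_le s t a b d : 0 < s -> s <= 1 -> s + t = 2 ->
  normc (radial s b - radial s a) * normc (radial t d - radial t a) <=
  16 * (normc (b - a) ^+ 2 + normc (d - a) ^+ 2).
Proof.
move=> s0 s1 st; have t1 : 1 <= t by lra. have t2 : t <= 2 by lra.
have t0 : 0 < t by lra.
set x := normc (b - a); set y := normc (d - a).
have x0 : 0 <= x := normc_ge0 _. have y0 : 0 <= y := normc_ge0 _.
have xy : 2 * (x * y) <= x ^+ 2 + y ^+ 2 by have := sqr_ge0 (x - y); nra.
have [a0|a0] := eqVneq a 0.
  rewrite /x /y a0 !radial0 !subr0 !normc_radial//.
  have := powRM_le_sqrD s0 t0 st (normc_ge0 b) (normc_ge0 d).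
  by have := sqr_ge0 (normc b); have := sqr_ge0 (normc d); lra.
have A0 : 0 < normc a by rewrite normc_gt0.
have h1 := radial_sub_le1 b s0 s1 a0; rewrite -/x in h1.
have PQ : normc a `^ (s - 1) * normc a `^ (t - 1) = 1.
  rewrite -powRD ?normc_eq0 ?a0 ?implybT//.
  by have -> : s - 1 + (t - 1) = 0; [lra|rewrite powRr0].
have close c : 0 <= c -> c <= 4 ->
    normc (radial t d - radial t a) <= c * (y * normc a `^ (t - 1)) ->
    normc (radial s b - radial s a) * normc (radial t d - radial t a) <=
    16 * (x ^+ 2 + y ^+ 2).
  move=> c0 c4 h2; apply: (le_trans (ler_pM (normc_ge0 _) (normc_ge0 _) h1 h2)).
  have -> : 2 * (x * normc a `^ (s - 1)) * (c * (y * normc a `^ (t - 1))) =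
    2 * c * (x * y) * (normc a `^ (s - 1) * normc a `^ (t - 1)) by ring.
  by rewrite PQ mulr1; have := mulr_ge0 x0 y0; nra.
case: (leP (normc d) (normc a)) => da.
  by apply: (close 2); [lra|lra|exact: radial_sub_ge1].
(* The Lipschitz bound is based at the point of larger modulus, which is now [d]. *)
have h2 := radial_sub_ge1 t1 t2 (ltW da).
rewrite normcBC (normcBC a d) -/y in h2.
case: (leP (normc d) (2 * normc a)) => d2.
  apply: (close 4); [lra|lra|apply: (le_trans h2)].
  have : normc d `^ (t - 1) <= 2 * normc a `^ (t - 1).
    apply: (@le_trans _ _ ((2 * normc a) `^ (t - 1))).
      by rewrite powR_homo ?normc_ge0 ?subr_ge0.
    rewrite powRM ?normc_ge0// ler_wpM2r ?powR_ge0//.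
    by apply: ler1_powR; [rewrite ler1n|lra].
  by move=> /(ler_wpM2l y0); lra.
have dy : normc d <= 2 * y.
  by have := lerB_normcD d (- a); rewrite normc_opp -/y; lra.
have h3 : normc (radial t d - radial t a) <= 4 * y `^ t.
  apply: (le_trans h2).
  have : normc d `^ (t - 1) <= 2 * y `^ (t - 1).
    apply: (@le_trans _ _ ((2 * y) `^ (t - 1))).
      by rewrite powR_homo ?normc_ge0 ?subr_ge0.
    rewrite powRM// ler_wpM2r ?powR_ge0//.
    by apply: ler1_powR; [rewrite ler1n|lra].
  by move=> /(ler_wpM2l y0); have := mulr_powRB1 y0 t0; lra.
have h4 := radial_holder a b s0 s1; rewrite -/x in h4.
apply: (le_trans (ler_pM (normc_ge0 _) (normc_ge0 _) h4 h3)).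
by have := powRM_le_sqrD s0 t0 st x0 y0; lra.
Qed.

Lemma radial_cross s t a b d : 0 < s -> 0 < t -> s + t = 2 ->
  normc (radial s b - radial s a) * normc (radial t d - radial t a) <=
  16 * (normc (b - a) ^+ 2 + normc (d - a) ^+ 2).
Proof.
move=> s0 t0 st; case: (leP s 1) => s1; first exact: radial_cross_le.
by rewrite mulrC [X in 16 * X]addrC; apply: radial_cross_le => //; lra.
Qed.

Lemma Re_scale_mul_conj (x y : R) a b :
  Re (x%:C%C * a * (y%:C%C * b)^*%C) = x * y * Re (a * b^*%C).
Proof. by case: a => a1 a2; case: b => b1 b2 /=; ring. Qed.

Lemma sqr_normcB a b :
  normc (a - b) ^+ 2 = normc a ^+ 2 + normc b ^+ 2 - 2 * Re (a * b^*%C).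
Proof. by rewrite !sqr_normcE; case: a => a1 a2; case: b => b1 b2 /=; ring. Qed.

(** For fixed moduli both sides are affine in [r = Re (a conj b)], which ranges over
    [[-|a||b|, |a||b|]], so the endpoints suffice: [h1] is the refined Young inequality, [h2]
    follows from [m <= s] and [m <= t]. The sign of the slope [m / 2 - X] selects the endpoint. *)
Lemma radial_young s t a b : 0 < s -> 0 < t -> s + t = 2 ->
  Num.min s t / 4 * normc (a - b) ^+ 2 <=
  s / 2 * normc a ^+ 2 + t / 2 * normc b ^+ 2 - Re (radial s a * (radial t b)^*%C).
Proof.
move=> s0 t0 st; set A := normc a; set B := normc b.
have A0 : 0 <= A := normc_ge0 _. have B0 : 0 <= B := normc_ge0 _.
set r := Re (a * b^*%C).
have eR : Re (radial s a * (radial t b)^*%C) = A `^ (s - 1) * B `^ (t - 1) * r.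
  by rewrite Re_scale_mul_conj.
have nr : `|r| <= A * B.
  by rewrite (le_trans (Re_le_normc _))// Normc.normcM normc_conj.
have eN : normc (a - b) ^+ 2 = A ^+ 2 + B ^+ 2 - 2 * r.
  exact: sqr_normcB.
rewrite eN eR.
have y := young_refined s0 t0 st A0 B0.
have EA := mulr_powRB1 A0 s0; have EB := mulr_powRB1 B0 t0.
set X := A `^ (s - 1) * B `^ (t - 1).
have X0 : 0 <= X by rewrite mulr_ge0 ?powR_ge0.
have XAB : X * (A * B) = A `^ s * B `^ t by rewrite -EA -EB /X; ring.
set m := Num.min s t in y *.
have m0 : 0 < m by rewrite lt_min s0.
have ms : m <= s by rewrite ge_min lexx.
have mt : m <= t by rewrite ge_min lexx orbT.
have AB2 := sqr_ge0 (A - B).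
have h1 : 0 <= s / 2 * A ^+ 2 + t / 2 * B ^+ 2 - X * (A * B) - m / 4 * (A - B) ^+ 2.
  by rewrite XAB; have := mulr_ge0 (ltW m0) AB2; lra.
have h2 : 0 <= s / 2 * A ^+ 2 + t / 2 * B ^+ 2 + X * (A * B) - m / 4 * (A + B) ^+ 2.
  have XAB0 := mulr_ge0 X0 (mulr_ge0 A0 B0).
  have : (A + B) ^+ 2 <= 2 * A ^+ 2 + 2 * B ^+ 2 by nra.
  move=> /(ler_wpM2l (ltW m0)).
  have := ler_wpM2r (sqr_ge0 A) ms; have := ler_wpM2r (sqr_ge0 B) mt; lra.
move: nr; rewrite ler_norml => /andP[r1 r2].
case: (leP (m / 2) X) => mX.
  have : (X - m / 2) * r <= (X - m / 2) * (A * B) by rewrite ler_wpM2l ?subr_ge0.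
  by nra.
have : (m / 2 - X) * (- (A * B)) <= (m / 2 - X) * r by rewrite ler_wpM2l// subr_ge0 ltW.
by nra.
Qed.

End RadialPower.

(** * Haar measure *)

Section GroupTopology.
Variable G : topologicalGroupType.
Implicit Types (g x : G) (V : set G).

Lemma mulg_cvg (T : Type) (F : set_system T) (f h : T -> G) g x : Filter F ->
  f @ F --> g -> h @ F --> x -> (fun t => f t * h t)%g @ F --> (g * x)%g.
Proof.
move=> FF fg hx; exact: (cvg_comp2 fg hx (@mulg_continuous G (g, x))).
Qed.

Lemma invg_cvg (T : Type) (F : set_system T) (f : T -> G) g : Filter F ->
  f @ F --> g -> (fun t => (f t)^-1)%g @ F --> g^-1%g.
Proof.
move=> FF fg; apply: (@cvg_comp _ _ _ f (fun x : G => x^-1)%g _ (nbhs g)) => //.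
exact: invg_continuous.
Qed.

Lemma mulg_continuousl g : continuous (fun x => g * x)%g.
Proof. by move=> x; apply: mulg_cvg; [exact: cvg_cst|exact: cvg_id]. Qed.

Lemma mulg_continuousr g : continuous (fun x => x * g)%g.
Proof. by move=> x; apply: mulg_cvg; [exact: cvg_id|exact: cvg_cst]. Qed.

Lemma image_mulgl g V : [set (g * x)%g | x in V] = (fun x => g^-1 * x)%g @^-1` V.
Proof.
apply/seteqP; split => [_ [x Vx <-]|x Vx] /=; first by rewrite mulKg.
by exists (g^-1 * x)%g => //; rewrite mulVKg.
Qed.

Lemma open_mulgl g V : open V -> open [set (g * x)%g | x in V].
Proof.
by move=> oV; rewrite image_mulgl; apply: open_comp => // x _; exact: mulg_continuousl.
Qed.

Lemma mulg_nbhs1 V : nbhs 1%g V ->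
  exists U, [/\ open U, U 1%g, U `<=` V & forall x y, U x -> U y -> V (x * y)%g].
Proof.
move=> V1; have := @mulg_continuous G (1%g, 1%g) V.
rewrite /= mulg1 => /(_ V1)[[A B]/= [A1 B1] AB].
have nW : nbhs 1%g (A `&` B `&` V) by apply: filterI => //; exact: filterI.
exists (A `&` B `&` V)^°; split.
- exact: open_interior.
- exact: nW.
- by move=> x /interior_subset[].
- move=> x y /interior_subset[[Ax _] _] /interior_subset[[_ By] _].
  exact: (AB (x, y)).
Qed.

End GroupTopology.

Section CountableUnions.

Lemma countable_bigcup_nat (T I : Type) (D : set I) (F : I -> set T) :
  countable D -> exists H : nat -> set T,
    (\bigcup_(i in D) F i = \bigcup_n H n) /\
    forall n, H n = set0 \/ exists2 i, D i & H n = F i.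
Proof.
move=> /pfcard_geP[->|[f]].
  exists (fun=> set0); rewrite bigcup_set0 bigcup0//; split => // n; by left.
exists (F \o f); split.
  apply/seteqP; split => x [i Di Fx].
    have [n _ fn] := @surj _ _ _ _ f i Di.
    by exists n => //=; rewrite fn.
  by exists (f i) => //; exact: funS.
by move=> n; right; exists (f n) => //; exact: funS.
Qed.

Lemma countable_bigcup_measurable d (T : measurableType d) I (D : set I) (F : I -> set T) :
  countable D -> (forall i, D i -> measurable (F i)) -> measurable (\bigcup_(i in D) F i).
Proof.
move=> /(countable_bigcup_nat F)[H [-> HE]] mF; apply: bigcupT_measurable => n.
by case: (HE n) => [->//|[i Di ->]]; exact: mF.
Qed.

End CountableUnions.

(** * Measurability of the group operations *)

Section BorelGroup.
Variables (R : realType) (G : topologicalGroupType).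

Lemma open_borel (O : set G) : open O -> measurable (O : set (borel G)).
Proof. by move=> oO; apply: sub_sigma_algebra. Qed.

Lemma continuous_borel (f : G -> G) : continuous f ->
  measurable_fun [set: borel G] (f : borel G -> borel G).
Proof.
move=> cf; apply: (@measurability _ _ (borel G) (borel G) setT _ (@open G)) => //.
move=> _ [Q oQ <-]; rewrite setTI; apply: open_borel.
by apply: open_comp => // x _; exact: cf.
Qed.

Lemma continuous_borel_real (f : G -> R) : continuous f ->
  measurable_fun [set: borel G] (f : borel G -> R).
Proof.
move=> cf; apply: (measurability _ (measurable_realfun.RGenOpens.measurableE R)).
move=> _ [_ [a [b ->] <-]]; rewrite setTI; apply: open_borel.
by apply: open_comp => // x _; exact: cf.
Qed.

Hypothesis sc : @second_countable G.

(** Second countability makes an open set of the product a countable union of open rectangles; the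
    group operations are then measurable for the product sigma-algebra, which Fubini's theorem
    uses. *)
Lemma open_borel2 (O : set (G * G)) : open O -> measurable (O : set (borel G * borel G)).
Proof.
move=> oO; have [B cB [Bo Bn]] := sc.
pose D := [set P : set G * set G | [/\ B P.1, B P.2 & P.1 `*` P.2 `<=` O]].
have -> : O = \bigcup_(P in D) (P.1 `*` P.2).
  apply/seteqP; split => [[x y] Oxy|z [P [_ _ PO] Pz]]; last exact: PO.
  have [[X Y]/= [nX nY] XY] := open_nbhs_nbhs (conj oO Oxy).
  have [X' [BX' X'x] sX] := Bn x _ nX.
  have [Y' [BY' Y'y] sY] := Bn y _ nY.
  exists (X', Y') => //; split => //= -[a b] [/= Xa Yb].
  by apply: XY; split; [exact: sX|exact: sY].
apply: countable_bigcup_measurable.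
  apply: (@sub_countable _ _ D (B `*` B)); last exact: countableX.
  by apply: subset_card_le => P [].
move=> P [BP1 BP2 _]; apply: measurableX; apply: open_borel; exact: Bo.
Qed.

Lemma continuous_borel2 (f : G * G -> G) : continuous f ->
  measurable_fun [set: borel G * borel G] (f : borel G * borel G -> borel G).
Proof.
move=> cf; apply: (@measurability _ _ _ (borel G) setT _ (@open G)) => //.
move=> _ [Q oQ <-]; rewrite setTI; apply: open_borel2.
by apply: open_comp => // x _; exact: cf.
Qed.

Lemma measurable_divl : measurable_fun [set: borel G * borel G]
  (fun z : borel G * borel G => ((z.1 : G)^-1 * z.2)%g : borel G).
Proof.
apply: (@continuous_borel2 (fun z => z.1^-1 * z.2)%g) => z.
apply: mulg_cvg; last exact: cvg_snd.
by apply: invg_cvg; exact: cvg_fst.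
Qed.

(** The basic open sets that fit into some translate of [V] are countably many and already cover
    [G]. *)
Lemma translates_countable_cover (V : set G) : nbhs 1%g V ->
  exists g : nat -> G, [set: G] = \bigcup_n [set (g n * x)%g | x in V].
Proof.
move=> V1; have [B cB [Bo Bn]] := sc.
pose D := [set O | B O /\ exists g, O `<=` [set (g * x)%g | x in V]].
have cD : countable D by apply: (sub_countable _ cB); apply: subset_card_le => Q [].
have cover x : exists2 O, D O & O x.
  have nV : nbhs x [set (x * y)%g | y in V].
    rewrite image_mulgl; apply: mulg_continuousl; by rewrite mulVg.
  by have [Q [BO Ox] OV] := Bn x _ nV; exists Q => //; split => //; exists x.
case: (pfcard_geP cD) => [D0|[f]].
  by have [Q] := cover 1%g; rewrite D0.
have gE n : {g | f n `<=` [set (g * x)%g | x in V]}.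
  by apply: cid; have [] : D (f n) by exact: funS.
exists (fun n => projT1 (gE n)); apply/seteqP; split => // x _.
have [Q DO Ox] := cover x; have [n _ fn] := @surj _ _ _ _ f Q DO.
by exists n => //; apply: (projT2 (gE n)); rewrite fn.
Qed.

End BorelGroup.

Section HaarMeasure.
Variables (R : realType) (G : topologicalGroupType).
Variable mu : {measure set (borel G) -> \bar R}.
Hypothesis sc : @second_countable G.
Hypothesis haar : left_haar mu.

Lemma haar_precompact_lty (V : set G) : open V -> precompact V -> (mu V < +oo)%E.
Proof.
move=> oV; rewrite precompactE => cV; have [_ fc _] := haar.
apply: (le_lt_trans _ (fc _ cV)); apply: le_measure; rewrite ?inE.
- exact: open_borel.
- rewrite -[closure V]setCK; apply: measurableC; apply: open_borel.
  exact/closed_openC/closed_closure.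
- exact: subset_closure.
Qed.

Lemma haar_sigma_finite (U : set G) : open U -> precompact U -> U 1%g ->
  sigma_finite [set: borel G] mu.
Proof.
move=> oU pU U1; have [iv _ _] := haar.
have [g gE] := translates_countable_cover sc (open_nbhs_nbhs (conj oU U1)).
exists (fun n => [set (g n * x)%g | x in U]) => // n; split.
  by apply: open_borel; exact: open_mulgl.
by rewrite iv; [exact: haar_precompact_lty|exact: open_borel].
Qed.

(** Otherwise countably many null translates would cover [G]. *)
Lemma haar_open_gt0 (V : set G) : open V -> V 1%g -> (0 < mu V)%E.
Proof.
move=> oV V1; have [iv _ nz] := haar.
rewrite lt0e measure_ge0 andbT; apply: contra_neq nz => V0.
have [g gE] := translates_countable_cover sc (open_nbhs_nbhs (conj oV V1)).
have mgV n : measurable ([set (g n * x)%g | x in V] : set (borel G)).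
  by apply: open_borel; exact: open_mulgl.
apply/(negligibleP mu measurableT); rewrite gE.
apply: negligible_bigcup => n; apply/(negligibleP mu (mgV n)).
by apply: (eq_trans (iv (g n) V _) V0); exact: open_borel.
Qed.

Lemma haar_preimage (g : G) (B : set (borel G)) : measurable B ->
  mu ((fun x : borel G => (g * x)%g : borel G) @^-1` B) = mu B.
Proof.
move=> mB; have [iv _ _] := haar; rewrite -(iv g^-1%g B mB) image_mulgl.
by rewrite invgK.
Qed.

Lemma measurable_mulgl (g : G) :
  measurable_fun [set: borel G] (fun x : borel G => (g * x)%g : borel G).
Proof. exact: (continuous_borel (@mulg_continuousl G g)). Qed.

Lemma haar_integral_translate (g : G) (f : borel G -> \bar R) :
  measurable_fun [set: borel G] f -> (forall x, 0 <= f x)%E ->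
  (\int[mu]_x (f (g * (x : G))%g) = \int[mu]_x (f x))%E.
Proof.
move=> mf f0; have mg := measurable_mulgl g.
have := @ge0_integral_pushforward _ _ _ _ R _ mg mu setT f measurableT mf.
rewrite preimage_setT => <-; last by move=> x _; exact: f0.
by apply: eq_measure_integral => A mA _; rewrite /= /pushforward haar_preimage.
Qed.

End HaarMeasure.

(** * Convolution on L^p *)

Section ComplexMeasurability.
Context {R : realType} {d : measure_display} {T : measurableType d}.
Implicit Types f g : T -> R[i].

(** [Cmeasurable] over an arbitrary measurable type, so that it also applies on
    [borel G * borel G]. *)
Definition cmeas f := measurable_fun [set: T] (fun x => Re (f x)) /\
  measurable_fun [set: T] (fun x => Im (f x)).

Lemma cmeas_normc f : cmeas f -> measurable_fun [set: T] (fun x => normc (f x)).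
Proof.
move=> [fr fi].
have -> : (fun x => normc (f x)) =
    (fun y : R => y `^ 2^-1) \o (fun x => Re (f x) ^+ 2 + Im (f x) ^+ 2).
  apply/funext => x /=; rewrite powR12_sqrt ?addr_ge0 ?sqr_ge0//.
  by case: (f x).
apply: measurableT_comp; first exact: measurable_powR.
by apply: measurable_funD; exact: measurable_funX.
Qed.

Lemma cmeasD f g : cmeas f -> cmeas g -> cmeas (fun x => f x + g x).
Proof.
move=> [fr fi] [gr gi]; split.
  by under eq_fun do rewrite raddfD; exact: measurable_funD.
by under eq_fun do rewrite raddfD; exact: measurable_funD.
Qed.

Lemma ReM (z w : R[i]) : Re (z * w) = Re z * Re w - Im z * Im w.
Proof. by case: z; case: w. Qed.

Lemma ImM (z w : R[i]) : Im (z * w) = Re z * Im w + Im z * Re w.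
Proof. by case: z; case: w. Qed.

Lemma cmeasM f g : cmeas f -> cmeas g -> cmeas (fun x => f x * g x).
Proof.
move=> [fr fi] [gr gi]; split.
  by under eq_fun do rewrite ReM; apply: measurable_funB; exact: measurable_funM.
by under eq_fun do rewrite ImM; apply: measurable_funD; exact: measurable_funM.
Qed.

Lemma cmeas_conj f : cmeas f -> cmeas (fun x => (f x)^*%C).
Proof.
move=> [fr fi]; split.
  by have -> : (fun x => Re (f x)^*%C) = (fun x => Re (f x)) by apply/funext => x; case: (f x).
have -> : (fun x => Im (f x)^*%C) = (fun x => - Im (f x)) by apply/funext => x; case: (f x).
exact: measurable_funN.
Qed.

Lemma cmeas_real (h : T -> R) : measurable_fun [set: T] h -> cmeas (fun x => (h x)%:C%C).
Proof. by move=> mh; split => //=; exact: measurable_cst. Qed.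

Lemma cmeas_cst (z : R[i]) : cmeas (fun=> z).
Proof. by split; exact: measurable_cst. Qed.

Lemma cmeasZ (z : R[i]) f : cmeas f -> cmeas (fun x => z * f x).
Proof. by move=> mf; apply: cmeasM => //; exact: cmeas_cst. Qed.

Lemma cmeasB f g : cmeas f -> cmeas g -> cmeas (fun x => f x - g x).
Proof.
move=> mf mg; have -> : (fun x => f x - g x) = (fun x => f x + (-1) * g x).
  by apply/funext => x; rewrite mulN1r.
by apply: cmeasD => //; exact: cmeasZ.
Qed.

Lemma cmeas_radial s f : cmeas f -> cmeas (fun x => radial s (f x)).
Proof.
move=> mf; rewrite /radial; apply: cmeasM => //; apply: cmeas_real.
apply: (measurableT_comp (measurable_powR (s - 1))); exact: cmeas_normc.
Qed.

End ComplexMeasurability.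

Lemma cmeas_comp (R : realType) d d' (T : measurableType d) (T' : measurableType d')
  (f : T' -> R[i]) (phi : T -> T') :
  measurable_fun [set: T] phi -> cmeas f -> cmeas (f \o phi).
Proof.
move=> mphi [fr fi]; split.
  exact: (measurableT_comp fr mphi).
exact: (measurableT_comp fi mphi).
Qed.

Section RealIntegrals.
Context {R : realType} {d : measure_display} {T : measurableType d}.
Variable mu : {measure set T -> \bar R}.
Implicit Types f g : T -> R.

Definition integ f := mu.-integrable [set: T] (EFin \o f).

Lemma integ_meas f : integ f -> measurable_fun [set: T] f.
Proof. by move=> /integrableP[/measurable_EFinP]. Qed.

Lemma integD f g : integ f -> integ g -> integ (fun x => f x + g x).
Proof. by move=> fi gi; exact: (integrableD measurableT fi gi). Qed.

Lemma integZ (a : R) f : integ f -> integ (fun x => a * f x).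
Proof. by move=> fi; exact: (integrableZl measurableT a fi). Qed.

Lemma integB f g : integ f -> integ g -> integ (fun x => f x - g x).
Proof. by move=> fi gi; exact: (integrableB measurableT fi gi). Qed.

Lemma integ_le f g : measurable_fun [set: T] f -> integ g ->
  (forall x, `|f x| <= g x) -> integ f.
Proof.
move=> mf gi fg; apply: (@le_integrable _ _ _ mu setT measurableT _ (EFin \o g)) => //.
  exact/measurable_EFinP.
by move=> x _ /=; rewrite lee_fin (le_trans (fg x))// ler_norm.
Qed.

Lemma integ_ge0P f : measurable_fun [set: T] f -> (forall x, 0 <= f x) ->
  integ f <-> (\int[mu]_x (f x)%:E < +oo)%E.
Proof.
move=> mf f0; split => [/integrable_lty|fy]; first by apply.
apply/integrableP; split; first exact/measurable_EFinP.
by under eq_integral do rewrite gee0_abs ?lee_fin//.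
Qed.

Lemma integ_EFin f : integ f -> (\int[mu]_x (f x)%:E)%E = (\int[mu]_x f x)%:E.
Proof.
by move=> fi; rewrite fineK//; exact: (@integrable_fin_num _ _ _ mu setT).
Qed.

Lemma RintD f g : integ f -> integ g ->
  \int[mu]_x (f x + g x) = \int[mu]_x f x + \int[mu]_x g x.
Proof. by move=> fi gi; exact: (RintegralD measurableT fi gi). Qed.

Lemma RintB f g : integ f -> integ g ->
  \int[mu]_x (f x - g x) = \int[mu]_x f x - \int[mu]_x g x.
Proof. by move=> fi gi; exact: (RintegralB measurableT fi gi). Qed.

Lemma RintZ (a : R) f : integ f -> \int[mu]_x (a * f x) = a * \int[mu]_x f x.
Proof. by move=> fi; rewrite RintegralZl. Qed.

Lemma le_Rint f g : integ f -> integ g -> (forall x, f x <= g x) ->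
  \int[mu]_x f x <= \int[mu]_x g x.
Proof. by move=> fi gi fg; apply: (le_Rintegral measurableT fi gi) => x _. Qed.

Lemma norm_Rint_le f g : integ f -> integ g -> (forall x, `|f x| <= g x) ->
  `|\int[mu]_x f x| <= \int[mu]_x g x.
Proof.
move=> fi gi fg; apply: (le_trans (le_normr_Rintegral measurableT fi)).
by apply: le_Rint => //; exact: (integrable_norm fi).
Qed.

End RealIntegrals.

Section ComplexIntegral.
Variables (R : realType) (G : topologicalGroupType).
Variable mu : {measure set (borel G) -> \bar R}.
Implicit Types f : borel G -> R[i].

Lemma cmeas_ReM_integ f (z : R[i]) : cmeas f -> integ mu (fun x => normc (f x)) ->
  integ mu (fun x => Re (z * f x)).
Proof.
move=> mf fi; apply: (integ_le _ (integZ (normc z) fi)).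
  exact: (cmeasZ z mf).1.
by move=> x; rewrite -Normc.normcM Re_le_normc.
Qed.

Lemma Re_Cintegral f (z : R[i]) : cmeas f -> integ mu (fun x => normc (f x)) ->
  Re (z * Cintegral mu f) = \int[mu]_x Re (z * f x).
Proof.
move=> mf fi.
have ir : integ mu (fun x => Re (f x)).
  by apply: (integ_le mf.1 fi) => x; exact: Re_le_normc.
have ii : integ mu (fun x => Im (f x)).
  by apply: (integ_le mf.2 fi) => x; exact: Im_le_normc.
under eq_Rintegral do rewrite ReM.
rewrite RintB; [|exact: integZ|exact: integZ].
by rewrite !RintZ// ReM.
Qed.

Lemma normc_Cintegral_le f : cmeas f ->
  ((normc (Cintegral mu f))%:E <= \int[mu]_x (normc (f x))%:E)%E.
Proof.
move=> mf; have mn := cmeas_normc mf.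
have [fy|fy] := ltP (\int[mu]_x (normc (f x))%:E)%E +oo%E; last first.
  by rewrite (le_trans _ fy)// leey.
have fi : integ mu (fun x => normc (f x)).
  by apply/integ_ge0P => // x; exact: normc_ge0.
have [s s1 ->] := unimodular_rotation (Cintegral mu f).
rewrite Re_Cintegral// integ_EFin// lee_fin; apply: le_Rint => //.
  exact: cmeas_ReM_integ.
move=> x; rewrite (le_trans (ler_norm _))// (le_trans (Re_le_normc _))//.
by rewrite Normc.normcM s1 mul1r.
Qed.

Lemma Cintegral_add f g : cmeas f -> cmeas g ->
  integ mu (fun x => normc (f x)) -> integ mu (fun x => normc (g x)) ->
  Cintegral mu (fun x => f x + g x) = Cintegral mu f + Cintegral mu g.
Proof.
move=> mf mg fi gi; rewrite /Cintegral.
have h (u : borel G -> R[i]) : cmeas u -> integ mu (fun x => normc (u x)) ->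
    integ mu (fun x => Re (u x)) /\ integ mu (fun x => Im (u x)).
  move=> mu' ui; split.
    by apply: (integ_le mu'.1 ui) => x; exact: Re_le_normc.
  by apply: (integ_le mu'.2 ui) => x; exact: Im_le_normc.
have [fr fim] := h _ mf fi; have [gr gim] := h _ mg gi.
under eq_Rintegral do rewrite raddfD.
under [X in Complex _ X]eq_Rintegral do rewrite raddfD.
by rewrite !RintD//.
Qed.

Lemma Cintegral_scale f (z : R[i]) : cmeas f -> integ mu (fun x => normc (f x)) ->
  Cintegral mu (fun x => z * f x) = z * Cintegral mu f.
Proof.
move=> mf fi; apply/eqP; rewrite eq_complex; apply/andP; split; apply/eqP.
  by rewrite Re_Cintegral.
have e (w : R[i]) : Im w = Re (- 'i%C * w) by case: w => a b /=; ring.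
rewrite [RHS]e mulrA Re_Cintegral//=.
by apply: eq_Rintegral => x _; rewrite [LHS]e mulrA.
Qed.

End ComplexIntegral.

Section IteratedIntegrals.
Context {R : realType} {d : measure_display} {T : measurableType d}.
Variable mu : {sigma_finite_measure set T -> \bar R}.
Implicit Types k b : T * T -> R.

Lemma ae_eq_Rint (f g : T -> R) : measurable_fun [set: T] f -> measurable_fun [set: T] g ->
  {ae mu, forall x, f x = g x} -> \int[mu]_x f x = \int[mu]_x g x.
Proof.
move=> mf mg fg; congr fine; apply: ae_eq_integral => //.
- exact/measurable_EFinP.
- exact/measurable_EFinP.
- by apply: filterS fg => x -> _.
Qed.

(** The total integral is the difference of those of the positive and negative parts, each
    measurable by Tonelli. Hence convolutions are measurable even where they diverge. *)
Lemma measurable_iterated_EFin k : measurable_fun [set: T * T] k ->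
  measurable_fun [set: T] (fun x => \int[mu]_h (k (h, x))%:E)%E.
Proof.
move=> mk; have mK : measurable_fun [set: T * T] (EFin \o k) by exact/measurable_EFinP.
have mp := measurable_funepos mK; have mn := measurable_funeneg mK.
have := emeasurable_funB
  (@measurable_fun_fubini_tonelli_G _ _ _ _ _ mu (EFin \o k)^\+%E mp (funepos_ge0 _))
  (@measurable_fun_fubini_tonelli_G _ _ _ _ _ mu (EFin \o k)^\-%E mn (funeneg_ge0 _)).
congr (measurable_fun _ _); apply/funext => x; rewrite [RHS]integralE /fubini_G.
by congr (_ - _)%E; apply: eq_integral => y _; rewrite ?funeposE ?funenegE.
Qed.

Lemma measurable_iterated_Rint k : measurable_fun [set: T * T] k ->
  measurable_fun [set: T] (fun x => \int[mu]_h k (h, x)).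
Proof.
move=> mk; apply: (measurableT_comp (fine_measurable measurableT)).
exact: measurable_iterated_EFin.
Qed.

(** Real-valued integrals apply [fine] to the inner integral; this alters it only where it is
    infinite, a null set because [k] is integrable on the product. *)
Lemma fubini_Rint k b : measurable_fun [set: T * T] k -> measurable_fun [set: T * T] b ->
  (forall z, `|k z| <= b z) ->
  (\int[mu]_h \int[mu]_x (b (h, x))%:E < +oo)%E ->
  integ mu (fun h => \int[mu]_x k (h, x)) /\
  \int[mu]_h (\int[mu]_x k (h, x)) = \int[mu]_x (\int[mu]_h k (h, x)).
Proof.
move=> mk mb kb bfin.
have mK : measurable_fun [set: T * T] (EFin \o k) by exact/measurable_EFinP.
have mB : measurable_fun [set: T * T] (EFin \o b) by exact/measurable_EFinP.
have b0 z : 0 <= b z by rewrite (le_trans _ (kb z)).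
have b0' z : (0 <= (EFin \o b) z)%E by rewrite lee_fin.
have ik : (mu \x mu)%E.-integrable [set: T * T] (EFin \o k).
  apply/integrable12ltyP => //; apply: le_lt_trans bfin.
  apply: ge0_le_integral => //.
  - by move=> x _; exact: integral_ge0.
  - apply: (measurable_fun_fubini_tonelli_F (abse \o (EFin \o k))) => //.
      exact: measurableT_comp.
    by move=> z; exact: abse_ge0.
  - exact: (@measurable_fun_fubini_tonelli_F _ _ _ _ _ mu (EFin \o b) mB b0').
  - move=> x _; apply: ge0_le_integral => //.
    + apply: (measurableT_comp (f := fun z => `|(EFin \o k) z|%E) (g := fun y => (x, y))).
        exact: measurableT_comp.
      exact: pair1_measurable.
    + apply: (measurableT_comp (f := EFin \o b) (g := fun y => (x, y))) => //.
      exact: pair1_measurable.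
    + by move=> y _ /=; rewrite lee_fin.
have ik' : (mu \x mu)%E.-integrable [set: T * T] (fun z => (k (z.2, z.1))%:E).
  apply/integrable12ltyP; last exact: ((integrable21ltyP mu mu mK).1 ik).
  apply: (measurableT_comp mK); apply: measurable_fun_pair.
    exact: measurable_snd.
  exact: measurable_fst.
have iF := integrable_fubini_F ik; have iG := integrable_fubini_F ik'.
have eF : {ae mu, forall h, ((\int[mu]_x k (h, x))%:E = \int[mu]_x (k (h, x))%:E)%E}.
  by apply: filterS (integrable_ae measurableT iF) => h /(_ I) ?; rewrite fineK.
have eG : {ae mu, forall x, ((\int[mu]_h k (h, x))%:E = \int[mu]_h (k (h, x))%:E)%E}.
  by apply: filterS (integrable_ae measurableT iG) => x /(_ I) ?; rewrite fineK.
have mF : measurable_fun [set: T] (fun h => \int[mu]_x k (h, x)).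
  apply: (measurableT_comp (fine_measurable measurableT)).
  exact: (measurable_int mu iF).
have mG := measurable_iterated_Rint mk.
split.
  apply/integrableP; split; first exact/measurable_EFinP.
  have /integrableP[_] := iF; apply: le_lt_trans.
  rewrite (ge0_ae_eq_integral _ _ _ (g := fun h => `|\int[mu]_x (k (h, x))%:E|%E)) //.
  - by apply: measurableT_comp => //; exact/measurable_EFinP.
  - by apply: measurableT_comp => //; exact: (measurable_int mu iF).
  - by apply: filterS eF => h eh _; exact: (congr1 abse eh).
congr fine; transitivity (\int[mu]_h \int[mu]_x (k (h, x))%:E)%E.
  apply: ae_eq_integral => //; first exact/measurable_EFinP.
    exact: (measurable_int mu iF).
  by apply: filterS eF => h eh _; exact: eh.
rewrite (Fubini ik); apply/esym/ae_eq_integral => //; first exact/measurable_EFinP.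
  exact: (measurable_int mu iG).
by apply: filterS eG => h eh _; exact: eh.
Qed.

End IteratedIntegrals.

Section Jensen.
Context {R : realType} {d : measure_display} {T : measurableType d}.
Variable mu : {measure set T -> \bar R}.

Lemma powR_le_powRD1 (y p : R) : 1 <= p -> 0 <= y -> y <= 1 + y `^ p.
Proof.
move=> p1 y0; have := powR_ge0 y p; case: (leP y 1) => y1; first lra.
by have := le1r_powR (ltW y1) p1; lra.
Qed.

Lemma density_integ (K y : T -> R) (p : R) : 1 <= p -> integ mu K ->
  (forall x, 0 <= K x) -> measurable_fun [set: T] y -> (forall x, 0 <= y x) ->
  integ mu (fun x => K x * y x `^ p) -> integ mu (fun x => K x * y x).
Proof.
move=> p1 iK K0 my y0 iKp; apply: (integ_le _ (integD iK iKp)).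
  by apply: measurable_funM => //; exact: integ_meas iK.
move=> x; rewrite ger0_norm ?mulr_ge0// -[X in X + _]mulr1 -mulrDr ler_wpM2l//.
exact: powR_le_powRD1.
Qed.

(** Young's inequality for [y x] and [m^(p-1)] is the tangent line of the convex power at the mean
    [m]; it is integrated against [K]. *)
Lemma jensen_powR (K y : T -> R) (p : R) : 1 < p -> integ mu K ->
  (forall x, 0 <= K x) -> \int[mu]_x K x = 1 ->
  measurable_fun [set: T] y -> (forall x, 0 <= y x) ->
  integ mu (fun x => K x * y x `^ p) ->
  (\int[mu]_x (K x * y x)) `^ p <= \int[mu]_x (K x * y x `^ p).
Proof.
move=> p1 iK K0 K1 my y0 iKp; have p0 : 0 < p by lra.
have iKy := density_integ (ltW p1) iK K0 my y0 iKp.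
set m := \int[mu]_x (K x * y x).
have m0 : 0 <= m by apply: Rintegral_ge0 => x _; rewrite mulr_ge0.
pose q := p / (p - 1).
have q0 : 0 < q by rewrite divr_gt0// subr_gt0.
have pq : p^-1 + q^-1 = 1.
  by rewrite /q invf_div; field; rewrite ?gt_eqF ?subr_gt0//.
have young x : m `^ (p - 1) * y x <= y x `^ p / p + m `^ p / q.
  have := conjugate_powR (y0 x) (powR_ge0 m (p - 1)) p0 q0 pq.
  rewrite -powRrM mulrC; congr (_ <= _ + _ `^ _ / _).
  by rewrite /q mulrC divfK// gt_eqF// subr_gt0.
have : \int[mu]_x (m `^ (p - 1) * (K x * y x)) <=
    \int[mu]_x (p^-1 * (K x * y x `^ p) + m `^ p / q * K x).
  apply: le_Rint; [exact: integZ|by apply: integD; exact: integZ|] => x.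
  have := ler_wpM2l (K0 x) (young x); lra.
rewrite RintD; [|exact: integZ|exact: integZ].
rewrite !RintZ// K1 mulr1 -/m [_ * m]mulrC mulr_powRB1//.
have -> : q^-1 = 1 - p^-1 by lra.
move=> h; have : p^-1 * m `^ p <= p^-1 * \int[mu]_x (K x * y x `^ p) by lra.
by rewrite ler_pM2l// invr_gt0.
Qed.

End Jensen.

Lemma ae_imp2 (R : realType) d (T : measurableType d) (mu : {measure set T -> \bar R})
  (P Q S : T -> Prop) : (forall x, P x -> Q x -> S x) ->
  {ae mu, forall x, P x} -> {ae mu, forall x, Q x} -> {ae mu, forall x, S x}.
Proof. by move=> PQS; apply: filterS2. Qed.

(** * Convolution with a density contracts L^p *)

Section Convolution.
Variables (R : realType) (G : topologicalGroupType).
Variable mu : {sigma_finite_measure set (borel G) -> \bar R}.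
Hypothesis sc : @second_countable G.
Hypothesis haar : left_haar mu.
Implicit Types f g : borel G -> R[i].

Lemma cmeas_div f : cmeas f ->
  cmeas (fun z : borel G * borel G => f (((z.1 : G)^-1 * z.2)%g : borel G)).
Proof. by move=> mf; exact: (cmeas_comp (measurable_divl sc) mf). Qed.

Lemma cmeas_translate (h : G) f : cmeas f -> cmeas (fun x : borel G => f (h * (x : G))%g).
Proof. by move=> mf; exact: (cmeas_comp (measurable_mulgl h) mf). Qed.

Lemma measurable_div_slice (x : G) :
  measurable_fun [set: borel G] (fun h : borel G => ((h : G)^-1 * x)%g : borel G).
Proof.
apply: (@continuous_borel G (fun h : G => h^-1 * x)%g) => h.
by apply: mulg_cvg; [apply: invg_cvg; exact: cvg_id|exact: cvg_cst].
Qed.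

Lemma cmeas_div_slice (x : G) f : cmeas f -> cmeas (fun h : borel G => f ((h : G)^-1 * x)%g).
Proof. by move=> mf; exact: (cmeas_comp (measurable_div_slice x) mf). Qed.

Lemma integ_translate (h : G) (u : borel G -> R) : integ mu u ->
  integ mu (fun x : borel G => u (h * (x : G))%g).
Proof.
move=> iu; have mu_ := integ_meas iu.
have mu' : measurable_fun [set: borel G] (fun x : borel G => u (h * (x : G))%g).
  exact: (measurableT_comp mu_ (measurable_mulgl h)).
apply/integrableP; split; first exact/measurable_EFinP.
have /integrableP[_] := iu.
rewrite -(haar_integral_translate haar h (f := fun x => `|(u x)%:E|%E))//.
by apply: measurableT_comp => //; exact/measurable_EFinP.
Qed.

Lemma Rint_translate (h : G) (u : borel G -> R) : measurable_fun [set: borel G] u ->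
  \int[mu]_x u (h * (x : G))%g = \int[mu]_x u x.
Proof.
move=> mu_; have mE : measurable_fun [set: borel G] (EFin \o u) by exact/measurable_EFinP.
rewrite /Rintegral [in RHS]integralE [in LHS]integralE; congr (fine (_ - _)%E).
  have := haar_integral_translate haar h (measurable_funepos mE) (funepos_ge0 _).
  move=> e; transitivity (\int[mu]_x ((EFin \o u)^\+%E (h * (x : G))%g))%E.
    by apply: eq_integral => x _; rewrite !funeposE.
  by rewrite e; apply: eq_integral => x _; rewrite !funeposE.
have := haar_integral_translate haar h (measurable_funeneg mE) (funeneg_ge0 _).
move=> e; transitivity (\int[mu]_x ((EFin \o u)^\-%E (h * (x : G))%g))%E.
  by apply: eq_integral => x _; rewrite !funenegE.
by rewrite e; apply: eq_integral => x _; rewrite !funenegE.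
Qed.

Variable K : G -> R.
Hypothesis hK : prob_density mu K.

Lemma density_ge0 x : 0 <= K x. Proof. by have [_ + _] := hK; exact. Qed.

Lemma density_measurable : measurable_fun [set: borel G] (K : borel G -> R).
Proof. by have [+ _ _] := hK. Qed.

Lemma density_integrable : integ mu (K : borel G -> R).
Proof.
apply/integ_ge0P; [exact: density_measurable|exact: density_ge0|].
by have [_ _ ->] := hK; rewrite ltry.
Qed.

Lemma density_Rint : \int[mu]_x K x = 1.
Proof. by have [_ _ e] := hK; rewrite /Rintegral e. Qed.

Lemma density_tonelli (u : borel G -> R) : measurable_fun [set: borel G] u ->
  (forall x, 0 <= u x) ->
  (\int[mu]_x \int[mu]_h (K h * u ((h : G)^-1 * x)%g)%:E = \int[mu]_x (u x)%:E)%E.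
Proof.
move=> mu_ u0; pose k (z : borel G * borel G) := K z.1 * u ((z.1 : G)^-1 * z.2)%g.
have mk : measurable_fun setT k.
  apply: measurable_funM.
    exact: (measurableT_comp density_measurable measurable_fst).
  exact: (measurableT_comp mu_ (measurable_divl sc)).
have k0 z : (0 <= (k z)%:E)%E by rewrite lee_fin mulr_ge0// density_ge0.
have mE : measurable_fun setT (EFin \o k) by exact/measurable_EFinP.
transitivity (\int[mu]_h \int[mu]_x (k (h, x))%:E)%E.
  by apply/esym; exact: (@fubini_tonelli _ _ _ _ R mu mu (EFin \o k) mE k0).
transitivity (\int[mu]_h ((K h)%:E * \int[mu]_x (u x)%:E))%E.
  apply: eq_integral => h _; rewrite /k /=.
  under eq_integral do rewrite EFinM.
  rewrite ge0_integralZl//.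
  - congr (_ * _)%E.
    apply: (haar_integral_translate haar _ (f := fun x => (u x)%:E)) => //.
    exact/measurable_EFinP.
  - apply/measurable_EFinP; exact: (measurableT_comp mu_ (measurable_mulgl _)).
  - by move=> x _; rewrite lee_fin.
  - by rewrite lee_fin density_ge0.
rewrite ge0_integralZr//.
- by have [_ _ ->] := hK; rewrite mul1e.
- by apply/measurable_EFinP; exact: density_measurable.
- by move=> h _; rewrite lee_fin density_ge0.
- by apply: integral_ge0 => x _; rewrite lee_fin.
Qed.

Let T := conv_op mu K.

Lemma cmeas_conv_integrand f (x : G) : cmeas f ->
  cmeas (fun h : borel G => (K h)%:C%C * f ((h : G)^-1 * x)%g).
Proof.
by move=> mf; apply: cmeasM; [apply: cmeas_real; exact: density_measurable|exact: cmeas_div_slice].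
Qed.

Lemma normc_conv_integrand f (x h : G) :
  normc ((K h)%:C%C * f (h^-1 * x)%g) = K h * normc (f (h^-1 * x)%g).
Proof. by rewrite Normc.normcM normc_real ger0_norm// density_ge0. Qed.

Lemma cmeas_conv f : cmeas f -> cmeas (T f : borel G -> R[i]).
Proof.
move=> mf.
have mk : cmeas (fun z : borel G * borel G => (K z.1)%:C%C * f ((z.1 : G)^-1 * z.2)%g).
  apply: cmeasM; last exact: cmeas_div.
  by apply: cmeas_real; exact: (measurableT_comp density_measurable measurable_fst).
split.
  exact: (measurable_iterated_Rint mu mk.1).
exact: (measurable_iterated_Rint mu mk.2).
Qed.

Section Power.
Variable p : R.
Hypothesis p1 : 1 < p.

Definition Lp f := cmeas f /\ integ mu (fun x => normc (f x) `^ p).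

Lemma measurable_normc_powR s f : cmeas f ->
  measurable_fun [set: borel G] (fun x => normc (f x) `^ s).
Proof.
by move=> mf; apply: (measurableT_comp (measurable_powR s)); exact: cmeas_normc.
Qed.

Lemma normc_conv_powR_le f x : cmeas f ->
  ((normc (T f x) `^ p)%:E <= \int[mu]_h (K h * normc (f ((h : G)^-1 * x)%g) `^ p)%:E)%E.
Proof.
move=> mf; set M := (\int[mu]_h _)%E.
have my := cmeas_normc (cmeas_div_slice x mf).
have mKp : measurable_fun [set: borel G]
    (fun h : borel G => K h * normc (f ((h : G)^-1 * x)%g) `^ p).
  apply: measurable_funM; first exact: density_measurable.
  exact: (measurableT_comp (measurable_powR p) my).
have [My|My] := ltP M +oo%E; last by rewrite (le_trans _ My)// leey.
have iKp : integ mu (fun h : borel G => K h * normc (f ((h : G)^-1 * x)%g) `^ p).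
  by apply/integ_ge0P => // h; rewrite mulr_ge0 ?density_ge0 ?powR_ge0.
have y0 (h : borel G) : 0 <= normc (f ((h : G)^-1 * x)%g) by exact: normc_ge0.
rewrite /M integ_EFin// lee_fin.
apply: le_trans (jensen_powR p1 density_integrable density_ge0 density_Rint my y0 iKp).
apply: powR_homo; [exact: ltW (lt_trans ltr01 p1)|exact: normc_ge0|].
have iKy := density_integ (ltW p1) density_integrable density_ge0 my y0 iKp.
rewrite -lee_fin -integ_EFin//.
apply: (le_trans (normc_Cintegral_le mu (cmeas_conv_integrand x mf))).
rewrite le_eqVlt; apply/orP; left; apply/eqP; apply: eq_integral => h _.
by rewrite normc_conv_integrand.
Qed.

Lemma conv_contraction f : cmeas f ->
  (\int[mu]_x (normc (T f x) `^ p)%:E <= \int[mu]_x (normc (f x) `^ p)%:E)%E.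
Proof.
move=> mf; rewrite -(density_tonelli (measurable_normc_powR p mf)); last first.
  by move=> x; exact: powR_ge0.
apply: ge0_le_integral => //.
- by move=> x _; rewrite lee_fin powR_ge0.
- by apply/measurable_EFinP; apply: measurable_normc_powR; exact: cmeas_conv.
- apply: (@measurable_iterated_EFin _ _ _ mu
    (fun z : borel G * borel G => K z.1 * normc (f ((z.1 : G)^-1 * z.2)%g) `^ p)).
  apply: measurable_funM.
    exact: (measurableT_comp density_measurable measurable_fst).
  exact: (measurableT_comp (measurable_powR p) (cmeas_normc (cmeas_div mf))).
- by move=> x _; exact: normc_conv_powR_le.
Qed.

Lemma Lp_conv f : Lp f -> Lp (T f : borel G -> R[i]).
Proof.
move=> [mf fi]; split; first exact: cmeas_conv.
apply/integ_ge0P; [by apply: measurable_normc_powR; exact: cmeas_conv|by move=> x; exact: powR_ge0|].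
apply: (le_lt_trans (conv_contraction mf)).
by move/integ_ge0P : fi; apply => //; [exact: measurable_normc_powR|move=> x; exact: powR_ge0].
Qed.

(** The convolution of [K] with [|f|^p] has a finite integral, hence is finite almost everywhere,
    and there [K y <= K + K y^p] dominates the integrand. On the exceptional set the value of [T f]
    is conventional, which is why [T] is linear only almost everywhere. *)
Lemma conv_integrand_ae f : Lp f ->
  {ae mu, forall x, integ mu (fun h : borel G => normc ((K h)%:C%C * f ((h : G)^-1 * x)%g))}.
Proof.
move=> [mf fi].
pose M (x : borel G) := (\int[mu]_h (K h * normc (f ((h : G)^-1 * x)%g) `^ p)%:E)%E.
have mKp : measurable_fun [set: borel G * borel G]
    (fun z : borel G * borel G => K z.1 * normc (f ((z.1 : G)^-1 * z.2)%g) `^ p).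
  apply: measurable_funM.
    exact: (measurableT_comp density_measurable measurable_fst).
  exact: (measurableT_comp (measurable_powR p) (cmeas_normc (cmeas_div mf))).
have M0 x : (0 <= M x)%E.
  by apply: integral_ge0 => h _; rewrite lee_fin mulr_ge0 ?powR_ge0// density_ge0.
have iM : mu.-integrable [set: borel G] M.
  apply/integrableP; split; first exact: (measurable_iterated_EFin mu mKp).
  under eq_integral do rewrite gee0_abs//.
  rewrite /M (density_tonelli (measurable_normc_powR p mf)); last by move=> x; exact: powR_ge0.
  by move/integ_ge0P : fi; apply => //; [exact: measurable_normc_powR|move=> x; exact: powR_ge0].
apply: filterS (integrable_ae measurableT iM) => x /(_ I) Mfin.
under [X in integ _ X]eq_fun do rewrite normc_conv_integrand.
apply: (density_integ (ltW p1) density_integrable density_ge0).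
- exact: cmeas_normc (cmeas_div_slice x mf).
- by move=> h; exact: normc_ge0.
- apply/integ_ge0P.
  + apply: measurable_funM; first exact: density_measurable.
    apply: (measurableT_comp (measurable_powR p)).
    exact: cmeas_normc (cmeas_div_slice x mf).
  + by move=> h; rewrite mulr_ge0 ?powR_ge0// density_ge0.
  + by rewrite -/(M x) ltey_eq Mfin.
Qed.

Lemma conv_add_ae f g : Lp f -> Lp g ->
  {ae mu, forall x, T (fun y => f y + g y) x = T f x + T g x}.
Proof.
move=> Lf Lg; apply: (ae_imp2 _ (conv_integrand_ae Lf) (conv_integrand_ae Lg)) => x if_ ig.
rewrite /T /conv_op /convolution.
rewrite -Cintegral_add//; [|exact: cmeas_conv_integrand Lf.1|exact: cmeas_conv_integrand Lg.1].
by congr Cintegral; apply/funext => h; rewrite mulrDr.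
Qed.

Lemma conv_scale_ae (z : R[i]) f : Lp f -> {ae mu, forall x, T (fun y => z * f y) x = z * T f x}.
Proof.
move=> Lf; apply: (ae_imp2 _ (conv_integrand_ae Lf) (conv_integrand_ae Lf)) => x if_ _.
rewrite /T /conv_op /convolution -Cintegral_scale//; last exact: cmeas_conv_integrand Lf.1.
by congr Cintegral; apply/funext => h; rewrite mulrCA.
Qed.

End Power.

End Convolution.

(** * The quadratic form of a translate *)

Section ResolventArithmetic.
Variable R : realType.

(** Near 1, the Stolz angle bounds [x N] by a multiple of [eta] plus a term in [x^2 N], absorbed
    while [(1 + D) x <= 1]. Farther away, take [z = conj l / |l|]: then
    [N - Re (z w) <= eta + N (1 - |l|)], and [hP] and [hS] bound [(|l| - 1) N] and [|z - 1|^2 N] by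
    multiples of [eta]. *)
Lemma numerical_range_distance (N D : R) (w l : R[i]) : 0 <= N -> 0 <= D ->
  `|Im w| <= D * (N - Re w) ->
  (forall z, normc z = 1 -> normc (z - 1) ^+ 2 * N <= D * (N - Re (z * w))) ->
  (forall z, normc z = 1 -> 0 <= N - Re (z * w)) ->
  1 < normc l -> normc l <= 2 ->
  normc (l - 1) * N <= (2 * (2 + D) + 2 * (1 + D) ^+ 2) * normc (l * N%:C%C - w).
Proof.
move=> N0 D0 hI hS hP l1 l2; set eta := normc (l * N%:C%C - w); set x := normc (l - 1).
have eta0 : 0 <= eta := normc_ge0 _. have x0 : 0 <= x := normc_ge0 _.
have x2 : x ^+ 2 = normc l ^+ 2 + 1 - 2 * Re l.
  by rewrite /x !sqr_normcE; case: l {l1 l2 eta eta0 x x0} => a b /=; ring.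
have Ree : `|Re (l * N%:C%C - w)| <= eta := Re_le_normc _.
have ReE : Re (l * N%:C%C - w) = Re l * N - Re w.
  by case: l {l1 l2 eta eta0 x x0 x2 Ree} => a b; case: w {hI hS hP} => c d /=; ring.
have h1 : x * N <= eta + (N - Re w) + `|Im w|.
  have -> : x * N = normc ((l - 1) * N%:C%C).
    by rewrite Normc.normcM normc_real (ger0_norm N0).
  have -> : (l - 1) * N%:C%C = (l * N%:C%C - w) + (w - N%:C%C) by ring.
  apply: (le_trans (normcD _ _)); rewrite -addrA lerD2l.
  apply: (le_trans (normc_le_ReIm _)).
  have := hP 1 (@Normc.normc1 R); rewrite mul1r => NRe.
  have -> : Re (w - N%:C%C) = Re w - N by case: (w).
  have -> : Im (w - N%:C%C) = Im w by case: (w) => a b /=; rewrite subr0.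
  by rewrite distrC ger0_norm.
have h2 : N - Re w <= N * (1 - Re l) + eta.
  by move: Ree; rewrite ReE ler_norml => /andP[_ ?]; lra.
have h3 : 2 * (1 - Re l) <= x ^+ 2.
  have l2' : 1 <= normc l ^+ 2 by rewrite exprn_ege1// ltW.
  by rewrite x2; lra.
have h4 : x * N <= (2 + D) * eta + (1 + D) / 2 * (x ^+ 2 * N).
  have e1 : N * (1 - Re l) <= x ^+ 2 * N / 2 by have := ler_wpM2r N0 h3; lra.
  have e2 : x * N <= eta + (1 + D) * (N - Re w) by lra.
  have D1 : 0 <= 1 + D by lra.
  have e3 : N - Re w <= x ^+ 2 * N / 2 + eta by lra.
  by have := ler_wpM2l D1 e3; lra.
have xN := mulr_ge0 x0 N0.
case: (leP ((1 + D) * x) 1) => hx.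
  have e1 : (1 + D) * (x ^+ 2 * N) <= x * N.
    by have := ler_wpM2r xN hx; lra.
  have := mulr_ge0 (sqr_ge0 (1 + D)) eta0; lra.
have l0 : 0 < normc l by lra.
set z := l^*%C / (normc l)%:C%C.
have nl : (normc l)%:C%C != 0 :> R[i] by rewrite eq_complex/= eqxx andbT gt_eqF.
have z1 : normc z = 1.
  rewrite /z Normc.normcM Normc.normcV normc_conj normc_real ger0_norm ?(ltW l0)//.
  by rewrite divff// gt_eqF.
have zl : z * l = (normc l)%:C%C.
  by apply: (mulIf nl); rewrite /z mulrAC divfK// mulrC -sqr_normc normcC -expr2.
have e1 : N - Re (z * w) <= eta + N * (1 - normc l).
  have : Re (z * (l * N%:C%C - w)) <= eta.
    by rewrite (le_trans (ler_norm _))// (le_trans (Re_le_normc _))// Normc.normcM z1 mul1r.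
  have -> : z * (l * N%:C%C - w) = (normc l * N)%:C%C - z * w.
    by rewrite mulrBr mulrA zl -rmorphM.
  have -> : Re ((normc l * N)%:C%C - z * w) = normc l * N - Re (z * w) by case: (z * w).
  lra.
have e2 : (normc l - 1) * N <= eta by have := hP _ z1; lra.
have e3 : normc (z - 1) ^+ 2 * N <= D * eta.
  apply: (le_trans (hS _ z1)); rewrite ler_wpM2l//.
  have Nl : 0 <= N * (normc l - 1) by rewrite mulr_ge0// subr_ge0 ltW.
  lra.
have e4 : x <= (normc l - 1) + normc (z - 1).
  have -> : x = normc (l^*%C - 1).
    by rewrite /x -(normc_conj (l - 1)) rmorphB rmorph1.
  have -> : l^*%C - 1 = (normc l - 1)%:C%C * z + (z - 1).
    have -> : (normc l - 1)%:C%C * z = l^*%C - z.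
      by rewrite rmorphB rmorph1 mulrBl mul1r {1}/z mulrC divfK.
    by ring.
  apply: (le_trans (normcD _ _)); rewrite Normc.normcM z1 mulr1 normc_real ger0_norm//.
  by rewrite subr_ge0 ltW.
(* Since [normc l <= 2], the square of [normc l - 1] is at most [normc l - 1]. *)
have e5 : x ^+ 2 <= 2 * (normc l - 1) + 2 * normc (z - 1) ^+ 2.
  have n0 := normc_ge0 (z - 1); set n := normc (z - 1) in e4 n0 *.
  by have := sqr_ge0 (normc l - 1 - n); nra.
have e6 : x ^+ 2 * N <= 2 * (1 + D) * eta by have := ler_wpM2r N0 e5; lra.
have e7 : x * N <= (1 + D) * (x ^+ 2 * N).
  by have := ler_wpM2r xN (ltW hx); lra.
have D1 : 0 <= 1 + D by lra.
have := ler_wpM2l D1 e6; have := mulr_ge0 D0 eta0; lra.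
Qed.

End ResolventArithmetic.

Section QuadraticForm.
Variables (R : realType) (G : topologicalGroupType).
Variable mu : {sigma_finite_measure set (borel G) -> \bar R}.
Hypothesis sc : @second_countable G.
Hypothesis haar : left_haar mu.
Variables (F : borel G -> R[i]) (s t : R).
Hypotheses (mF : cmeas F) (iF : integ mu (fun x => normc (F x) ^+ 2)).
Hypotheses (s0 : 0 < s) (t0 : 0 < t) (st : s + t = 2).
Implicit Types (z : R[i]) (g h : G).

Definition sqmass := \int[mu]_x (normc (F x) ^+ 2).

Definition twist z g (x : borel G) := normc (z * F (g^-1 * (x : G))%g - F x) ^+ 2.

Definition energy z g := \int[mu]_x twist z g x.

(** The integrand of [<f(g^-1 .), J>] for [f = radial s F] and [J = radial t F]; everything is
    expressed through the single [L^2] function [F]. *)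
Definition pairing g (x : borel G) : R[i] :=
  radial s (F (g^-1 * (x : G))%g) * (radial t (F x))^*%C.

Definition correlation z g := \int[mu]_x Re (z * pairing g x).

Local Notation N := sqmass.

Lemma sqmass_ge0 : 0 <= N.
Proof. by apply: Rintegral_ge0 => x _; exact: sqr_ge0. Qed.

Lemma integ_sq_translate g : integ mu (fun x : borel G => normc (F (g * (x : G))%g) ^+ 2).
Proof. exact: (integ_translate haar g iF). Qed.

Lemma sq_translate g : \int[mu]_x (normc (F (g * (x : G))%g) ^+ 2) = N.
Proof. exact: (Rint_translate haar g (integ_meas iF)). Qed.

Lemma measurable_sqr_normc d (T : measurableType d) (f : T -> R[i]) : cmeas f ->
  measurable_fun [set: T] (fun x => normc (f x) ^+ 2).
Proof. by move=> mf; apply: measurable_funX; exact: cmeas_normc. Qed.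

Lemma cmeas_twist z g : cmeas (fun x : borel G => z * F (g^-1 * (x : G))%g - F x).
Proof. by apply: cmeasB => //; apply: cmeasZ; exact: cmeas_translate. Qed.

Lemma sqr_normcB_le (a b : R[i]) : normc (a - b) ^+ 2 <= 2 * normc a ^+ 2 + 2 * normc b ^+ 2.
Proof.
have := normcB a b; have := normc_ge0 (a - b); set n := normc (a - b) => n0 h.
have : n ^+ 2 <= (normc a + normc b) ^+ 2 by rewrite lerXn2r ?nnegrE ?addr_ge0 ?normc_ge0.
by have := sqr_ge0 (normc a - normc b); nra.
Qed.

Lemma twist_le z g x : normc z = 1 ->
  twist z g x <= 2 * normc (F (g^-1 * (x : G))%g) ^+ 2 + 2 * normc (F x) ^+ 2.
Proof. by move=> z1; apply: (le_trans (sqr_normcB_le _ _)); rewrite Normc.normcM z1 mul1r. Qed.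

Lemma integ_twist z g : normc z = 1 -> integ mu (twist z g).
Proof.
move=> z1; apply: (integ_le _ (integD (integZ 2 (integ_sq_translate g^-1%g)) (integZ 2 iF))).
  by apply: measurable_sqr_normc; exact: cmeas_twist.
by move=> x; rewrite ger0_norm ?sqr_ge0// twist_le.
Qed.

Lemma energy_ge0 z g : 0 <= energy z g.
Proof. by apply: Rintegral_ge0 => x _; exact: sqr_ge0. Qed.

Lemma energy_le z g : normc z = 1 -> energy z g <= 4 * N.
Proof.
move=> z1; apply: (@le_trans _ _ (\int[mu]_x (2 * normc (F (g^-1 * (x : G))%g) ^+ 2 + 2 * normc (F x) ^+ 2))).
  apply: le_Rint; first exact: integ_twist.
    by apply: integD; apply: integZ => //; exact: integ_sq_translate.
  by move=> x; exact: twist_le.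
rewrite RintD; [|by apply: integZ; exact: integ_sq_translate|exact: integZ].
rewrite !RintZ ?sq_translate// -/N; [lra|exact: integ_sq_translate].
Qed.

Lemma energyV g : energy 1 g^-1%g = energy 1 g.
Proof.
rewrite /energy -(Rint_translate haar g (integ_meas (integ_twist g (@Normc.normc1 R)))).
by apply: eq_Rintegral => x _; rewrite /twist !mul1r mulKg invgK normcBC.
Qed.

Lemma energyM g h : energy 1 (g * h)%g <= 2 * energy 1 g + 2 * energy 1 h.
Proof.
have n1 := @Normc.normc1 R.
have ih := integ_translate haar g^-1%g (integ_twist h n1).
have eh := Rint_translate haar g^-1%g (integ_meas (integ_twist h n1)).
rewrite [in X in _ + X]/energy -eh /energy -!RintZ//; last exact: integ_twist.
rewrite -RintD; [|by apply: integZ; exact: integ_twist|exact: integZ].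
apply: le_Rint; first exact: integ_twist.
  by apply: integD; apply: integZ => //; exact: integ_twist.
move=> x; rewrite /twist !mul1r invgM -mulgA [leRHS]addrC.
set a := F _; set b := F (g^-1 * _)%g; set c := F x.
rewrite (_ : a - c = (a - b) - (c - b)); last by ring.
by rewrite (normcBC b c); exact: sqr_normcB_le.
Qed.

(** If [F] is nearly fixed by [z g] and by [z h], it is nearly fixed by [z^2 g h]; if it is also
    nearly fixed by [z g h], then [z] is close to 1. The three differences combine exactly to
    [z (z - 1) F((g h)^-1 .)]. *)
Lemma sqmass_energy z g h : normc z = 1 ->
  normc (z - 1) ^+ 2 * N <= 4 * energy z h + 4 * energy z g + 2 * energy z (g * h)%g.
Proof.
move=> z1.
have ih := integ_translate haar g^-1%g (integ_twist h z1).
have eh := Rint_translate haar g^-1%g (integ_meas (integ_twist h z1)).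
have iL := integ_sq_translate (g * h)^-1%g.
rewrite -(sq_translate (g * h)^-1%g) -RintZ//.
rewrite {1}/energy -eh -!RintZ//; [|exact: integ_twist|exact: integ_twist].
rewrite -RintD; [|exact: integZ|by apply: integZ; exact: integ_twist].
rewrite -RintD; last 2 first.
  by apply: integD; apply: integZ => //; exact: integ_twist.
  by apply: integZ; exact: integ_twist.
apply: le_Rint; first exact: integZ.
  by apply: integD; [apply: integD; apply: integZ => //; exact: integ_twist|apply: integZ; exact: integ_twist].
move=> x; rewrite /twist invgM -mulgA.
set a := F _; set b := F (g^-1 * _)%g; set c := F x.
have -> : normc (z - 1) ^+ 2 * normc a ^+ 2 = normc ((z * (z * a - b) + (z * b - c)) - (z * a - c)) ^+ 2.
  have -> : (z * (z * a - b) + (z * b - c)) - (z * a - c) = z * ((z - 1) * a) by ring.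
  by rewrite !Normc.normcM z1 mul1r exprMn.
apply: (le_trans (sqr_normcB_le _ _)); rewrite lerD2r.
have := sqr_normcB_le (z * (z * a - b)) (- (z * b - c)).
by rewrite opprK normc_opp !Normc.normcM z1 mul1r; lra.
Qed.

Lemma cmeas_pairing g : cmeas (pairing g).
Proof.
apply: cmeasM; first by apply: cmeas_radial; exact: cmeas_translate.
by apply: cmeas_conj; exact: cmeas_radial.
Qed.

Lemma normc_radial_mul_le (a b : R[i]) :
  normc (radial s a * (radial t b)^*%C) <= normc a ^+ 2 + normc b ^+ 2.
Proof.
rewrite Normc.normcM normc_conj !normc_radial//.
exact: powRM_le_sqrD (normc_ge0 _) (normc_ge0 _).
Qed.

Lemma Re_pairing_le z g x : `|Re (z * pairing g x)| <=
  normc z * (normc (F (g^-1 * (x : G))%g) ^+ 2 + normc (F x) ^+ 2).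
Proof.
apply: (le_trans (Re_le_normc _)); rewrite Normc.normcM ler_wpM2l ?normc_ge0//.
exact: normc_radial_mul_le.
Qed.

Lemma integ_Re_pairing z g : integ mu (fun x => Re (z * pairing g x)).
Proof.
apply: (integ_le _ (integZ (normc z) (integD (integ_sq_translate g^-1%g) iF))).
  exact: (cmeasZ z (cmeas_pairing g)).1.
by move=> x; exact: Re_pairing_le.
Qed.

Lemma correlation_bounded z g : normc z = 1 -> `|correlation z g| <= 2 * N.
Proof.
move=> z1; apply: (@le_trans _ _ (\int[mu]_x (normc (F (g^-1 * (x : G))%g) ^+ 2 + normc (F x) ^+ 2))).
  apply: norm_Rint_le; first exact: integ_Re_pairing.
    by apply: integD => //; exact: integ_sq_translate.
  by move=> x; rewrite (le_trans (Re_pairing_le _ _ _))// z1 mul1r.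
rewrite RintD ?sq_translate// -/N; [lra|exact: integ_sq_translate].
Qed.

(** [radial_young] at each point, for [z F(g^-1 x)] and [F x]; by left invariance the masses add up
    to [(s/2 + t/2) N = N]. *)
Lemma energy_correlation z g : normc z = 1 ->
  Num.min s t / 4 * energy z g <= N - correlation z g.
Proof.
move=> z1; have iT := integ_sq_translate g^-1%g; have iP := integ_Re_pairing z g.
have -> : N - correlation z g = \int[mu]_x (s / 2 * normc (F (g^-1 * (x : G))%g) ^+ 2 +
    t / 2 * normc (F x) ^+ 2 - Re (z * pairing g x)).
  rewrite RintB//; last by apply: integD; exact: integZ.
  rewrite RintD; [|exact: integZ|exact: integZ].
  rewrite !RintZ// sq_translate -/N -/(correlation z g); congr (_ - _).
  by rewrite -mulrDl -mulrDl st divff// mul1r.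
rewrite /energy -(RintZ _ (integ_twist g z1)).
apply: le_Rint; first by apply: integZ; exact: integ_twist.
  by apply: integB => //; apply: integD; exact: integZ.
move=> x; have := radial_young (z * F (g^-1 * (x : G))%g) (F x) s0 t0 st.
by rewrite radial_rot// (Normc.normcM z) z1 mul1r -(mulrA z).
Qed.

Definition skew g := \int[mu]_x Im (pairing g x).

Lemma ReNi (w : R[i]) : Re (- 'i%C * w) = Im w.
Proof. by case: w => a b /=; ring. Qed.

Lemma skewE g : skew g = correlation (- 'i%C) g.
Proof. by apply: eq_Rintegral => x _; rewrite ReNi. Qed.

Lemma normcNi : normc (- 'i%C : R[i]) = 1.
Proof. by rewrite normc_opp /normc/= expr0n expr1n add0r sqrtr1. Qed.

Lemma skew_bounded g : `|skew g| <= 2 * N.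
Proof. by rewrite skewE; apply: correlation_bounded; exact: normcNi. Qed.

Lemma integ_skew g : integ mu (fun x => Im (pairing g x)).
Proof. by under eq_fun do rewrite -ReNi; exact: integ_Re_pairing. Qed.

Lemma Im_radial_mul (a : R[i]) : Im (radial s a * (radial t a)^*%C) = 0.
Proof. by rewrite /radial; case: a => a b /=; ring. Qed.

Lemma ImD (a b : R[i]) : Im (a + b) = Im a + Im b.
Proof. by case: a; case: b. Qed.

Lemma ImB (a b : R[i]) : Im (a - b) = Im a - Im b.
Proof. by case: a; case: b. Qed.

(** After a translation by [g], expanding [u] yields the three pairings and a fourth term
    [radial s (F x) conj (radial t (F x))], which is real. So the defect is the integral of a
    product of two differences, which [radial_cross] bounds to second order. *)
Lemma skew_quasihom g h :
  `|skew (g * h)%g - skew g - skew h| <= 16 * energy 1 g + 16 * energy 1 h.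
Proof.
have n1 := @Normc.normc1 R.
pose u (x : borel G) := Im ((radial s (F (h^-1 * (x : G))%g) - radial s (F x)) *
   (radial t (F (g * (x : G))%g) - radial t (F x))^*%C).
have igh := integ_translate haar g (integ_skew (g * h)%g).
have ig := integ_translate haar g (integ_skew g).
have ih := integ_skew h.
have uE x : u x = Im (pairing (g * h)%g (g * (x : G))%g) - Im (pairing g (g * (x : G))%g) - Im (pairing h x).
  rewrite /u /pairing invgM -mulgA !mulKg.
  have := Im_radial_mul (F x).
  set a := radial s (F (h^-1 * x)%g); set b := radial s (F x).
  set c := radial t (F (g * x)%g); set e := radial t (F x).
  move=> be.
  have -> : (a - b) * (c - e)^*%C = a * c^*%C - b * c^*%C - a * e^*%C + b * e^*%C.
    by rewrite rmorphB/=; ring.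
  by rewrite ImD !ImB be addr0.
have e1 := Rint_translate haar g (u := fun x : borel G => Im (pairing (g * h)%g x))
  (integ_meas (integ_skew (g * h)%g)).
have e2 := Rint_translate haar g (u := fun x : borel G => Im (pairing g x))
  (integ_meas (integ_skew g)).
have -> : skew (g * h)%g - skew g - skew h = \int[mu]_x u x.
  rewrite [skew (g * h)%g]/skew -e1 [skew g]/skew -e2.
  rewrite -(RintB igh ig) -(RintB (integB igh ig) ih).
  by apply: eq_Rintegral => x _; rewrite uE.
rewrite -(energyV g) addrC -mulrDr /energy.
have i1 := integ_twist h n1; have i2 := integ_twist g^-1%g n1.
rewrite -(RintD i1 i2) -(RintZ 16 (integD i1 i2)).
apply: norm_Rint_le.
- by rewrite (funext uE); exact: (integB (integB igh ig) ih).
- exact: (integZ 16 (integD i1 i2)).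
- move=> x; apply: (le_trans (Im_le_normc _)); rewrite Normc.normcM normc_conj.
  have := radial_cross (F x) (F (h^-1 * (x : G))%g) (F (g * (x : G))%g) s0 t0 st.
  by rewrite /twist !mul1r invgK.
Qed.

Lemma measurable_energy z : measurable_fun [set: borel G] (energy z : borel G -> R).
Proof.
apply: (@measurable_iterated_Rint _ _ _ mu
  (fun y : borel G * borel G => twist z (y.2 : G) y.1)).
apply: measurable_sqr_normc; apply: cmeasB.
  apply: cmeasZ; apply: (@cmeas_comp _ _ _ _ _
    (fun w : borel G * borel G => F ((w.1 : G)^-1 * w.2)%g) (fun y => (y.2, y.1))).
    by apply: measurable_fun_pair; [exact: measurable_snd|exact: measurable_fst].
  exact: cmeas_div.
exact: (cmeas_comp measurable_fst mF).
Qed.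

Lemma cmeas_pairing2 :
  cmeas (fun y : borel G * borel G => pairing (y.1 : G) y.2).
Proof.
apply: cmeasM; first by apply: cmeas_radial; exact: cmeas_div.
by apply: cmeas_conj; apply: cmeas_radial; exact: (cmeas_comp measurable_snd mF).
Qed.

Lemma measurable_correlation z :
  measurable_fun [set: borel G] (correlation z : borel G -> R).
Proof.
apply: (@measurable_iterated_Rint _ _ _ mu
  (fun y : borel G * borel G => Re (z * pairing (y.2 : G) y.1))).
apply: (cmeasZ z (@cmeas_comp _ _ _ _ _
  (fun w : borel G * borel G => pairing (w.1 : G) w.2)
  (fun y : borel G * borel G => (y.2, y.1)) _ cmeas_pairing2)).1.
by apply: measurable_fun_pair; [exact: measurable_snd|exact: measurable_fst].
Qed.

End QuadraticForm.

Lemma weighted_average (R : realType) d (T : measurableType d) (mu : {measure set T -> \bar R})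
  (w a b : T -> R) (c al be : R) :
  integ mu w -> integ mu (fun x => w x * a x) -> integ mu (fun x => w x * b x) ->
  (forall x, w x * c <= w x * (al * a x + be * b x)) ->
  c * \int[mu]_x w x <= al * \int[mu]_x (w x * a x) + be * \int[mu]_x (w x * b x).
Proof.
move=> iw ia ib h.
rewrite -(RintZ c iw) -(RintZ al ia) -(RintZ be ib) -(RintD (integZ al ia) (integZ be ib)).
apply: le_Rint; [exact: integZ|by apply: integD; exact: integZ|].
by move=> x; have := h x; lra.
Qed.

(** * Means against the density and its lower bound near the identity *)

Section Averages.
Variables (R : realType) (G : topologicalGroupType).
Variable mu : {sigma_finite_measure set (borel G) -> \bar R}.
Hypothesis sc : @second_countable G.
Hypothesis haar : left_haar mu.
Variables (F : borel G -> R[i]) (p s t : R).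
Hypotheses (mF : cmeas F) (iF : integ mu (fun x => normc (F x) ^+ 2)).
Hypotheses (p1 : 1 < p) (sE : s = 2 / p) (tE : t = 2 - s).
Variable K : G -> R.
Hypothesis hK : prob_density mu K.
Local Notation N := (sqmass mu F).
Local Notation E := (energy mu F).
Local Notation corr := (correlation mu F s t).

Lemma exponent_s_gt0 : 0 < s.
Proof. by rewrite sE divr_gt0// (lt_trans ltr01 p1). Qed.

Lemma exponent_t_gt0 : 0 < t.
Proof. by rewrite tE subr_gt0 sE ltr_pdivrMr ?(lt_trans ltr01 p1)// ltr_pMr. Qed.

Lemma exponent_sum : s + t = 2.
Proof. by rewrite tE addrC subrK. Qed.

Let s0 := exponent_s_gt0.
Let t0 := exponent_t_gt0.
Let st := exponent_sum.

Lemma density_integM (phi : borel G -> R) (M : R) :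
  measurable_fun [set: borel G] phi -> (forall g, `|phi g| <= M) ->
  integ mu (fun g : borel G => K g * phi g).
Proof.
move=> mphi hM; apply: (integ_le _ (integZ M (density_integrable hK))).
  by apply: measurable_funM => //; exact: density_measurable hK.
move=> g; rewrite normrM (ger0_norm (density_ge0 hK g)) mulrC.
by rewrite ler_wpM2r// (density_ge0 hK).
Qed.

Definition mean_energy z := \int[mu]_g (K g * E z g).

Definition mean_corr z := \int[mu]_g (K g * corr z g).

Lemma integ_mean_energy z : normc z = 1 -> integ mu (fun g : borel G => K g * E z g).
Proof.
move=> z1; apply: (density_integM (M := 4 * N)).
  exact: measurable_energy.
by move=> g; rewrite ger0_norm ?energy_ge0// energy_le.
Qed.

Lemma integ_mean_corr z : normc z = 1 -> integ mu (fun g : borel G => K g * corr z g).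
Proof.
move=> z1; apply: (density_integM (M := 2 * N)).
  exact: measurable_correlation.
by move=> g; exact: (correlation_bounded haar mF iF s0 t0 st).
Qed.

Lemma mean_energy_ge0 z : 0 <= mean_energy z.
Proof. by apply: Rintegral_ge0 => g _; rewrite mulr_ge0 ?energy_ge0// (density_ge0 hK). Qed.

Lemma mean_energy_corr z : normc z = 1 ->
  Num.min s t / 4 * mean_energy z <= N - mean_corr z.
Proof.
move=> z1; have iE := integ_mean_energy z1; have iC := integ_mean_corr z1.
have iN : integ mu (fun g : borel G => N * K g) by apply: integZ; exact: density_integrable hK.
have -> : N - mean_corr z = \int[mu]_g (N * K g - K g * corr z g).
  by rewrite RintB// RintZ ?(density_Rint hK) ?mulr1//; exact: density_integrable hK.
rewrite /mean_energy -RintZ//; apply: le_Rint; [exact: integZ|exact: integB|].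
move=> g; have h := energy_correlation haar mF iF s0 t0 st g z1.
by have := ler_wpM2l (density_ge0 hK g) h; lra.
Qed.

Variables (V W : set G) (eps : R).
Hypotheses (oV : open V) (V1 : V 1%g) (muV : (mu V < +oo)%E) (eps0 : 0 < eps).
Hypotheses (VW : V `<=` W) (VVW : forall x y, V x -> V y -> W (x * y)%g).
Hypothesis KW : forall g, W g -> eps <= K g.

Let m := fine (mu V).
Let iV : borel G -> R := \1_V.

Lemma haar_V_gt0 : 0 < m.
Proof.
apply: fine_gt0; rewrite muV andbT.
exact: (haar_open_gt0 sc haar oV V1).
Qed.

Lemma measurable_V : measurable (V : set (borel G)).
Proof. exact: open_borel. Qed.

Lemma integ_indic_V : integ mu iV.
Proof.
apply/integ_ge0P; first exact: measurable_indic measurable_V.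
  by move=> x; rewrite /iV indicE ler0n.
by rewrite integral_indic ?setIT//; exact: measurable_V.
Qed.

Lemma Rint_indic_V : \int[mu]_x iV x = m.
Proof. by rewrite /Rintegral integral_indic ?setIT//; exact: measurable_V. Qed.

Lemma indic_V_le1 x : 0 <= iV x <= 1.
Proof. by rewrite /iV indicE; case: (_ \in _); rewrite ?lexx ?ler01. Qed.

Lemma indic_Vphi_integ (phi : borel G -> R) (M : R) :
  measurable_fun [set: borel G] phi -> (forall g, 0 <= phi g <= M) ->
  integ mu (fun g => iV g * phi g).
Proof.
move=> mphi hM; apply: (integ_le _ (integZ M integ_indic_V)).
  by apply: measurable_funM => //; exact: integ_meas integ_indic_V.
move=> g; have /andP[h1 h2] := hM g; have /andP[i0 _] := indic_V_le1 g.
by rewrite ger0_norm ?mulr_ge0// mulrC ler_wpM2r.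
Qed.

Lemma eps_le_mean z (A : set G) : normc z = 1 -> A `<=` W -> measurable (A : set (borel G)) ->
  eps * \int[mu]_g (\1_A g * E z g) <= mean_energy z.
Proof.
move=> z1 AW mA.
have iA : integ mu (fun g : borel G => \1_A g * E z g).
  apply: (integ_le _ (integZ eps^-1 (integ_mean_energy z1))).
    by apply: measurable_funM; [exact: measurable_indic|exact: measurable_energy].
  move=> g; have E0 := energy_ge0 mu F z g.
  rewrite ger0_norm ?mulr_ge0// mulrA ler_wpM2r//.
  rewrite mulrC ler_pdivlMr// indicE; case: (boolP (g \in A)) => [|_].
    by rewrite inE mul1r => /AW; exact: KW.
  by rewrite mul0r (density_ge0 hK).
rewrite -RintZ//; apply: le_Rint; [exact: integZ|exact: integ_mean_energy|] => g.
have E0 := energy_ge0 mu F z g.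
rewrite mulrA ler_wpM2r// indicE; case: (boolP (g \in A)) => [|_].
  by rewrite inE mulr1 => /AW; exact: KW.
by rewrite mulr0 (density_ge0 hK).
Qed.

(* Left invariance moves the average of [E z (u h)] over [h] in [V] to the
   average over [u V], which lies in [W]. *)
Lemma translated_average z u : normc z = 1 -> V u ->
  integ mu (fun h : borel G => iV h * E z (u * h)%g) /\
  eps * \int[mu]_h (iV h * E z (u * (h : G))%g) <= mean_energy z.
Proof.
move=> z1 Vu; pose A : set G := [set (u * x)%g | x in V].
have mA : measurable (A : set (borel G)) by apply: open_borel; exact: open_mulgl.
have e : (fun h : borel G => iV h * E z (u * h)%g) =
    (fun h : borel G => (fun y : borel G => \1_A y * E z y) (u * (h : G))%g).
  apply/funext => h; congr (_ * _); rewrite /iV !indicE; congr (_%:R); congr nat_of_bool.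
  apply/idP/idP; rewrite !inE; first by move=> Vh; exists h.
  by move=> [y Vy /mulgI <-].
have mAE : measurable_fun [set: borel G] (fun y : borel G => \1_A y * E z y).
  by apply: measurable_funM; [exact: measurable_indic|exact: measurable_energy].
split.
  apply: (indic_Vphi_integ (M := 4 * N)).
    apply: (measurableT_comp (f := (E z : borel G -> R))
        (g := fun g : borel G => (u * (g : G))%g : borel G)).
      exact: measurable_energy.
    exact: measurable_mulgl.
  by move=> g; rewrite energy_ge0 energy_le.
rewrite e (Rint_translate haar u mAE); apply: eps_le_mean => //.
by move=> _ [x Vx <-]; exact: VVW.
Qed.

(** Average [E u <= 2 E(u h) + 2 E h] over [h] in [V]: both [u h] and [h] lie in [W], where
    [K >= eps]. *)
Lemma energy_le_mean u : V u -> eps * m * E 1 u <= 4 * mean_energy 1.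
Proof.
move=> Vu; have n1 := @Normc.normc1 R.
have [i1 h1] := translated_average n1 Vu.
have h2 := eps_le_mean n1 VW measurable_V.
have i2 : integ mu (fun h => iV h * E 1 h).
  apply: (indic_Vphi_integ (M := 4 * N)); first exact: measurable_energy.
  by move=> g; rewrite energy_ge0 energy_le.
have : m * E 1 u <= 2 * \int[mu]_h (iV h * E 1 (u * (h : G))%g) + 2 * \int[mu]_h (iV h * E 1 h).
  rewrite -Rint_indic_V mulrC; apply: weighted_average => //; first exact: integ_indic_V.
  move=> h; have /andP[i0 _] := indic_V_le1 h; rewrite ler_wpM2l//.
  by have := energyM haar mF iF (u * h)%g h^-1%g; rewrite mulgK (energyV haar mF iF).
move: h1 h2 (ltW eps0); rewrite -/iV.
move: (\int[mu]_h _) (\int[mu]_h _) (mean_energy 1) (E 1 u) (m) => A B S e m'.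
move=> h1 h2 e0 /(ler_wpM2l e0); lra.
Qed.

(** [sqmass_energy] at [u] and [h], averaged over [h] and then over [u] in [V]. The first average
    contributes 2 + 4, the second 4, whence 10. *)
Lemma sqmass_le_mean z : normc z = 1 ->
  eps * m * (normc (z - 1) ^+ 2 * N) <= 10 * mean_energy z.
Proof.
move=> z1; set X := normc (z - 1) ^+ 2 * N.
have h2 := eps_le_mean z1 VW measurable_V.
set I := \int[mu]_g (\1_V g * E z g) in h2.
have i2 : integ mu (fun h => iV h * E z h).
  apply: (indic_Vphi_integ (M := 4 * N)); first exact: measurable_energy.
  by move=> g; rewrite energy_ge0 energy_le.
have iV1 := integ_indic_V.
have step u : V u -> eps * (m * X) <= 6 * mean_energy z + 4 * eps * m * E z u.
  move=> Vu; have [i1 h1] := translated_average z1 Vu.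
  have : m * (X - 4 * E z u) <= 2 * \int[mu]_h (iV h * E z (u * (h : G))%g) + 4 * I.
    rewrite -Rint_indic_V mulrC; apply: weighted_average => //.
    move=> h; have /andP[i0 _] := indic_V_le1 h; rewrite ler_wpM2l//.
    have := sqmass_energy haar mF iF u h z1; rewrite -/X.
    by move: (X) (E z u) (E z (u * h)%g) (E z h) => a b c d; lra.
  move: h1 h2 (ltW eps0); move: (\int[mu]_h _) (I) (mean_energy z) (E z u) (m) (X) => A B S e m' X'.
  by move=> h1 h2 e0 /(ler_wpM2l e0); lra.
have m0 := haar_V_gt0.
have : m * (eps * (m * X) - 6 * mean_energy z) <= 4 * eps * m * I + 0 * I.
  rewrite -{1}Rint_indic_V mulrC; apply: weighted_average => //.
  move=> u; rewrite mul0r addr0 /iV indicE; case: (boolP (u \in V)) => [|_]; last by rewrite !mul0r.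
  rewrite inE !mul1r => /step.
  by move: (E z u) (mean_energy z) (X) (m) => a b c d; lra.
move: h2 m0; move: (I) (mean_energy z) (m) (X) => B S m' X' h2 m0 h3.
rewrite -(ler_pM2r m0); have := ler_wpM2l (ltW m0) h2; lra.
Qed.

End Averages.

Section LpSpace.
Variables (R : realType) (G : topologicalGroupType).
Variable mu : {sigma_finite_measure set (borel G) -> \bar R}.
Variable p : R.
Hypothesis p1 : 1 < p.
Implicit Types u v : borel G -> R[i].

Let p0 : 0 < p := lt_trans ltr01 p1.

Lemma powRD_le (x y : R) : 0 <= x -> 0 <= y ->
  (x + y) `^ p <= 2 `^ p * (x `^ p + y `^ p).
Proof.
move=> x0 y0; wlog xy : x y x0 y0 / x <= y.
  by move=> h; case: (leP x y) => [|/ltW] xy; [|rewrite addrC [X in _ * X]addrC]; exact: h.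
apply: (@le_trans _ _ ((2 * y) `^ p)).
  by apply: powR_homo; [exact: ltW|exact: addr_ge0|lra].
by rewrite powRM// ler_wpM2l ?powR_ge0// lerDr powR_ge0.
Qed.

Lemma LpD u v : Lp mu p u -> Lp mu p v -> Lp mu p (fun x => u x + v x).
Proof.
move=> [mu' iu] [mv iv]; split; first exact: cmeasD.
apply: (integ_le _ (integZ (2 `^ p) (integD iu iv))).
  by apply: measurable_normc_powR; exact: cmeasD.
move=> x; rewrite ger0_norm ?powR_ge0//.
apply: le_trans (powRD_le (normc_ge0 _) (normc_ge0 _)).
by apply: powR_homo; [exact: ltW|exact: normc_ge0|exact: normcD].
Qed.

Lemma LpZ (z : R[i]) u : Lp mu p u -> Lp mu p (fun x => z * u x).
Proof.
move=> [mu' iu]; split; first exact: cmeasZ.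
have e x : normc (z * u x) `^ p = normc z `^ p * normc (u x) `^ p.
  by rewrite Normc.normcM powRM ?normc_ge0.
by rewrite (funext e); exact: integZ.
Qed.

Lemma Lp0 : Lp mu p (fun=> 0).
Proof.
split; first exact: cmeas_cst.
apply/integ_ge0P; [by apply: measurable_normc_powR; exact: cmeas_cst|by move=> x; exact: powR_ge0|].
by under eq_integral do rewrite Normc.normc0 powR0 ?gt_eqF//; rewrite integral0 ltry.
Qed.

End LpSpace.

(** * The duality pairing and the resolvent estimate for one function *)

Section Duality.
Variables (R : realType) (G : topologicalGroupType).
Variable mu : {sigma_finite_measure set (borel G) -> \bar R}.
Hypothesis sc : @second_countable G.
Hypothesis haar : left_haar mu.
Variables (F : borel G -> R[i]) (p s t : R).
Hypotheses (mF : cmeas F) (iF : integ mu (fun x => normc (F x) ^+ 2)).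
Hypotheses (p1 : 1 < p) (sE : s = 2 / p) (tE : t = 2 - s).
Variable K : G -> R.
Hypothesis hK : prob_density mu K.
Local Notation N := (sqmass mu F).
Local Notation corr := (correlation mu F s t).

Let s0 : 0 < s := exponent_s_gt0 p1 sE.
Let t0 : 0 < t := exponent_t_gt0 p1 sE tE.
Let st : s + t = 2 := exponent_sum tE.
Let p0 : 0 < p := lt_trans ltr01 p1.

Let f (x : borel G) : R[i] := radial s (F x).
Let J (x : borel G) : R[i] := radial t (F x).

Lemma powR_radial_s (a : R) : 0 <= a -> (a `^ s) `^ p = a ^+ 2.
Proof.
by move=> a0; rewrite -powRrM sE divfK ?gt_eqF// (powR_mulrn 2).
Qed.

Lemma Lp_radial : Lp mu p f.
Proof.
split; first exact: cmeas_radial.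
have e x : normc (f x) `^ p = normc (F x) ^+ 2.
  by rewrite normc_radial// powR_radial_s// normc_ge0.
by rewrite (funext e).
Qed.

Lemma sqmass_radial : \int[mu]_x (normc (f x) `^ p) = N.
Proof.
apply: eq_Rintegral => x _.
by rewrite normc_radial// powR_radial_s// normc_ge0.
Qed.

(** Young's inequality applies to [|u|^(p/2)] and [|F|], because [(|u|^(p/2))^s = |u|] and
    [|J| = |F|^t]. *)
Lemma integ_dual (u : borel G -> R[i]) : Lp mu p u ->
  integ mu (fun x => normc (u x) * normc (J x)).
Proof.
move=> [mu' iu]; apply: (integ_le _ (integD iu iF)).
  by apply: measurable_funM; apply: cmeas_normc => //; exact: cmeas_radial.
move=> x; rewrite ger0_norm ?mulr_ge0 ?normc_ge0// normc_radial//.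
have n0 := normc_ge0 (u x).
have := powRM_le_sqrD s0 t0 st (powR_ge0 (normc (u x)) (p / 2)) (normc_ge0 (F x)).
have -> : (normc (u x) `^ (p / 2)) `^ s = normc (u x).
  rewrite -powRrM; have -> : p / 2 * s = 1 by rewrite sE; field; rewrite gt_eqF.
  by rewrite powRr1.
by rewrite -(powR_mulrn 2 (powR_ge0 _ _)) -powRrM divfK.
Qed.

Lemma cmeas_dual (u : borel G -> R[i]) : cmeas u -> cmeas (fun x => u x * (J x)^*%C).
Proof. by move=> mu'; apply: cmeasM => //; apply: cmeas_conj; exact: cmeas_radial. Qed.

Lemma integ_dual_conj (u : borel G -> R[i]) : Lp mu p u ->
  integ mu (fun x => normc (u x * (J x)^*%C)).
Proof.
move=> Lu; have e x : normc (u x * (J x)^*%C) = normc (u x) * normc (J x).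
  by rewrite Normc.normcM normc_conj.
by rewrite (funext e); exact: integ_dual.
Qed.

Definition duality (u : borel G -> R[i]) : R[i] := Cintegral mu (fun x => u x * (J x)^*%C).

Let T := conv_op mu K.

Lemma measurable_correlation_kernel z : measurable_fun [set: borel G * borel G]
  (fun y : borel G * borel G => K y.1 * Re (z * pairing F s t (y.1 : G) y.2)).
Proof.
apply: measurable_funM.
  exact: (measurableT_comp (density_measurable hK) measurable_fst).
exact: (cmeasZ z (cmeas_pairing2 sc s t mF)).1.
Qed.

Lemma mean_corrE z :
  mean_corr mu F s t K z = \int[mu]_x (\int[mu]_h (K h * Re (z * pairing F s t h x))).
Proof.
pose k (y : borel G * borel G) := K y.1 * Re (z * pairing F s t (y.1 : G) y.2).
pose b (y : borel G * borel G) :=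
  normc z * (K y.1 * (normc (F ((y.1 : G)^-1 * y.2)%g) ^+ 2 + normc (F y.2) ^+ 2)).
have mb : measurable_fun setT b.
  apply: measurable_funM; first exact: measurable_cst.
  apply: measurable_funM.
    exact: (measurableT_comp (density_measurable hK) measurable_fst).
  apply: measurable_funD; apply: measurable_sqr_normc; first exact: cmeas_div.
  exact: (cmeas_comp measurable_snd mF).
have kb y : `|k y| <= b y.
  rewrite /k /b normrM (ger0_norm (density_ge0 hK _)) [leRHS]mulrCA.
  by rewrite ler_wpM2l ?(density_ge0 hK)//; exact: Re_pairing_le.
have inner h : (\int[mu]_x (b (h, x))%:E = (normc z * (K h * (2 * N)))%:E)%E.
  have i1 := integ_sq_translate haar iF (h : G)^-1%g.
  have i2 := integZ (normc z) (integZ (K h) (integD i1 iF)).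
  rewrite (integ_EFin i2) (RintZ _ (integZ (K h) (integD i1 iF))) (RintZ _ (integD i1 iF)).
  rewrite (RintD i1 iF) (sq_translate haar iF) -/N.
  by congr (_ * (_ * _))%:E; ring.
have [_ <-] : integ mu (fun h => \int[mu]_x k (h, x)) /\
    \int[mu]_h (\int[mu]_x k (h, x)) = \int[mu]_x (\int[mu]_h k (h, x)).
  apply: (fubini_Rint (measurable_correlation_kernel z) mb kb).
  under eq_integral do rewrite inner.
  have iK : integ mu (fun h : borel G => normc z * (K h * (2 * N))).
    apply: integZ; under eq_fun do rewrite mulrC.
    by apply: integZ; exact: density_integrable hK.
  by rewrite (integ_EFin iK) ltry.
apply: eq_Rintegral => h _.
by rewrite /k /= (RintZ _ (integ_Re_pairing haar mF iF s0 t0 st z h)).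
Qed.

(** Fubini turns each rotation of [<T f, J>] into a mean of correlations over translates, so the
    geometric bounds apply to it. The inner integrals agree off the null set where the convolution
    diverges. *)
Lemma duality_conv z : Re (z * duality (T f)) = mean_corr mu F s t K z.
Proof.
have Lf := Lp_radial; have LT := Lp_conv sc haar hK p1 Lf.
rewrite Re_Cintegral; [|exact: cmeas_dual LT.1|exact: integ_dual_conj].
rewrite mean_corrE; apply: ae_eq_Rint.
- exact: (cmeasZ z (cmeas_dual LT.1)).1.
- exact: (measurable_iterated_Rint mu (measurable_correlation_kernel z)).
apply: (ae_imp2 _ (conv_integrand_ae sc haar hK p1 Lf) (conv_integrand_ae sc haar hK p1 Lf)) => x ix _.
have -> : z * (T f x * (J x)^*%C) =
    z * (J x)^*%C * Cintegral mu (fun h : borel G => (K h)%:C%C * f ((h : G)^-1 * x)%g).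
  by rewrite (mulrC (T f x)) mulrA.
rewrite (Re_Cintegral _ (cmeas_conv_integrand hK x Lf.1) ix).
apply: eq_Rintegral => h _; rewrite /pairing -/(f _) -/(J x).
have e (a : R) (w : R[i]) : a * Re w = Re (a%:C%C * w) by case: w => ? ? /=; ring.
by rewrite e; congr Re; ring.
Qed.

Lemma duality_self : duality f = N%:C%C.
Proof.
apply/eqP; rewrite eq_complex; apply/andP; split; apply/eqP => /=.
  apply: eq_Rintegral => x _; rewrite sqr_normcE /f /J /radial.
  have n0 := normc_ge0 (F x).
  have [->|Fx0] := eqVneq (F x) 0; first by rewrite !mulr0 /= !mul0r subr0 expr0n addr0.
  have e : normc (F x) `^ (s - 1) * normc (F x) `^ (t - 1) = 1.
    rewrite -powRD ?normc_eq0 ?Fx0 ?implybT//.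
    by have -> : s - 1 + (t - 1) = 0; [have := st; lra|rewrite powRr0].
  have -> : Re ((normc (F x) `^ (s - 1))%:C%C * F x * ((normc (F x) `^ (t - 1))%:C%C * F x)^*%C) =
     normc (F x) `^ (s - 1) * normc (F x) `^ (t - 1) * (Re (F x) ^+ 2 + Im (F x) ^+ 2).
    by case: (F x) => a b /=; ring.
  by rewrite e mul1r.
rewrite /Rintegral; under eq_integral do rewrite Im_radial_mul.
by rewrite integral0.
Qed.

Definition lpnorm (u : borel G -> R[i]) := (\int[mu]_x (normc (u x) `^ p)) `^ p^-1.

Lemma CnormE (u : borel G -> R[i]) : Lp mu p u -> Cnorm mu p u = (lpnorm u)%:E.
Proof.
move=> [mu' iu]; rewrite /Cnorm unlock /=.
under eq_integral => x _ do rewrite /= ger0_norm ?normc_ge0//.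
by rewrite integ_EFin// poweR_EFin.
Qed.

Lemma holder_dual (u : borel G -> R[i]) : Lp mu p u ->
  \int[mu]_x (normc (u x) * normc (J x)) <= lpnorm u * N `^ (1 - p^-1).
Proof.
move=> Lu; have [mu' iu] := Lu.
pose q := p / (p - 1).
have q0 : 0 < q by rewrite divr_gt0// subr_gt0.
have qV : q^-1 = 1 - p^-1 by rewrite /q invf_div mulrBl divff ?gt_eqF// mul1r.
have pq : p^-1 + q^-1 = 1 by rewrite qV addrC subrK.
have mu2 := cmeas_normc mu'; have mJ := cmeas_normc (cmeas_radial t mF).
have := hoelder mu mu2 mJ p0 q0 pq.
have JE x : normc (J x) `^ q = normc (F x) ^+ 2.
  rewrite normc_radial// -powRrM.
  have -> : t * q = 2%:R; last by rewrite powR_mulrn// normc_ge0.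
  have p1' : p - 1 != 0 by rewrite subr_eq0 gt_eqF.
  by rewrite /q tE sE; field; rewrite p1' gt_eqF.
rewrite Lnorm1.
have -> : (\int[mu]_x `|(EFin \o (fun x => normc (u x)) \* (fun x => normc (J x)))%R x| =
    (\int[mu]_x (normc (u x) * normc (J x)))%:E)%E.
  rewrite -integ_EFin; last exact: integ_dual.
  by apply: eq_integral => x _ /=; rewrite ger0_norm// mulr_ge0 ?normc_ge0.
have -> : 'N[mu]_p%:E[EFin \o (fun x => normc (u x))]%E = (lpnorm u)%:E.
  exact: CnormE.
have -> : 'N[mu]_q%:E[EFin \o (fun x => normc (J x))]%E = (N `^ (1 - p^-1))%:E.
  rewrite unlock /= -qV.
  under eq_integral => x _ do rewrite /= ger0_norm ?normc_ge0// JE.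
  by rewrite integ_EFin// poweR_EFin.
by rewrite -EFinM lee_fin.
Qed.

(** The numerical range bounds [|l - 1| N] by the pairing of [l f - T f] with [J], and Hölder bounds
    that by its norm times [N^(1 - 1/p)]. Dividing leaves [N^(1/p)], the norm of [f]. *)
Lemma resolvent_bound (D : R) : 0 <= D ->
  `|mean_corr mu F s t K (- 'i%C)| <= D * (N - mean_corr mu F s t K 1) ->
  (forall z, normc z = 1 ->
     normc (z - 1) ^+ 2 * N <= D * (N - mean_corr mu F s t K z)) ->
  (forall z, normc z = 1 -> 0 <= N - mean_corr mu F s t K z) ->
  forall l, 1 < normc l -> normc l <= 2 ->
  normc (l - 1) * lpnorm f <=
    (2 * (2 + D) + 2 * (1 + D) ^+ 2) * lpnorm (fun x => l * f x - T f x).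
Proof.
move=> D0 h1 h2 h3 l l1 l2; set kap := 2 * (2 + D) + _.
have kap0 : 0 <= kap by rewrite /kap; have := sqr_ge0 (1 + D); lra.
have Lf := Lp_radial; have LT := Lp_conv sc haar hK p1 Lf.
have N0 := sqmass_ge0 mu F.
have ImE (w : R[i]) : Im w = Re (- 'i%C * w) by rewrite ReNi.
have ReE (w : R[i]) : Re w = Re (1 * w) by rewrite mul1r.
have main : normc (l - 1) * N <= kap * normc (l * N%:C%C - duality (T f)).
  apply: numerical_range_distance => //.
  - by rewrite ImE ReE !duality_conv.
  - by move=> z z1; rewrite duality_conv; exact: h2.
  - by move=> z z1; rewrite duality_conv; exact: h3.
have Lu : Lp mu p (fun x => l * f x - T f x).
  have -> : (fun x => l * f x - T f x) = (fun x => l * f x + (-1) * T f x).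
    by apply/funext => x; rewrite mulN1r.
  exact: (LpD p1 (LpZ l Lf) (LpZ (-1) LT)).
have dE : l * N%:C%C - duality (T f) = duality (fun x => l * f x - T f x).
  rewrite -duality_self /duality -Cintegral_scale; [|exact: cmeas_dual Lf.1|exact: integ_dual_conj].
  rewrite -[- Cintegral _ _]mulN1r -Cintegral_scale; [|exact: cmeas_dual LT.1|exact: integ_dual_conj].
  rewrite -Cintegral_add.
  - by congr Cintegral; apply/funext => x; ring.
  - by apply: cmeasZ; exact: cmeas_dual Lf.1.
  - by apply: cmeasZ; exact: cmeas_dual LT.1.
  - under eq_fun do rewrite Normc.normcM.
    by apply: integZ; exact: integ_dual_conj.
  - under eq_fun do rewrite Normc.normcM.
    by apply: integZ; exact: integ_dual_conj.
have hd : normc (duality (fun x => l * f x - T f x)) <=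
    lpnorm (fun x => l * f x - T f x) * N `^ (1 - p^-1).
  apply: le_trans (holder_dual Lu); rewrite -lee_fin -integ_EFin; last exact: integ_dual.
  apply: (le_trans (normc_Cintegral_le mu (cmeas_dual Lu.1))).
  rewrite le_eqVlt; apply/orP; left; apply/eqP; apply: eq_integral => x _.
  by rewrite Normc.normcM normc_conj.
rewrite dE in main; have fin := le_trans main (ler_wpM2l kap0 hd).
have -> : lpnorm f = N `^ p^-1 by rewrite /lpnorm sqmass_radial.
have U0 : 0 <= lpnorm (fun x => l * f x - T f x) := powR_ge0 _ _.
have x0 := normc_ge0 (l - 1).
move: N0 fin U0 x0; move: (sqmass mu F) (lpnorm _) (normc (l - 1)) => M U x.
rewrite le_eqVlt => /predU1P[<-|M0] h U0 x0.
  by rewrite powR0 ?mulr0 ?mulr_ge0// invr_eq0 gt_eqF.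
have eM : M = M `^ p^-1 * M `^ (1 - p^-1).
  by rewrite -powRD ?(gt_eqF M0) ?implybT// addrC subrK powRr1// ltW.
by rewrite -(ler_pM2r (powR_gt0 (1 - p^-1) M0)) -mulrA -eM -mulrA.
Qed.

End Duality.

(** * Quasi-homomorphisms *)

Section Generation.
Variable G : topologicalGroupType.
Hypothesis cG : connected [set: G].

(** [P] is open because [P V] lies in [P], and closed because every point of its closure lies in
    [P V]. Products suffice, so [P] may be a mere subsemigroup. *)
Lemma connected_group_ind (V : set G) (P : set G) : open V -> V 1%g -> V `<=` P ->
  (forall x y, P x -> P y -> P (x * y)%g) -> forall g, P g.
Proof.
move=> oV V1 VP PM g.
have nV (z : G) : nbhs z (fun x => V (z^-1 * x)%g).
  have := @mulg_continuousl G z^-1%g z V; rewrite /= mulVg; apply.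
  exact: open_nbhs_nbhs.
have nV' (z : G) : nbhs z (fun x => V (x^-1 * z)%g).
  have : (fun x : G => x^-1 * z)%g @ nbhs z --> (z^-1 * z)%g.
    by apply: mulg_cvg; [apply: invg_cvg; exact: cvg_id|exact: cvg_cst].
  by rewrite mulVg; apply; exact: open_nbhs_nbhs.
suff -> : P = [set: G] by [].
apply: cG.
- by exists 1%g; exact: VP.
- exists P; last by rewrite setTI.
  rewrite openE => x Px; apply: filterS (nV x) => y Vy.
  by rewrite -(mulVKg x y); apply: PM => //; exact: VP.
- exists P; last by rewrite setTI.
  move=> x clx; have [h [Ph Vh]] := clx _ (nV' x).
  by rewrite -(mulVKg h x); apply: PM => //; exact: VP.
Qed.

End Generation.

Section FiniteTranslates.
Variable G : topologicalGroupType.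

Lemma compact_translates (C V S : set G) : compact C -> open V ->
  (forall c, C c -> exists2 s, S s & V (s^-1 * c)%g) ->
  exists D : {fset G}, (forall s, s \in D -> S s) /\
    (forall c, C c -> exists2 s, s \in D & V (s^-1 * c)%g).
Proof.
rewrite compact_cover => cC oV cov.
have [|x Cx|D DS CD] := cC G S (fun s => (fun x => s^-1 * x)%g @^-1` V).
- move=> s _; apply: open_comp => // x _; exact: mulg_continuousl.
- by have [s Ss Vs] := cov x Cx; exists s.
exists D; split => [s sD|c Cc]; first by have := DS s sD; rewrite inE.
by have [s sD Vs] := CD c Cc; exists s.
Qed.

Lemma compact_mulg (A B : set G) : compact A -> compact B ->
  compact [set (z.1 * z.2)%g | z in A `*` B].
Proof.
move=> cA cB; apply: continuous_compact; last exact: compact_setX.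
exact/continuous_subspaceT/mulg_continuous.
Qed.

Lemma compact_invg (A : set G) : compact A -> compact [set x^-1%g | x in A].
Proof.
move=> cA; apply: continuous_compact => //.
exact/continuous_subspaceT/invg_continuous.
Qed.

End FiniteTranslates.

Section QuasiHomomorphisms.
Variables (R : realType) (G : topologicalGroupType).
Variables (V X : set G).

(* [E] plays the role of a squared word length, scaled by [Q]: it bounds the
   defect of additivity of [gam], which is not assumed to be regular. *)
Record quasihom (E gam : G -> R) (Q : R) : Prop := {
  qh_E0 : forall g, 0 <= E g;
  qh_EM : forall g h, E (g * h)%g <= 2 * E g + 2 * E h;
  qh_EV : forall g, E g^-1%g = E g;
  qh_E_le : forall g, V g -> E g <= Q;
  qh_M : forall g h, `|gam (g * h)%g - gam g - gam h| <= E g + E h;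
  qh_X : forall x, X x -> gam x = 0;
  qh_bounded : forall C, compact C -> exists A, forall g, C g -> `|gam g| <= A
}.

(** The constant precedes the quantifiers over [E], [gam] and [Q]; it depends on [V], [X] and the
    set alone, which makes the final bound uniform in the function and in the density. *)
Definition ebounded (S : set G) := exists2 C : R, 0 <= C &
  forall E gam Q, quasihom E gam Q -> forall g, S g -> E g <= C * Q.

Definition gbounded (S : set G) := exists2 C : R, 0 <= C &
  forall E gam Q, quasihom E gam Q -> forall g, S g -> `|gam g| <= C * Q.

Hypotheses (oV : open V) (V1 : V 1%g) (cG : connected [set: G]).

Lemma quasihom_Q0 E gam Q : quasihom E gam Q -> 0 <= Q.
Proof. by move=> qh; apply: le_trans (qh_E_le qh V1); exact: qh_E0 qh _. Qed.

Let mulg_set (A B : set G) : set G := [set (z.1 * z.2)%g | z in A `*` B].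

Lemma ebounded_mul A B : ebounded A -> ebounded B -> ebounded (mulg_set A B).
Proof.
move=> [C C0 hC] [D D0 hD]; exists (2 * C + 2 * D); first lra.
move=> E gam Q qh _ [[a b] /= [Aa Bb] <-].
by have := qh_EM qh a b; have := hC _ _ _ qh _ Aa; have := hD _ _ _ qh _ Bb; lra.
Qed.

Lemma gbounded_mul A B : ebounded A -> ebounded B -> gbounded A -> gbounded B ->
  gbounded (mulg_set A B).
Proof.
move=> [C C0 hC] [D D0 hD] [C' C'0 hC'] [D' D'0 hD'].
exists (C + D + C' + D'); first lra.
move=> E gam Q qh _ [[a b] /= [Aa Bb] <-].
have := qh_M qh a b; have := hC _ _ _ qh _ Aa; have := hD _ _ _ qh _ Bb.
have := hC' _ _ _ qh _ Aa; have := hD' _ _ _ qh _ Bb.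
rewrite !ler_norml => /andP[? ?] /andP[? ?] ? ? /andP[? ?]; apply/andP; split; lra.
Qed.

Lemma ebounded1 g : ebounded [set g].
Proof.
apply: (connected_group_ind cG oV V1 (P := fun g => ebounded [set g])) => [x Vx|x y ex ey].
  exists 1 => // E gam Q qh _ ->; rewrite mul1r; exact: qh_E_le qh _ Vx.
have [C C0 hC] := ebounded_mul ex ey; exists C => // E gam Q qh _ ->.
by apply: hC qh _ _; exists (x, y).
Qed.

Lemma ebounded_sub A B : A `<=` B -> ebounded B -> ebounded A.
Proof. by move=> AB [C C0 h]; exists C => // E gam Q qh g /AB; exact: h qh _. Qed.

Lemma gbounded_sub A B : A `<=` B -> gbounded B -> gbounded A.
Proof. by move=> AB [C C0 h]; exists C => // E gam Q qh g /AB; exact: h qh _. Qed.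

Lemma ebounded_V : ebounded V.
Proof. by exists 1 => // E gam Q qh g; rewrite mul1r; exact: qh_E_le qh _. Qed.

Lemma ebounded_seq (s : seq G) : ebounded [set x | x \in s].
Proof.
elim: s => [|a s [C C0 hC]]; first by exists 0 => // E gam Q qh g.
have [D D0 hD] := ebounded1 a; exists (C + D); first lra.
move=> E gam Q qh g; have Q0 := quasihom_Q0 qh.
rewrite /= inE => /orP[/eqP ->|gs].
  by have := hD _ _ _ qh a erefl; have := mulr_ge0 C0 Q0; lra.
by have := hC _ _ _ qh g gs; have := mulr_ge0 D0 Q0; lra.
Qed.

Lemma gbounded_seq (s : seq G) : (forall x, x \in s -> gbounded [set x]) ->
  gbounded [set x | x \in s].
Proof.
elim: s => [_|a s ih hs]; first by exists 0 => // E gam Q qh g.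
have [|C C0 hC] := ih; first by move=> x xs; apply: hs; rewrite inE xs orbT.
have [D D0 hD] := hs a (mem_head _ _); exists (C + D); first lra.
move=> E gam Q qh g; have Q0 := quasihom_Q0 qh.
rewrite /= inE => /orP[/eqP ->|gs].
  by have := hD _ _ _ qh a erefl; have := mulr_ge0 C0 Q0; lra.
by have := hC _ _ _ qh g gs; have := mulr_ge0 D0 Q0; lra.
Qed.

Lemma mulg_setP (A B : set G) a b : A a -> B (a^-1 * b)%g -> mulg_set A B b.
Proof. by move=> Aa Bb; exists (a, (a^-1 * b)%g) => //=; rewrite mulVKg. Qed.

Lemma ebounded_compact C : compact C -> ebounded C.
Proof.
move=> cC; have [|D [_ hD]] := compact_translates (S := setT) cC oV.
  by move=> c _; exists c => //; rewrite mulVg.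
apply: ebounded_sub (ebounded_mul (ebounded_seq D) ebounded_V) => c Cc.
by have [s sD Vs] := hD c Cc; apply: mulg_setP Vs.
Qed.

(** The constant may vary with the point; uniformity over a compact set is the content of
    [gbounded_cocompact]. *)
Definition good : set G := [set g | gbounded [set g]].

Lemma good1 : good 1%g.
Proof.
exists 2 => // E gam Q qh _ ->.
have := qh_M qh 1%g 1%g; rewrite mulg1; have := qh_E_le qh V1.
have := quasihom_Q0 qh.
rewrite !ler_norml => ? ? /andP[? ?]; apply/andP; split; lra.
Qed.

Lemma goodM x y : good x -> good y -> good (x * y)%g.
Proof.
move=> gx gy; apply: gbounded_sub (gbounded_mul (ebounded1 x) (ebounded1 y) gx gy).
by move=> _ ->; exists (x, y).
Qed.

Lemma goodV x : good x -> good x^-1%g.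
Proof.
have [D D0 hD] := good1; have [F F0 hF] := ebounded1 x.
move=> [C C0 hC]; exists (C + D + 2 * F); first lra.
move=> E gam Q qh _ ->; have := qh_M qh x x^-1%g; rewrite mulgV (qh_EV qh).
have := hD _ _ _ qh _ erefl; have := hC _ _ _ qh _ erefl; have := hF _ _ _ qh _ erefl.
rewrite !ler_norml => ? /andP[? ?] /andP[? ?] /andP[? ?]; apply/andP; split; lra.
Qed.

(* Additivity up to [E] makes the values at [x] and [x^-1] cancel. *)
Lemma good_commutator x y : good [~ x, y]%g.
Proof.
have [D D0 hD] := good1.
have [Fx Fx0 hFx] := ebounded1 x; have [Fy Fy0 hFy] := ebounded1 y.
have [Fxy Fxy0 hFxy] := ebounded1 (x * y)%g.
have [Fyxy Fyxy0 hFyxy] := ebounded1 (y^-1 * (x * y))%g.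
exists (2 * D + 10 * (Fx + Fy + Fxy + Fyxy)); first lra.
move=> E gam Q qh _ ->; rewrite commgEl conjgE.
have Q0 := quasihom_Q0 qh.
have := qh_M qh x y; have := qh_M qh y^-1%g (x * y)%g.
have := qh_M qh x^-1%g (y^-1 * (x * y))%g.
have := qh_M qh x x^-1%g; have := qh_M qh y y^-1%g; rewrite !mulgV !(qh_EV qh).
have := hD _ _ _ qh _ erefl; have := hFx _ _ _ qh _ erefl; have := hFy _ _ _ qh _ erefl.
have := hFxy _ _ _ qh _ erefl; have := hFyxy _ _ _ qh _ erefl.
have := mulr_ge0 D0 Q0; have := mulr_ge0 Fx0 Q0; have := mulr_ge0 Fy0 Q0.
have := mulr_ge0 Fxy0 Q0; have := mulr_ge0 Fyxy0 Q0.
move=> ? ? ? ? ? ? ? ? ?.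
rewrite !ler_norml => /andP[? ?] /andP[? ?] /andP[? ?] /andP[? ?] /andP[? ?] /andP[? ?].
apply/andP; split; lra.
Qed.

Lemma good_commutator_subgroup : @commutator_subgroup G `<=` good.
Proof.
apply: smallest_sub.
  split=> [|x y gx gy]; first exact: good1.
  by apply: goodM => //; exact: goodV.
by move=> _ [x _ [y _ <-]]; exact: good_commutator.
Qed.

Lemma good_X : X `<=` good.
Proof.
move=> x Xx; exists 0 => // E gam Q qh _ ->.
by rewrite (qh_X qh Xx) normr0 mul0r.
Qed.

(* If [u^4 = b l] with [b] bounded and [l] good, then [4 gam(u) = gam(b) + O(Q)],
   so the supremum of [|gam|] over a bounded set absorbs itself. *)
Lemma gbounded_cocompact (B : set G) : compact B -> V `<=` B ->
  (forall g, exists b l, [/\ B b, good l & g = (b * l)%g]) -> gbounded B.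
Proof.
move=> cB VB coB.
pose B2 := mulg_set B B; pose B4 := mulg_set B2 B2.
have cB2 : compact B2 by exact: compact_mulg.
have cB4 : compact B4 by exact: compact_mulg.
(* [M] contains every [l = b^-1 u^4]. Finitely many good points approximate, up to [V], the part of
   [M] in the closure of [good], and a finite set has one constant. *)
pose M := mulg_set [set x^-1%g | x in B] B4.
have cM : compact M by apply: compact_mulg => //; exact: compact_invg.
have cK : compact (M `&` closure good) by apply: compact_closedI => //; exact: closed_closure.
have [|D [Dg hD]] := compact_translates (S := good) cK oV.
  move=> c [_ clc]; have : nbhs c (fun x => V (x^-1 * c)%g).
    have : (fun x : G => x^-1 * c)%g @ nbhs c --> (c^-1 * c)%g.
      by apply: mulg_cvg; [apply: invg_cvg; exact: cvg_id|exact: cvg_cst].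
    by rewrite mulVg; apply; exact: open_nbhs_nbhs.
  by move=> /clc[s [gs Vs]]; exists s.
have [CD CD0 hCD] := gbounded_seq (fun x xD => Dg x xD).
have [ED ED0 hED] := ebounded_seq D.
have [EB EB0 hEB] := ebounded_compact cB.
pose C := CD + 12 * EB + EB + 3 * ED + 3.
(* In [u^4 = b s v] only [gam b] and [gam v] are estimated by [A], so [4 |gam u| <= 2 A + O(Q)].
   With [u^2] instead, the bound would be [A] again, with no gain. *)
have step E gam Q A : quasihom E gam Q -> (forall u, B u -> `|gam u| <= A) ->
    forall u, B u -> `|gam u| <= A / 2 + C * Q.
  move=> qh hA u Bu; have Q0 := quasihom_Q0 qh.
  have [b [l [Bb gl ul]]] := coB (u * u * (u * u))%g.
  have lE : l = (b^-1 * (u * u * (u * u)))%g by rewrite ul mulKg.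
  have [|s sD Vs] := hD l.
    split; last exact: subset_closure.
    rewrite lE; exists (b^-1, u * u * (u * u))%g => //; split => /=; first by exists b.
    by exists (u * u, u * u)%g => //; split; exists (u, u).
  set v := (s^-1 * l)%g in Vs.
  have ul' : (u * u * (u * u) = b * (s * v))%g by rewrite ul /v mulVKg.
  have := qh_M qh u u; have := qh_M qh (u * u)%g (u * u)%g; rewrite ul'.
  have := qh_M qh b (s * v)%g; have := qh_M qh s v.
  have := qh_EM qh u u; have := qh_EM qh s v.
  have := qh_E_le qh Vs; have := hEB _ _ _ qh _ Bu; have := hEB _ _ _ qh _ Bb.
  have := hED _ _ _ qh _ sD; have := hCD _ _ _ qh _ sD.
  have := hA _ Bb; have := hA v (VB _ Vs).
  have := mulr_ge0 CD0 Q0; have := mulr_ge0 EB0 Q0; have := mulr_ge0 ED0 Q0.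
  move=> ? ? ?.
  rewrite !ler_norml => /andP[? ?] /andP[? ?] /andP[? ?] ? ? ? ? ? ?.
  move=> /andP[? ?] /andP[? ?] /andP[? ?] /andP[? ?].
  by apply/andP; split; rewrite /C; lra.
exists (2 * C); first by rewrite /C; lra.
move=> E gam Q qh u Bu.
(* This bound has no known size; it only guarantees a finite supremum. *)
have [A hA] := qh_bounded qh cB.
pose S := [set `|gam u| | u in B].
have supS : has_sup S.
  split; first by exists `|gam u|, u.
  by exists A => _ [w Bw <-]; exact: hA.
have hS w : B w -> `|gam w| <= sup S by move=> Bw; apply: ub_le_sup; [case: supS|exists w].
have : sup S <= sup S / 2 + C * Q.
  by apply: sup_le_ub; [case: supS|move=> _ [w Bw <-]; exact: step qh hS _ Bw].
by have := hS u Bu; lra.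
Qed.

(** The factor 2 in [qh_EM] lets the bound on [E] grow like [4^n], and [gam] picks up one value of
    [E] per letter. The base 16 is generous: exponential moments of every order are available. *)
Lemma quasihom_word_growth (B U : set G) : compact B -> V `<=` B ->
  (forall g, exists b l, [/\ B b, good l & g = (b * l)%g]) ->
  compact (closure U) ->
  exists2 C : R, 0 < C & forall E gam Q, quasihom E gam Q ->
    forall n g, set_power U n g -> `|gam g| <= C * 16 ^+ n * Q.
Proof.
move=> cB VB coB cU.
have gV : gbounded V := gbounded_sub VB (gbounded_cocompact cB VB coB).
have gall g : good g.
  apply: (connected_group_ind cG oV V1 (P := good)) => [x Vx|x y]; last exact: goodM.
  by apply: gbounded_sub gV => _ ->.
have [D [_ hD]] : exists D : {fset G}, (forall s, s \in D -> setT s) /\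
    (forall c, closure U c -> exists2 s, s \in D & V (s^-1 * c)%g).
  by apply: compact_translates => // c _; exists c => //; rewrite mulVg.
have eU : ebounded U by apply: ebounded_sub (ebounded_compact cU); exact: subset_closure.
have gU : gbounded U.
  have gD : gbounded [set x | x \in D] by apply: gbounded_seq => x _; exact: gall.
  apply: gbounded_sub (gbounded_mul (ebounded_seq D) ebounded_V gD gV) => c Uc.
  by have [s sD Vs] := hD c (subset_closure Uc); apply: mulg_setP Vs.
have [CE CE0 hE] := eU; have [CG CG0 hG] := gU; have [C1 C10 h1] := good1.
pose C := CE + CG + C1 + 1.
exists C; first by rewrite /C; lra.
move=> E gam Q qh n g.
have Q0 := quasihom_Q0 qh; have E1 := qh_E_le qh V1.
have := mulr_ge0 CE0 Q0; have := mulr_ge0 CG0 Q0; have := mulr_ge0 C10 Q0 => ? ? ?.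
suff : set_power U n g -> E g <= 4 ^+ n * (C * Q) /\ `|gam g| <= 16 ^+ n * (C * Q).
  by move=> h /h[_ +]; rewrite mulrCA mulrA.
elim: n g => [|n ih] g [s sU <-].
  rewrite big_ord0 !expr0 !mul1r /C; split; first lra.
  by apply: (le_trans (h1 _ _ _ qh _ erefl)); lra.
rewrite big_ord_recl; set h := (\prod_(i < n) _)%g.
have [|Eh gh] := ih h; first by exists (fun i => s (lift ord0 i)).
have Us := sU ord0; have := hE _ _ _ qh _ Us; have := hG _ _ _ qh _ Us.
have CQ0 : 0 <= C * Q by rewrite mulr_ge0// /C; lra.
have p4 : 1 <= 4 ^+ n :> R by rewrite exprn_ege1// ler1n.
have p16 : 4 ^+ n <= 16 ^+ n :> R by rewrite lerXn2r ?nnegrE// ler_nat.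
have q4 := ler_wpM2r CQ0 p4; have q16 := ler_wpM2r CQ0 p16.
have := qh_EM qh (s ord0) h; have := qh_M qh (s ord0) h.
rewrite [4 ^+ _]exprS [16 ^+ _]exprS; move: gh.
rewrite !ler_norml => /andP[? ?] /andP[? ?] ? /andP[? ?] ?.
have CE' : CE * Q <= C * Q by rewrite /C; lra.
have CG' : CG * Q <= C * Q by rewrite /C; lra.
split; first lra.
by apply/andP; split; lra.
Qed.

End QuasiHomomorphisms.

Local Open Scope quotient_scope.

(** * Kernels, quotients and a cocompactness statement *)

Section GroupToZmodule.
Variables (G : groupType) (Z : zmodType) (f : G -> Z).
Hypothesis fM : forall g h, f (g * h)%g = f g + f h.

Lemma hom_one : f 1%g = 0.
Proof. by apply: (addrI (f 1%g)); rewrite -fM mulg1 addr0. Qed.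

Lemma hom_inv g : f g^-1%g = - f g.
Proof. by apply: (addrI (f g)); rewrite -fM mulgV hom_one subrr. Qed.

Lemma hom_eq x y : (f x = f y) <-> f (x^-1 * y)%g = 0.
Proof.
rewrite fM hom_inv addrC; split => [->|/subr0_eq//]; exact: subrr.
Qed.

End GroupToZmodule.

Section QuotientCover.
Variables (G : topologicalGroupType) (N : set G) (X : topologicalType).
Variable phi : left_quotient N -> X.
Hypothesis hphi : homeomorphism phi.
Let f g := phi (left_proj N g).

Lemma left_proj_eq x y : (left_proj N x = left_proj N y) <-> f x = f y.
Proof.
have [_ [k [kK _ _]]] := hphi.
by split => [|/(congr1 k)]; rewrite /f ?kK// => ->.
Qed.

Lemma left_proj_lcoset x y : left_proj N x = left_proj N y -> lcoset N x = lcoset N y.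
Proof. by move=> /eqmodP /asboolP. Qed.

Lemma left_proj_continuous : continuous f.
Proof.
have [cphi _] := hphi; move=> x; apply: continuous_comp; last exact: cphi.
exact: pi_continuous.
Qed.

Variable K : set G.
Hypothesis fK : forall x y, f x = f y <-> K (x^-1 * y)%g.

(** The saturation of an open set is a union of its right translates by kernel elements. *)
Lemma left_proj_open (O : set G) : open O -> open [set left_proj N g | g in O].
Proof.
move=> oO; rewrite /open/= /quotient_open.
rewrite openE => x [y Oy yx]; have Kn : K (y^-1 * x)%g by apply/fK/left_proj_eq.
set n := (y^-1 * x)%g in Kn.
have xn : (x * n^-1 = y)%g by rewrite /n invgM invgK mulVKg.
have : nbhs x ((fun z => z * n^-1)%g @^-1` O).
  by apply: mulg_continuousr; rewrite xn; exact: open_nbhs_nbhs.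
apply: filterS => z /= Oz; exists (z * n^-1)%g => //.
by apply/left_proj_eq/fK; rewrite invgM invgK mulgVK.
Qed.

(** The images of the translates [j V] are open and cover the quotient, so finitely many cover the
    compact set; what is left of [g] lies in the kernel. *)
Lemma compact_quotient_cover (C : set X) (V : set G) : compact C -> open V -> V 1%g ->
  exists s : seq G, forall g, C (f g) ->
    exists j v n, [/\ j \in s, V v, K n & g = (j * v * n)%g].
Proof.
have [cphi [k [kK Kk ck]]] := hphi => cC oV V1.
have : compact [set k x | x in C].
  by apply: continuous_compact => //; exact/continuous_subspaceT.
rewrite compact_cover.
pose F (j : G) := [set left_proj N g | g in [set (j * v)%g | v in V]].
move=> /(_ _ setT F)[|_ [x Cx <-]|D _ cov].
- by move=> j _; apply: left_proj_open; exact: open_mulgl.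
- have [g gE] : exists g, left_proj N g = k x by exists (repr (k x)); exact: reprK.
  by exists g => //; exists g => //; exists 1%g; rewrite ?mulg1.
exists D => g Cg; have [|j jD [_ [v Vv <-] jvg]] := cov (left_proj N g).
  by exists (f g) => //; exact: kK.
exists j, v, ((j * v)^-1 * g)%g; split => //; last by rewrite mulVKg.
by apply/fK/left_proj_eq.
Qed.

End QuotientCover.

Section Cocompact.
Variables (R : realType) (G : topologicalGroupType) (q r : nat).
Variable phi0 : left_quotient (closed_commutator G) -> 'rV[R]_q * 'rV[circle R]_r.
Variable phi1 : left_quotient (torus_preimage phi0) -> 'rV[R]_q.
Hypotheses (iso0 : quotient_iso phi0 +%R) (iso1 : quotient_iso phi1 +%R).
Let f0 g := phi0 (left_proj (closed_commutator G) g).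
Let f1 g := phi1 (left_proj (torus_preimage phi0) g).

Lemma frac_itv (x : R) : 0 <= x - (Num.floor x)%:~R <= 1.
Proof.
by have /andP[h1 h2] := floor_itv x; rewrite intrD in h2; apply/andP; split; lra.
Qed.

Lemma circle_compact : compact [set: circle R].
Proof.
have -> : [set: circle R] = [set (\pi_(circle R) x : circle R) | x in `[0 : R, 1]%classic].
  apply/seteqP; split => // z _; pose x : R := repr z.
  pose y := x - (Num.floor x)%:~R.
  exists y; first by rewrite /= in_itv/=; exact: frac_itv.
  rewrite -[RHS](reprK z); apply/eqP; rewrite -/x.
  rewrite -[_ == _]/(y == x %[mod {ideal_quot integers R}]) -Quotient.idealrBE.
  by rewrite /y addrC addrA addNr add0r rpredN; apply/intrP; exists (Num.floor x).
apply: continuous_compact; last exact: segment_compact.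
apply: continuous_subspaceT; exact: pi_continuous.
Qed.

Lemma torus_compact : compact [set z : 'rV[R]_q * 'rV[circle R]_r | z.1 = 0].
Proof.
have -> : [set z : 'rV[R]_q * 'rV[circle R]_r | z.1 = 0] = [set 0] `*` [set: 'rV[circle R]_r].
  by apply/seteqP; split => [[a b]/= ->|[a b] /= [-> _]].
apply: compact_setX; first exact: compact_set1.
have := @rV_compact (circle R) r (fun=> setT) (fun=> circle_compact).
by congr compact; apply/seteqP; split.
Qed.

Lemma cube_compact : compact [set y : 'rV[R]_q | forall i, 0 <= y ord0 i <= 1].
Proof.
have := @rV_compact R q (fun=> `[0, 1]%classic) (fun=> @segment_compact R 0 1).
by congr compact; apply/seteqP; split => y /= h i; have := h i; rewrite /= in_itv.
Qed.

Let f0M g h : f0 (g * h)%g = f0 g + f0 h. Proof. exact: iso0.2. Qed.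
Let f1M g h : f1 (g * h)%g = f1 g + f1 h. Proof. exact: iso1.2. Qed.

Lemma ker_f0 n : f0 n = 0 -> closed_commutator G n.
Proof.
rewrite -(hom_one f0M) => /(left_proj_eq iso0.1) /left_proj_lcoset h.
have c1 : closed_commutator G 1%g.
  apply: subset_closure => S [[S1 _] _]; exact: S1.
have : lcoset (closed_commutator G) n n by exists 1%g; rewrite ?mulg1.
by rewrite h => -[m Nm <-]; rewrite mul1g.
Qed.

Lemma ker_f1 n : f1 n = 0 -> (f0 n).1 = 0.
Proof.
move=> n0; have /(left_proj_eq iso1.1)/left_proj_lcoset h : f1 n = f1 1%g.
  by rewrite n0 (hom_one f1M).
have c1 : torus_preimage phi0 1%g by rewrite /torus_preimage/= -/(f0 1%g) (hom_one f0M).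
have : lcoset (torus_preimage phi0) n n by exists 1%g; rewrite ?mulg1.
by rewrite h => -[m Nm <-]; rewrite mul1g; exact: Nm.
Qed.

Lemma phi1_continuous : continuous f1.
Proof. exact: left_proj_continuous iso1.1. Qed.

Lemma phi1_surjective y : exists g, f1 g = y.
Proof.
have [_ [k [_ Kk _]]] := iso1.1; exists (repr (k y)).
by rewrite /f1 -[RHS]Kk; congr phi1; exact: reprK.
Qed.

Variables (V S : set G).
Hypotheses (oV : open V) (V1 : V 1%g) (cV : compact (closure V)).
Hypotheses (S1 : S 1%g) (SM : forall x y, S x -> S y -> S (x * y)%g).
Hypotheses (SV : forall x, S x -> S x^-1%g) (SC : @commutator_subgroup G `<=` S).
Hypothesis Se : forall i, exists2 x, S x & f1 x = delta_mx ord0 i.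

Lemma lattice_mem (m : 'I_q -> int) :
  exists2 l, S l & f1 l = \row_i (m i)%:~R.
Proof.
pose M y := exists2 l, S l & f1 l = y.
have M0 : M 0 by exists 1%g => //; exact: hom_one.
have MD x y : M x -> M y -> M (x + y).
  by move=> [l Sl <-] [k Sk <-]; exists (l * k)%g; [exact: SM|exact: f1M].
have MN x : M x -> M (- x).
  by move=> [l Sl <-]; exists l^-1%g; [exact: SV|exact: hom_inv].
have Mn x n : M x -> M (x *+ n).
  by move=> Mx; elim: n => [|n ih]; rewrite ?mulr0n// mulrS; exact: MD.
have -> : \row_i (m i)%:~R = \sum_i delta_mx ord0 i *~ m i :> 'rV[R]_q.
  apply/rowP => j; rewrite !mxE summxE (bigD1 j)//= big1 ?addr0.
    by rewrite -[delta_mx _ _ *~ _]scaler_int !mxE !eqxx mulr1.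
  by move=> i ij; rewrite -[delta_mx _ _ *~ _]scaler_int !mxE eqxx eq_sym (negPf ij) mulr0.
elim/big_ind: _ => // i _; have Me : M (delta_mx ord0 i) by have [x ? ?] := Se i; exists x.
by case: (m i) => n; [exact: Mn|apply: MN; exact: Mn].
Qed.

(** [g] is peeled in three layers, each costing a compact factor: a lift to [S] of an integer vector
    brings [f1 g] into the unit cube, the kernel of [f1] maps into the compact torus, and the rest
    lies in the closure of the commutator subgroup, hence within [V] of [S]. *)
Lemma cocompact_good : exists B : set G, [/\ compact B, V `<=` B &
  forall g, exists b l, [/\ B b, S l & g = (b * l)%g]].
Proof.
have fK0 x y : f0 x = f0 y <-> f0 (x^-1 * y)%g = 0 := hom_eq f0M x y.
have fK1 x y : f1 x = f1 y <-> f1 (x^-1 * y)%g = 0 := hom_eq f1M x y.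
have [s1 hs1] := compact_quotient_cover (K := fun n => f1 n = 0) iso1.1 fK1 cube_compact oV V1.
have [s0 hs0] := compact_quotient_cover (K := fun n => f0 n = 0) iso0.1 fK0 torus_compact oV V1.
pose mul (A B : set G) : set G := [set (z.1 * z.2)%g | z in A `*` B].
pose W := closure V.
pose B0 := mul (mul (mul [set` s1] W) (mul [set` s0] W)) W.
have cs (s : seq G) : compact [set` s] by apply: finite_compact; exact: finite_seq.
have cB0 : compact B0 by rewrite /B0; do !apply: compact_mulg => //.
exists (B0 `|` W); split; [exact: compactU|by move=> x Vx; right; exact: subset_closure|].
move=> g; have [l Sl fl] := lattice_mem (fun i => Num.floor (f1 g ord0 i)).
have [|j [v [n [js Vv fn gE]]]] := hs1 (g * l^-1)%g.
  move=> i; rewrite -/(f1 _) f1M (hom_inv f1M) fl !mxE.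
  exact: frac_itv.
have [|j' [v' [n' [js' Vv' fn' nE]]]] := hs0 n; first exact: ker_f1.
have nV : nbhs n' (fun x => V (n' * x^-1)%g).
  have : (fun x : G => n' * x^-1)%g @ nbhs n' --> (n' * n'^-1)%g.
    by apply: mulg_cvg; [exact: cvg_cst|apply: invg_cvg; exact: cvg_id].
  by rewrite mulgV; apply; exact: open_nbhs_nbhs.
have [l' [Cl' Vl']] := ker_f0 fn' nV.
exists (j * v * (j' * v') * (n' * l'^-1))%g, (l' * l)%g; split.
- left; exists (j * v * (j' * v'), n' * l'^-1)%g => //; split => /=; last exact: subset_closure.
  exists (j * v, j' * v')%g => //; split => /=.
    by exists (j, v) => //; split => //; exact: subset_closure.
  by exists (j', v') => //; split => //; exact: subset_closure.
- by apply: SM => //; exact: SC.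
- rewrite !mulgA mulgVK -(mulgVK l g) gE nE !mulgA.
  by rewrite -!mulgA.
Qed.

End Cocompact.

(** * Centered densities with exponential moments *)

Section WordLength.
Variables (R : realType) (G : topologicalGroupType).

Lemma set_powerM (U : set G) m n x y :
  set_power U m x -> set_power U n y -> set_power U (m + n) (x * y)%g.
Proof.
move=> [s Us <-] [t Ut <-].
exists (fun i : 'I_(m + n) => match fintype.split i with inl j => s j | inr k => t k end).
  by move=> i /=; case: (fintype.split i).
rewrite big_split_ord /=; congr (_ * _)%g; apply: eq_bigr => i _.
  by rewrite (unsplitK (inl i)).
by rewrite (unsplitK (inr i)).
Qed.

Variable U : set G.
Hypotheses (cG : connected [set: G]) (oU : open U) (U1 : U 1%g).

Lemma set_power_cover g : exists2 n, (0 < n)%N & set_power U n g.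
Proof.
apply: (connected_group_ind cG oU U1
  (P := fun g => exists2 n, (0 < n)%N & set_power U n g)) => [x Ux|x y [m m0 mx] [n n0 ny]].
  by exists 1%N => //; exists (fun=> x) => //; rewrite big_ord1.
by exists (m + n)%N; [rewrite addn_gt0 m0|exact: set_powerM].
Qed.

(** The infimum is a minimum, so bounds along word lengths become bounds in terms of [rho]. *)
Lemma rho_attained g : exists2 n, set_power U n g & rho R U g = n%:R.
Proof.
have [k k0 kg] := set_power_cover g.
have [|n /asboolP[n0 ng] nmin] := @ex_minnP (fun n => `[< (0 < n)%N /\ set_power U n g >]).
  by exists k; apply/asboolP.
exists n => //; apply/eqP; rewrite eq_le; apply/andP; split.
  apply: ge_inf; last by exists n.
  by exists 0 => _ [m _ <-]; exact: ler0n.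
apply: lb_le_inf; first by exists n%:R, n.
by move=> _ [m hm <-]; rewrite ler_nat; apply: nmin; apply/asboolP.
Qed.

End WordLength.

(* The point is that [g] need not be measurable: [rho R U] is not known to be. *)
Lemma ge0_le_integralT (R : realType) d (T : measurableType d)
    (mu : {measure set T -> \bar R}) (f g : T -> \bar R) :
  (forall x, 0 <= f x)%E -> (forall x, f x <= g x)%E ->
  (\int[mu]_x f x <= \int[mu]_x g x)%E.
Proof.
move=> f0 fg; have g0 x : (0 <= g x)%E := le_trans (f0 x) (fg x).
rewrite !ge0_integralTE//; apply: le_ereal_sup; apply: image_subset => h hf x.
exact: le_trans (hf x) (fg x).
Qed.

Section Centering.
Variables (R : realType) (G : topologicalGroupType).
Variable mu : {sigma_finite_measure set (borel G) -> \bar R}.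
Hypotheses (cG : connected [set: G]).
Variable K : G -> R.
Hypothesis hK : prob_density mu K.

Lemma exp_moment_bound (U : set G) (gam : borel G -> R) (C M : R) :
  open U -> U 1%g -> 0 <= C -> measurable_fun [set: borel G] gam ->
  (forall n g, set_power U n g -> `|gam g| <= C * 16 ^+ n) ->
  (\int[mu]_g (K g * expR (ln 16 * rho R U g))%:E <= M%:E)%E ->
  integ mu (fun g => K g * gam g) /\ `|\int[mu]_g (K g * gam g)| <= C * M.
Proof.
move=> oU U1 C0 mg gle KM; have K0 := density_ge0 hK.
have [mK _ _] := hK.
have gle' g : `|gam g| <= C * expR (ln 16 * rho R U g).
  have [n ng ->] := rho_attained R cG oU U1 g.
  by apply: (le_trans (gle _ _ ng)); rewrite expRM_natr lnK// posrE.
have mKg : measurable_fun [set: borel G] (fun g => `|K g * gam g|).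
  by apply: measurableT_comp => //; exact: measurable_funM.
have M0 : 0 <= M.
  rewrite -lee_fin; apply: le_trans KM; apply: integral_ge0 => g _.
  by rewrite lee_fin mulr_ge0// expR_ge0.
have le1 : (\int[mu]_g (`|K g * gam g|)%:E <= (C * M)%:E)%E.
  (* A constant can be taken out of the left integral, whose integrand is measurable; so [C] is
     moved there as [C^-1], and [C = 0] is treated apart. *)
  have [C00|Cn0] := eqVneq C 0.
    rewrite C00 mul0r integral0_eq// => g _; have := gle' g.
    by rewrite C00 mul0r normr_le0 => /eqP ->; rewrite mulr0 normr0.
  have Cp : 0 < C by rewrite lt_neqAle eq_sym Cn0.
  have : (\int[mu]_g (C^-1 * `|K g * gam g|)%:E <= M%:E)%E.
    apply: le_trans KM; apply: ge0_le_integralT => g.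
      by rewrite lee_fin mulr_ge0// invr_ge0.
    rewrite lee_fin normrM (ger0_norm (K0 g)) mulrCA ler_wpM2l//.
    by rewrite ler_pdivrMl.
  under eq_integral do rewrite EFinM.
  rewrite ge0_integralZl//; last by rewrite lee_fin invr_ge0.
    by rewrite lee_pdivrMl// EFinM.
  exact/measurable_EFinP.
have iKg : integ mu (fun g => K g * gam g).
  apply/integrableP; split; first by apply/measurable_EFinP; exact: measurable_funM.
  by apply: le_lt_trans le1 (ltry _).
split=> //; apply: (le_trans (le_normr_Rintegral measurableT iKg)).
rewrite -lee_fin; apply: le_trans le1; rewrite -(integ_EFin)//.
exact: (integrable_norm iKg).
Qed.

(** The extended integral is the difference of those of the positive and negative parts. If either
    were infinite, so would be the difference; the value 0 therefore forces integrability. *)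
Lemma centered_Rint q (pi1 : G -> 'rV[R]_q) i :
  measurable_fun [set: borel G] (fun g : borel G => pi1 g ord0 i) ->
  centered mu pi1 K ->
  integ mu (fun g => K g * pi1 g ord0 i) /\ \int[mu]_g (K g * pi1 g ord0 i) = 0.
Proof.
move=> mpi /(_ i) cK; have [mK _ _] := hK.
have mf : measurable_fun [set: borel G] (fun g => (K g * pi1 g ord0 i)%:E).
  by apply/measurable_EFinP; exact: measurable_funM.
suff iK : integ mu (fun g => K g * pi1 g ord0 i).
  by split=> //; apply/eqP; rewrite -eqe -integ_EFin// cK.
apply/integrableP; split; first exact: mf.
set f := fun g : borel G => (K g * pi1 g ord0 i)%:E in mf.
have : (\int[mu]_g f g = 0)%E by exact: cK.
have -> : (\int[mu]_g `|(EFin \o (fun g => K g * pi1 g ord0 i)%R) g| =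
          \int[mu]_g (f^\+ g) + \int[mu]_g (f^\- g))%E.
  rewrite -ge0_integralD//; last 2 first.
  - exact: measurable_funepos.
  - exact: measurable_funeneg.
  by apply: eq_integral => g _; exact: (congr1 (@^~ g) (fune_abse f)).
rewrite integralE.
have := @integral_ge0 _ _ _ mu setT _ (fun x _ => funepos_ge0 f x).
have := @integral_ge0 _ _ _ mu setT _ (fun x _ => funeneg_ge0 f x).
move: (integral _ _ _) (integral _ _ _) => [a||] [b||] //= _ _ _.
by rewrite -EFinD ltry.
Qed.
End Centering.

Lemma Rint_sum_eq0 (R : realType) d (T : measurableType d) (mu : {measure set T -> \bar R})
    (I : Type) (r : seq I) (f : I -> T -> R) :
  (forall i, integ mu (f i) /\ \int[mu]_x f i x = 0) ->
  integ mu (fun x => \sum_(i <- r) f i x) /\ \int[mu]_x (\sum_(i <- r) f i x) = 0.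
Proof.
move=> hf; elim: r => [|i r [ir r0]].
  have e x : \sum_(i <- [::]) f i x = 0 by rewrite big_nil.
  rewrite (funext e); split; last by rewrite /Rintegral integral0.
  exact: integrable0.
have [fi f0] := hf i.
have e x : \sum_(j <- i :: r) f j x = f i x + \sum_(j <- r) f j x by rewrite big_cons.
rewrite (funext e); split; first exact: integD.
by rewrite (RintD fi ir) f0 r0 addr0.
Qed.

Section MeanSkew.
Variables (R : realType) (G : topologicalGroupType).
Variable mu : {sigma_finite_measure set (borel G) -> \bar R}.
Hypothesis sc : @second_countable G.
Hypothesis haar : left_haar mu.
Hypothesis cG : connected [set: G].
Variables (q : nat) (pi1 : G -> 'rV[R]_q) (x_ : 'I_q -> G).
Hypothesis pi1M : forall g h, pi1 (g * h)%g = pi1 g + pi1 h.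
Hypothesis cpi1 : continuous pi1.
Hypothesis pi1x : forall i, pi1 (x_ i) = delta_mx ord0 i.
Variables (F : borel G -> R[i]) (p s t : R).
Hypotheses (mF : cmeas F) (iF : integ mu (fun x => normc (F x) ^+ 2)).
Hypotheses (p1 : 1 < p) (sE : s = 2 / p) (tE : t = 2 - s).
Variable K : G -> R.
Hypothesis hK : prob_density mu K.
Hypothesis cK : centered mu pi1 K.
Variables (V W : set G) (eps : R).
Hypotheses (oV : open V) (V1 : V 1%g) (muV : (mu V < +oo)%E) (eps0 : 0 < eps).
Hypotheses (VW : V `<=` W) (VVW : forall x y, V x -> V y -> W (x * y)%g).
Hypothesis KW : forall g, W g -> eps <= K g.
Local Notation N := (sqmass mu F).
Local Notation corr := (mean_corr mu F s t K).
Local Notation sk := (skew mu F s t).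
Local Notation m := (fine (mu V)).

Let s0 : 0 < s := exponent_s_gt0 p1 sE.
Let t0 : 0 < t := exponent_t_gt0 p1 sE tE.
Let st : s + t = 2 := exponent_sum tE.

(** The subtracted term is a homomorphism, which leaves the defect of additivity unchanged, chosen
    so that the result vanishes at the lifts [x_ i] of the basis vectors. *)
Definition centered_skew (g : G) : R := sk g - \sum_i pi1 g ord0 i * sk (x_ i).

Lemma continuous_coord i : continuous (fun g => pi1 g ord0 i).
Proof.
move=> g; apply: (@continuous_comp _ _ _ pi1 (fun y : 'rV_q => y ord0 i)); first exact: cpi1.
exact: coord_continuous.
Qed.

(** The 16 comes from [skew_quasihom], and 64 = 16 * 4 combines it with [energy_le_mean]. On compact
    sets, [sk] is bounded by [2 N] and the linear part by continuity. *)
Lemma quasihom_skew : quasihom V [set x_ i | i in setT]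
  (fun g => 16 * energy mu F 1 g) centered_skew (64 / (eps * m) * mean_energy mu F K 1).
Proof.
have m0 := haar_V_gt0 sc haar oV V1 muV.
split => [g|g h|g|g Vg|g h|_ [i _ <-]|C cC].
- by rewrite mulr_ge0// energy_ge0.
- by have := energyM haar mF iF g h; lra.
- by rewrite (energyV haar mF iF).
- have := energy_le_mean sc haar mF iF hK oV muV eps0 VW VVW KW Vg.
  have em : 0 < eps * m by exact: mulr_gt0.
  move=> h; rewrite mulrAC ler_pdivlMr//; move: h.
  by move: (energy _ _ _ _) (mean_energy _ _ _ _) (eps * m) => a b c; lra.
- apply: le_trans (skew_quasihom haar mF iF s0 t0 st g h).
  rewrite le_eqVlt; apply/orP; left; apply/eqP; congr (`|_|).
  rewrite /centered_skew pi1M.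
  have -> : \sum_i (pi1 g + pi1 h) ord0 i * sk (x_ i) =
     \sum_i pi1 g ord0 i * sk (x_ i) + \sum_i pi1 h ord0 i * sk (x_ i).
    by rewrite -big_split; apply: eq_bigr => i _; rewrite mxE mulrDl.
  by move: (sk _) (sk g) (sk h) (\sum_i _) (\sum_i _) => a b c u v; lra.
- rewrite /centered_skew (bigD1 i)//= pi1x mxE !eqxx mul1r big1 ?addr0 ?subrr// => j ji.
  by rewrite mxE eqxx /= (negPf ji) mul0r.
- have cf : continuous (fun g => \sum_i pi1 g ord0 i * sk (x_ i)).
    apply: continuous_big => [|i _ g]; first by move=> z; apply: cvgD; [exact: cvg_fst|exact: cvg_snd].
    by apply: cvgMl; exact: continuous_coord.
  have [A [_ hA]] := @compact_bounded R R^o _ (continuous_compact (continuous_subspaceT cf) cC).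
  exists (2 * N + (A + 1)) => g Cg; apply: (le_trans (ler_normB _ _)); apply: lerD.
    exact: skew_bounded.
  by apply: (hA (A + 1)); [rewrite ltrDl|exists g].
Qed.

Lemma measurable_skew : measurable_fun [set: borel G] sk.
Proof.
rewrite (_ : sk = correlation mu F s t (- 'i%C)); last by apply/funext => g; rewrite skewE.
exact: measurable_correlation.
Qed.

Variables (U : set G) (C M : R).
Hypotheses (oU : open U) (U1 : U 1%g) (C0 : 0 < C).
Hypothesis hC : forall E gam Q, quasihom V [set x_ i | i in setT] E gam Q ->
  forall n g, set_power U n g -> `|gam g| <= C * 16 ^+ n * Q.
Hypothesis KM : (\int[mu]_g (K g * expR (ln 16 * rho R U g))%:E <= M%:E)%E.

(** Centering enters here: the coordinates integrate to 0 against [K], so [sk] and [centered_skew]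
    have the same mean, and word growth with the exponential moment bounds the latter. *)
Lemma mean_skew_le :
  eps * m * `|corr (- 'i%C)| <= 64 * C * M * mean_energy mu F K 1.
Proof.
have m0 := haar_V_gt0 sc haar oV V1 muV.
have em : 0 < eps * m by exact: mulr_gt0.
set Q := 64 / (eps * m) * mean_energy mu F K 1.
have Q0 : 0 <= Q.
  by rewrite mulr_ge0 ?(mean_energy_ge0 _ hK)// divr_ge0// ltW.
have mcoord i : measurable_fun [set: borel G] (fun g : borel G => pi1 g ord0 i).
  by apply: continuous_borel_real; exact: continuous_coord.
have mgam : measurable_fun [set: borel G] centered_skew.
  apply: measurable_funB; first exact: measurable_skew.
  apply: (@measurable_sum _ _ _ _ _ _ (fun i (g : borel G) => pi1 g ord0 i * sk (x_ i))) => i.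
  by apply: measurable_funM => //; exact: measurable_cst.
have [|ig gle] := exp_moment_bound cG hK oU U1 (mulr_ge0 (ltW C0) Q0) mgam _ KM.
  by move=> n g ng; rewrite mulrAC; exact: (hC quasihom_skew).
have [|iS S0] := Rint_sum_eq0 (mu := mu) (index_enum 'I_q)
    (f := fun i g => K g * (pi1 g ord0 i * sk (x_ i))).
  move=> i; have [ii i0] := centered_Rint hK (mcoord i) cK.
  have e g : K g * (pi1 g ord0 i * sk (x_ i)) = sk (x_ i) * (K g * pi1 g ord0 i).
    by rewrite mulrA mulrC.
  rewrite (funext e); split; first exact: integZ.
  by rewrite (RintZ _ ii) i0 mulr0.
have corrE : corr (- 'i%C) = \int[mu]_g (K g * centered_skew g).
  rewrite -[RHS]addr0 -[X in _ = _ + X]S0 -(RintD ig iS); apply: eq_Rintegral => g _.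
  by rewrite -skewE /centered_skew mulrBr mulr_sumr subrK.
rewrite corrE mulrC -ler_pdivlMr//; apply: (le_trans gle).
rewrite /Q; move: (mean_energy _ _ _ _) => a.
have -> : C * (64 / (eps * m) * a) * M = 64 * C * M * a / (eps * m) by field; rewrite gt_eqF//= gt_eqF.
by [].
Qed.

(** The numerator adds [64 C M] from [mean_skew_le] and [10] from [sqmass_le_mean], so that one [D]
    serves both estimates; it involves neither [F] nor the density. *)
Lemma uniform_resolvent_bound : 0 <= M ->
  let D := (64 * C * M + 10) / (eps * m * (Num.min s t / 4)) in
  forall l : R[i], 1 < normc l -> normc l <= 2 ->
  normc (l - 1) * lpnorm mu p (fun x => radial s (F x)) <=
  (2 * (2 + D) + 2 * (1 + D) ^+ 2) *
    lpnorm mu p (fun x => l * radial s (F x) - conv_op mu K (fun x => radial s (F x)) x).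
Proof.
move=> M0 D.
have m0 := haar_V_gt0 sc haar oV V1 muV.
have em : 0 < eps * m by exact: mulr_gt0.
have c0 : 0 < Num.min s t / 4 by rewrite divr_gt0// lt_min s0.
have CM : 0 <= 64 * C * M by rewrite !mulr_ge0// ltW.
have D0 : 0 <= D.
  by apply: divr_ge0; [apply: addr_ge0|apply: mulr_ge0; exact: ltW].
have gap z : normc z = 1 -> Num.min s t / 4 * mean_energy mu F K z <= N - corr z.
  by move=> z1; exact: (mean_energy_corr sc haar mF iF p1 sE tE hK z1).
have E0 z : 0 <= mean_energy mu F K z := mean_energy_ge0 _ hK z.
have key z (b a : R) : normc z = 1 -> 0 <= b -> b <= 64 * C * M + 10 ->
    eps * m * a <= b * mean_energy mu F K z -> a <= D * (N - corr z).
  move=> z1 b0 bD ab.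
  rewrite /D mulrAC ler_pdivlMr; last exact: mulr_gt0.
  have h1 := ler_wpM2r (ltW c0) ab.
  have h2 := ler_wpM2l b0 (gap z z1).
  have h3 : b * (N - corr z) <= (64 * C * M + 10) * (N - corr z).
    apply: ler_wpM2r => //; apply: le_trans (gap z z1); apply: mulr_ge0 => //; exact: ltW.
  move: h1 h2 h3; move: (mean_energy _ _ _ _) (N - _) (Num.min s t / 4) (eps * m)
    (64 * C * M + 10) => e n c k d h1 h2 h3.
  have -> : a * (k * c) = k * a * c by ring.
  apply: le_trans h3; apply: le_trans h2; apply: (le_trans h1).
  by rewrite le_eqVlt; apply/orP; left; apply/eqP; ring.
have n1 : normc (1 : R[i]) = 1 by rewrite Normc.normc1.
apply: (resolvent_bound sc haar mF iF p1 sE tE hK D0) => [|z z1|z z1].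
- apply: (key 1 (64 * C * M)) => //; [by rewrite lerDl|exact: mean_skew_le].
- apply: (key z 10) => //; first by rewrite lerDr.
  exact: (sqmass_le_mean sc haar mF iF hK oV V1 muV eps0 VW VVW KW z1).
- by apply: le_trans (gap z z1); apply: mulr_ge0 => //; exact: ltW.
Qed.

End MeanSkew.

Lemma ae_imp (R : realType) d (T : measurableType d) (mu : {measure set T -> \bar R})
  (P Q : T -> Prop) : (forall x, P x -> Q x) ->
  {ae mu, forall x, P x} -> {ae mu, forall x, Q x}.
Proof. by move=> PQ; apply: filterS. Qed.

(** * The L^p norm and polynomials in the convolution operator *)

Section LpNorm.
Variables (R : realType) (G : topologicalGroupType).
Variable mu : {sigma_finite_measure set (borel G) -> \bar R}.
Variable p : R.
Hypothesis p1 : 1 < p.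
Implicit Types u v : borel G -> R[i].
Local Notation "'N[ u ]" := (lpnorm mu p u) (format "''N[' u ]").

Let p0 : 0 < p := lt_trans ltr01 p1.

Lemma in_LpW u : in_Lp mu p u -> Lp mu p u.
Proof.
move=> [mu' nu]; split=> //.
apply/integ_ge0P; [exact: measurable_normc_powR|by move=> x; exact: powR_ge0|].
have := powR_Lnorm mu (fun x => (normc (u x))%:E) (negbT (gt_eqF p0)).
under eq_integral => x _ do rewrite /= ger0_norm ?normc_ge0//.
by move=> <-; rewrite poweR_lty.
Qed.

Lemma lpnorm_ae u v : cmeas u -> cmeas v -> {ae mu, forall x, u x = v x} -> 'N[u] = 'N[v].
Proof.
move=> mu' mv uv; apply: (congr1 (@powR R ^~ p^-1)).
apply: ae_eq_Rint; [exact: measurable_normc_powR|exact: measurable_normc_powR|].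
by apply: ae_imp uv => x /= ->.
Qed.

Lemma lpnormZ (z : R[i]) u : Lp mu p u -> 'N[fun x => z * u x] = normc z * 'N[u].
Proof.
move=> [mu' iu]; rewrite /lpnorm.
have e x : normc (z * u x) `^ p = normc z `^ p * normc (u x) `^ p.
  by rewrite Normc.normcM powRM ?normc_ge0.
rewrite (funext e) (RintZ _ iu) powRM ?powR_ge0//; last first.
  by apply: Rintegral_ge0 => x _; exact: powR_ge0.
by rewrite -powRrM divff ?gt_eqF// powRr1// normc_ge0.
Qed.

Lemma lpnormD u v : Lp mu p u -> Lp mu p v -> 'N[fun x => u x + v x] <= 'N[u] + 'N[v].
Proof.
move=> Lu Lv; have [mu' iu] := Lu; have [mv iv] := Lv.
have Lc w : Lp mu p w -> Lp mu p (fun x => (normc (w x))%:C%C).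
  move=> [mw iw]; split; first by apply: cmeas_real; exact: cmeas_normc.
  have e x : normc ((normc (w x))%:C%C : R[i]) = normc (w x).
    by rewrite normc_real ger0_norm// normc_ge0.
  by under [X in integ _ X]funext do rewrite e.
have Lw := LpD p1 (Lc _ Lu) (Lc _ Lv).
have Luv := LpD p1 Lu Lv.
have wE x : normc ((normc (u x))%:C%C + (normc (v x))%:C%C : R[i]) = normc (u x) + normc (v x).
  by rewrite -(rmorphD (real_complex R)) normc_real ger0_norm// addr_ge0// normc_ge0.
apply: (@le_trans _ _ 'N[fun x => (normc (u x))%:C%C + (normc (v x))%:C%C]).
  apply: powR_homo; [by rewrite invr_ge0 ltW|by apply: Rintegral_ge0 => x _; exact: powR_ge0|].
  apply: le_Rint; [by case: Luv|by case: Lw|] => x.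
  by apply: powR_homo; [exact: ltW|exact: normc_ge0|rewrite wE; exact: normcD].
suff : (Cnorm mu p (fun x => (normc (u x))%:C%C + (normc (v x))%:C%C)%R <=
        Cnorm mu p u + Cnorm mu p v)%E.
  by rewrite (CnormE Lw) (CnormE Lu) (CnormE Lv) -EFinD lee_fin.
rewrite /Cnorm.
have -> : (fun x => (normc ((normc (u x))%:C%C + (normc (v x))%:C%C))%:E) =
    EFin \o ((fun x => normc (u x)) \+ (fun x => normc (v x))).
  by apply/funext => x; rewrite wE.
exact: (minkowski_EFin mu (cmeas_normc mu') (cmeas_normc mv) (ltW p1)).
Qed.

End LpNorm.

Section PolynomialCalculus.
Variables (R : realType) (G : topologicalGroupType).
Variable mu : {sigma_finite_measure set (borel G) -> \bar R}.
Hypothesis sc : @second_countable G.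
Hypothesis haar : left_haar mu.
Variable K : G -> R.
Hypothesis hK : prob_density mu K.
Variable p : R.
Hypothesis p1 : 1 < p.
Local Notation "'N[ u ]" := (lpnorm mu p u) (format "''N[' u ]").
Local Notation T := (conv_op mu K).

Let p0 : 0 < p := lt_trans ltr01 p1.

Lemma lpnorm_conv u : Lp mu p u -> 'N[T u] <= 'N[u].
Proof.
move=> Lu; have [mu' iu] := Lu; have [mT iT] := Lp_conv sc haar hK p1 Lu.
apply: powR_homo; [by rewrite invr_ge0 ltW|by apply: Rintegral_ge0 => x _; exact: powR_ge0|].
by rewrite -lee_fin -(integ_EFin iT) -(integ_EFin iu); exact: (conv_contraction sc haar hK p1).
Qed.

Variables (f : borel G -> R[i]).
Hypothesis Lf : Lp mu p f.

Lemma Lp_iter k : Lp mu p (iter k T f).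
Proof. by elim: k => //= k; exact: Lp_conv. Qed.

(** The representative [P(T) f]. Linearity in [P] holds at every point, while applying [T]
    corresponds to multiplication by [X] only almost everywhere. *)
Definition pcalc (P : {poly R[i]}) (x : borel G) : R[i] :=
  \sum_(k < size P) P`_k * iter k T f x.

Lemma pcalc_widen n (P : {poly R[i]}) x : (size P <= n)%N ->
  pcalc P x = \sum_(k < n) P`_k * iter k T f x.
Proof.
move=> Pn; rewrite /pcalc (big_ord_widen n (fun k => P`_k * iter k T f x))//.
rewrite big_mkcond; apply: eq_bigr => k _; case: ltnP => // kP.
by rewrite nth_default ?mul0r.
Qed.

Lemma pcalcD P Q x : pcalc (P + Q) x = pcalc P x + pcalc Q x.
Proof.
have sP := leq_maxl (size P) (size Q); have sQ := leq_maxr (size P) (size Q).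
rewrite (pcalc_widen _ sP) (pcalc_widen _ sQ) (pcalc_widen _ (size_polyD P Q)) -big_split.
by apply: eq_bigr => k _; rewrite coefD mulrDl.
Qed.

Lemma pcalcZ l P x : pcalc (l *: P) x = l * pcalc P x.
Proof.
rewrite (pcalc_widen _ (size_scale_leq l P)) /pcalc mulr_sumr.
by apply: eq_bigr => k _; rewrite coefZ mulrA.
Qed.

Lemma pcalcXn n x : pcalc 'X^n x = iter n T f x.
Proof.
rewrite /pcalc size_polyXn big_ord_recr /= coefXn eqxx mul1r big1 ?add0r// => k _.
by rewrite coefXn ltn_eqF ?mul0r.
Qed.

Lemma pcalcXM P x : pcalc ('X * P) x = \sum_(k < size P) P`_k * iter k.+1 T f x.
Proof.
have sXP : (size ('X * P)%R <= (size P).+1)%N.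
  by apply: leq_trans (size_polyMleq _ _) _; rewrite size_polyX.
rewrite (pcalc_widen _ sXP) big_ord_recl coefXM eqxx mul0r add0r.
by apply: eq_bigr => k _; rewrite coefXM.
Qed.

Lemma Lp_sum (c : nat -> R[i]) (h : nat -> borel G -> R[i]) n :
  (forall k, Lp mu p (h k)) -> Lp mu p (fun x => \sum_(k < n) c k * h k x).
Proof.
move=> Lh; elim: n => [|n ih].
  by under [X in Lp _ _ X]funext do rewrite big_ord0; exact: Lp0.
under [X in Lp _ _ X]funext do rewrite big_ord_recr /=.
by apply: LpD => //; exact: LpZ.
Qed.

Lemma Lp_pcalc P : Lp mu p (pcalc P).
Proof. exact: (Lp_sum (fun k => P`_k) _ Lp_iter). Qed.

Lemma conv_sum_ae (c : nat -> R[i]) (h : nat -> borel G -> R[i]) n :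
  (forall k, Lp mu p (h k)) ->
  {ae mu, forall x, T (fun y => \sum_(k < n) c k * h k y) x = \sum_(k < n) c k * T (h k) x}.
Proof.
move=> Lh; elim: n => [|n ih].
  have e (y : borel G) : \sum_(k < 0) c k * h k y = 0 * 0 by rewrite big_ord0 mul0r.
  rewrite (funext e).
  apply: ae_imp (conv_scale_ae sc haar hK p1 0 (Lp0 mu p1)) => x ->.
  by rewrite big_ord0 mul0r.
have e (y : borel G) : \sum_(k < n.+1) c k * h k y =
    \sum_(k < n) c k * h k y + c n * h n y by rewrite big_ord_recr.
rewrite (funext e).
have hadd := conv_add_ae sc haar hK p1 (Lp_sum c n Lh) (LpZ (c n) (Lh n)).
apply: (ae_imp2 _ hadd (ae_imp2 (fun x a b => conj a b) (conv_scale_ae sc haar hK p1 (c n) (Lh n)) ih)).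
by move=> x -> [-> ->]; rewrite big_ord_recr.
Qed.

Lemma conv_pcalc_ae P : {ae mu, forall x, T (pcalc P) x = pcalc ('X * P) x}.
Proof.
apply: ae_imp (conv_sum_ae (fun k => P`_k) (size P) Lp_iter) => x Tx.
by rewrite pcalcXM [LHS]Tx.
Qed.

Variable kap : R.
Hypothesis kap0 : 0 <= kap.
Hypothesis res : forall v, Lp mu p v -> forall l, 1 < normc l -> normc l <= 2 ->
  normc (l - 1) * 'N[v] <= kap * 'N[fun x => l * v x - T v x].

Lemma iter_decay n :
  'N[fun x => iter n T f x - iter n.+1 T f x] <=
    48 * kap ^+ 2 * (1 + kap) * pi ^+ 2 / n.+1%:R * 'N[f].
Proof.
have cP P := (Lp_pcalc P).1.
have [LT cT] : (forall P, Lp mu p (T (pcalc P))) /\ forall P, cmeas (T (pcalc P) : borel G -> R[i]).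
  have h P : Lp mu p (T (pcalc P)) by apply: Lp_conv => //; exact: Lp_pcalc.
  by split => // P; case: (h P).
have := polynomial_decay (nu := fun P => 'N[pcalc P]) (kap := kap) _ _ _ _ kap0 n.
have -> : pcalc 1 = f by apply/funext => x; rewrite -(expr0 'X) pcalcXn.
have -> : pcalc ('X^n * (1 - 'X)) = (fun x => iter n T f x - iter n.+1 T f x).
  apply/funext => x; rewrite mulrBr mulr1 -exprSr -scaleN1r.
  by rewrite pcalcD pcalcZ !pcalcXn mulN1r.
apply => [P Q|l P|P|l P l1 l2].
- rewrite (funext (pcalcD P Q)); exact: lpnormD (Lp_pcalc P) (Lp_pcalc Q).
- rewrite (funext (pcalcZ l P)); exact: lpnormZ (Lp_pcalc P).
- rewrite -(lpnorm_ae p (cT P) (cP _) (conv_pcalc_ae P)).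
  exact: lpnorm_conv (Lp_pcalc P).
- have mr : cmeas (fun x => l * pcalc P x - T (pcalc P) x : R[i]).
    by apply: cmeasB => //; exact: cmeasZ.
  have e : {ae mu, forall x : borel G,
      l * pcalc P x - T (pcalc P) x = pcalc ((l%:P - 'X) * P) x}.
    apply: ae_imp (conv_pcalc_ae P) => x ->.
    have -> : (l%:P - 'X) * P = l *: P + (-1) *: ('X * P).
      by rewrite mulrBl mul_polyC scaleN1r.
    by rewrite pcalcD !pcalcZ mulN1r.
  rewrite -(lpnorm_ae p mr (cP _) e); exact: res (Lp_pcalc P) l l1 l2.
Qed.

End PolynomialCalculus.

(** Fubini's theorem is used for a bundled sigma-finite measure; unpacking the record first makes
    the bundled measure convertible to the given one. *)
Lemma sigma_finite_package (R : realType) d (T : measurableType d)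
    (mu : {measure set T -> \bar R}) : sigma_finite [set: T] mu ->
  exists nu : {sigma_finite_measure set T -> \bar R}, (nu : {measure set T -> \bar R}) = mu.
Proof.
case: mu => mu0 mu1 h.
pose mu := @Measure.Pack d T R mu0 mu1.
pose H := Measure_isSigmaFinite.Build d T R mu h.
pose nu : {sigma_finite_measure set T -> \bar R} := HB.pack mu0 mu H.
exists nu; rewrite /nu /=.
reflexivity.
Qed.

Lemma lt0_ereal_real (R : realType) (x : \bar R) : (0 < x)%E -> exists2 e : R, 0 < e & (e%:E <= x)%E.
Proof. by case: x => [r r0||//]; [exists r|exists 1 => //; rewrite leey]. Qed.

Lemma ltey_real (R : realType) (x : \bar R) : (x < +oo)%E -> exists2 M : R, 0 <= M & (x <= M%:E)%E.
Proof.
case: x => [r _|//|_]; last by exists 0 => //; rewrite leNye.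
by exists (Num.max r 0); [rewrite le_max lexx orbT|rewrite lee_fin le_max lexx].
Qed.

(** * Uniform constants for the whole family *)

Section Decay.
Variables (R : realType) (d : nat) (G : lieGroupType R d).
Variables (mu : {sigma_finite_measure set (borel G) -> \bar R}) (U : set G).
Variables (q r : nat).
Variable phi0 : left_quotient (closed_commutator G) -> 'rV[R]_q * 'rV[circle R]_r.
Variable phi1 : left_quotient (torus_preimage phi0) -> 'rV[R]_q.
Variables (A : Type) (K : A -> G -> R).
Hypotheses (cG : connected [set: G]) (haar : left_haar mu) (hU : distance_neighborhood U).
Hypotheses (iso0 : quotient_iso phi0 +%R) (iso1 : quotient_iso phi1 +%R).
Hypothesis hK : forall a, prob_density mu (K a).
Hypothesis cK : forall a, centered mu (phi1 \o left_proj (torus_preimage phi0)) (K a).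
Variable W : set G.
Hypothesis W1 : nbhs 1%g W.
Hypothesis infK : (0 < ereal_inf [set (K a g)%:E | a in [set: A] & g in W])%E.
Hypothesis expK : forall k : R, 0 < k ->
     (ereal_sup [set (\int[mu]_g (K a g * expR (k * rho R U g))%:E)%E
                | a in [set: A]] < +oo)%E.
Variable p : R.
Hypothesis p1 : 1 < p.

Let sc : @second_countable G := @lie_second_countable R d G.
Let p0 : 0 < p := lt_trans ltr01 p1.

(** Every [v] in [L^p] is [radial (2/p)] of the [L^2] function [radial (p/2) v], so estimates in
    terms of [F] cover all of [L^p]. The set [V], the lifts and all constants are fixed before [a]
    and [v]. *)
Lemma uniform_resolvent : exists2 kap : R, 0 <= kap & forall a v, Lp mu p v ->
  forall l : R[i], 1 < normc l -> normc l <= 2 ->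
  normc (l - 1) * lpnorm mu p v <=
    kap * lpnorm mu p (fun x => l * v x - conv_op mu (K a) v x).
Proof.
have [oU pU U1 _] := hU.
have cU : compact (closure U) by rewrite -precompactE.
have [eps eps0 epsle] := lt0_ereal_real infK.
have KW a g : (W `&` U) g -> eps <= K a g.
  move=> [Wg _]; rewrite -lee_fin; apply: (le_trans epsle).
  by apply: ereal_inf_lbound; exists a => //; exists g.
have [M M0 Mle] := ltey_real (expK (ln_gt0 (ltr1n R 16))).
have KM a : (\int[mu]_g (K a g * expR (ln 16 * rho R U g))%:E <= M%:E)%E.
  by apply: le_trans Mle; apply: ereal_sup_ubound; exists a.
(* Intersecting with [U] makes [V] precompact, hence of finite measure. *)
have [|V [oV V1 VW VVW]] := @mulg_nbhs1 G (W `&` U).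
  by apply: filterI => //; exact: open_nbhs_nbhs.
have pV : precompact V by apply: precompact_subset pU => g /VW[].
have muV := haar_precompact_lty haar oV pV.
have [x_ xE] := choice (fun i => phi1_surjective iso1 (delta_mx ord0 i)).
pose X := [set x_ i | i in setT].
have [B [cB VB coB]] : exists B, [/\ compact B, V `<=` B &
    forall g, exists b l, [/\ B b, good R V X l & g = (b * l)%g]].
  apply: (cocompact_good iso0 iso1 oV V1).
  - by rewrite -precompactE.
  - exact: good1.
  - exact: goodM.
  - exact: goodV.
  - exact: good_commutator_subgroup.
  - by move=> i; exists (x_ i) => //; apply: good_X; exists i.
have [C C0 hC] := quasihom_word_growth oV V1 cG cB VB coB cU.
pose s := 2 / p; pose t := 2 - s.
pose D := (64 * C * M + 10) / (eps * fine (mu V) * (Num.min s t / 4)).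
exists (2 * (2 + D) + 2 * (1 + D) ^+ 2).
  have m0 := haar_V_gt0 sc haar oV V1 muV.
  have s0 : 0 < s := exponent_s_gt0 p1 erefl.
  have t0 : 0 < t := exponent_t_gt0 p1 erefl erefl.
  have D0 : 0 <= D.
    apply: divr_ge0; first by rewrite addr_ge0// !mulr_ge0// ltW.
    by rewrite !mulr_ge0 ?invr_ge0// ?ltW// lt_min s0.
  by rewrite addr_ge0 ?mulr_ge0 ?sqr_ge0// addr_ge0.
move=> a v [mv iv] l l1 l2.
pose F (x : borel G) := radial (p / 2) (v x).
have vE : (fun x => radial s (F x)) = v.
  apply/funext => x; rewrite /F radial_comp ?divr_gt0//.
  have -> : s * (p / 2) = 1 by rewrite /s; field; rewrite gt_eqF.
  exact: radial1.
have iF : integ mu (fun x => normc (F x) ^+ 2).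
  have e x : normc (F x) ^+ 2 = normc (v x) `^ p.
    rewrite normc_radial ?divr_gt0// -(powR_mulrn 2 (powR_ge0 _ _)) -powRrM divfK//.
  by rewrite (funext e).
have pi1M g h : (phi1 \o left_proj (torus_preimage phi0)) (g * h)%g =
    (phi1 \o left_proj (torus_preimage phi0)) g + (phi1 \o left_proj (torus_preimage phi0)) h.
  by have [_ h1] := iso1; exact: h1.
(* [F] itself mentions [v], so the function is generalized to [w] before being replaced by
   [radial s] of [F]. *)
suff key w : w = (fun x => radial s (F x)) -> normc (l - 1) * lpnorm mu p w <=
    (2 * (2 + D) + 2 * (1 + D) ^+ 2) * lpnorm mu p (fun x => l * w x - conv_op mu (K a) w x).
  exact: key (esym vE).
move=> ->; exact: (uniform_resolvent_bound sc haar cG pi1M (phi1_continuous iso1) xE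
  (cmeas_radial (p / 2) mv) iF p1 erefl erefl (hK a) (cK a) oV V1 muV eps0 VW VVW (KW a)
  oU U1 C0 hC (KM a) M0 l1 l2).
Qed.

Lemma uniform_decay : exists2 c : R, 0 < c &
    forall (n : nat) (a : A), (0 < n)%N ->
      let T := conv_op mu (K a) in
      (opnorm mu p p (fun f => iter n T f \- T (iter n T f))%R
        <= (c * n%:R^-1)%:E)%E.
Proof.
have [kap kap0 res] := uniform_resolvent.
set c := 48 * kap ^+ 2 * (1 + kap) * pi ^+ 2.
have c0 : 0 <= c.
  apply: mulr_ge0 (sqr_ge0 _); apply: mulr_ge0; last by apply: addr_ge0.
  by apply: mulr_ge0 (sqr_ge0 _).
(* Only [0 <= kap] is known, so [c] may vanish; adding 1 makes the constant positive. *)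
exists (c + 1); first by rewrite ltr_pwDr.
move=> n a n0; cbv zeta; set T := conv_op mu (K a); apply: ge_ereal_sup => _ [f [/(in_LpW p1) Lf nf] <-].
have hn := iter_decay sc haar (hK a) p1 Lf kap0 (res a) n.
have Lk k := Lp_iter sc haar (hK a) p1 Lf k.
have Ld : Lp mu p (fun x => iter n T f x - iter n.+1 T f x).
  have := LpD p1 (Lk n) (LpZ (-1) (Lk n.+1)).
  by under [X in Lp _ _ X]funext do rewrite mulN1r.
have nf1 : lpnorm mu p f <= 1 by move: nf; rewrite (CnormE Lf) lee_fin.
have -> : Cnorm mu p (iter n T f \- T (iter n T f)) = (lpnorm mu p (fun x => iter n T f x - iter n.+1 T f x))%:E.
  exact: CnormE Ld.
rewrite lee_fin; apply: (le_trans hn).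
apply: (@le_trans _ _ (c / n.+1%:R)).
  by rewrite ler_piMr// divr_ge0.
apply: ler_pM => //; first by rewrite lerDl.
by rewrite lef_pV2 ?posrE ?ltr0n// ler_nat.
Qed.

End Decay.

Theorem theorem1p13 (R : realType) (d : nat) (G : lieGroupType R d)
    (mu : {measure set (borel G) -> \bar R}) (U : set G)
    (q r : nat) (phi0 : left_quotient (closed_commutator G) -> 'rV[R]_q * 'rV[circle R]_r)
    (phi1 : left_quotient (torus_preimage phi0) -> 'rV[R]_q)
    (A : Type) (K : A -> G -> R) :
  connected [set: G] ->
  left_haar mu ->
  distance_neighborhood U ->
  quotient_iso phi0 +%R ->
  quotient_iso phi1 +%R ->
  (forall a, prob_density mu (K a)) ->
  (forall a, centered mu (phi1 \o left_proj (torus_preimage phi0)) (K a)) ->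
  (exists2 W : set G, nbhs 1%g W &
     (0 < ereal_inf [set (K a g)%:E | a in [set: A] & g in W])%E) ->
  (forall k : R, 0 < k ->
     (ereal_sup [set (\int[mu]_g (K a g * expR (k * rho R U g))%:E)%E
                | a in [set: A]] < +oo)%E) ->
  forall p : R, 1 < p ->
  exists2 c : R, 0 < c &
    forall (n : nat) (a : A), (0 < n)%N ->
      let T := conv_op mu (K a) in
      (opnorm mu p p (fun f => iter n T f \- T (iter n T f))%R
        <= (c * n%:R^-1)%:E)%E.
Proof.
move=> cG haar hU iso0 iso1 hK cK [W W1 infK] expK p p1.
have [oU pU U1 _] := hU.
have [nu nuE] :=
  sigma_finite_package (haar_sigma_finite (@lie_second_countable R d G) haar oU pU U1).
move: haar hK cK expK; rewrite -nuE => haar hK cK expK.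
exact: (uniform_decay cG haar hU iso0 iso1 hK cK W1 infK expK p1).
Qed.
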